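(* Let $n\ge1$ and let $\boldsymbol Q$ be a symmetric positive definite $n\times n$ matrix with $Q^{j,j}=1$ and $Q^{j,j'}\in[-1,1]$. Let $\mathscr C(x,\Phi)$ be the Crisanti--Sommers functional defined in the context on pairs $(x,\Phi)$ with $|\boldsymbol Q-\Phi(t_x)|>0$. Then $\mathscr C$ attains its minimum (over all such pairs) on the compact set $$A_{T,L}=\{(x,\Phi): x(t)=1\text{ for }t\ge T\text{ and }\|(\boldsymbol Q-\Phi(t_x))^{-1}\|_\infty\le L\},$$ where the constants $$T=n-\frac1{\sqrt n}e^{-(\langle\vec h\vec h^{\mathsf T}+\boldsymbol\xi'(\boldsymbol Q),\boldsymbol Q\rangle+n-\log|\boldsymbol Q|)},\qquad L=\sqrt n\,e^{\langle\vec h\vec h^{\mathsf T}+\boldsymbol\xi'(\boldsymbol Q),\boldsymbol Q\rangle+n-\log|\boldsymbol Q|}$$ only depend on the fixed parameters of the model. Compactness is with respect to the distance $\|x_1-x_2\|_1+\|\Phi_1-\Phi_2\|_\infty$.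
   Context: Parameters: $\vec h\in\mathbb R^n$ and $\vec\beta_p\in\mathbb R^n$ for $p\ge2$, with $\vec\beta_p=\vec 0$ for odd $p$ and $\sum_{p\ge2}2^p\vec\beta_p(j)^2<\infty$ for all $j\le n$. Notation: $\langle\boldsymbol A,\boldsymbol B\rangle=\operatorname{tr}(\boldsymbol A\boldsymbol B)$, $|\cdot|$ is the determinant, $\|\cdot\|_\infty$ of a matrix is the infinity norm (maximum absolute entry), $\mathbb S^n_+$ is the set of $n\times n$ positive semidefinite matrices, $\odot$ and $\boldsymbol A^{\circ p}$ denote the Hadamard (entrywise) product and power, and $\boldsymbol\xi'(\boldsymbol A)=\sum_{p\ge2}p(\vec\beta_p\vec\beta_p^{\mathsf T})\odot\boldsymbol A^{\circ(p-1)}$. Pairs $(x,\Phi)$: $x:[0,n]\to[0,1]$ is right-continuous and non-decreasing with $x(0)=0$ and $x(n)=1$; $\Phi:[0,n]\to\mathbb S^n_+$ is a path that is 1-Lipschitz in each coordinate, monotone ($\Phi(t_2)-\Phi(t_1)\in\mathbb S^n_+$ for $t_2\ge t_1$), with $\operatorname{tr}\Phi(t)=t$, $\Phi(0)=\boldsymbol 0$, $\Phi(n)=\boldsymbol Q$; its coordinatewise derivative $\Phi'$ exists almost everywhere. Put $t_x=\inf\{t\in[0,n]:x(t)\ge1\}$, $\hat\Phi(t)=\int_t^nx(s)\Phi'(s)\,ds$, and, when $|\boldsymbol Q-\Phi(t_x)|>0$, $$\mathscr C(x,\Phi)=\frac12\bigg(\int_0^nx(t)\langle\boldsymbol\xi'(\Phi(t))+\vec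 h\vec h^{\mathsf T},\Phi'(t)\rangle\,dt+\log|\Phi(n)-\Phi(t_x)|+\int_0^{t_x}\langle\hat\Phi(t)^{-1},\Phi'(t)\rangle\,dt\bigg).$$ Norms: $\|x_1-x_2\|_1=\int_0^n|x_1(t)-x_2(t)|\,dt$ and $\|\Phi_1-\Phi_2\|_\infty=\max_{i,j\le n}\sup_{t\in[0,n]}|\Phi_1^{i,j}(t)-\Phi_2^{i,j}(t)|$.
   Formalization: Right-continuity of x is required only on the open interval (0,n), so x may jump at 0 although x(0)=0; with right-continuity at 0 the set A_{T,L} is not compact and the minimum can fail to exist (n=1, Q=1, h=0, all beta_p=0). *)

(* Defs.v *)
From HB Require Import structures.
From mathcomp Require Import all_boot all_order all_algebra.
From mathcomp Require Import all_classical all_reals all_analysis.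
From mathcomp Require Import measurable_realfun.

Set Implicit Arguments.
Unset Strict Implicit.
Unset Printing Implicit Defensive.

Import Order.TTheory GRing.Theory Num.Theory.
Import numFieldNormedType.Exports.

Local Open Scope classical_set_scope.
Local Open Scope ring_scope.

Section Matrices.
Context {R : realType} {n : nat}.
Implicit Types A B : 'M[R]_n.

Definition mx_inner A B : R := \tr (A *m B).

Definition psdmx A : Prop :=
  A^T = A /\ forall v : 'cV[R]_n, 0 <= (v^T *m A *m v) 0 0.

Definition pdmx A : Prop :=
  A^T = A /\ forall v : 'cV[R]_n, v != 0 -> 0 < (v^T *m A *m v) 0 0.

(* The entries of the Hadamard series
   xi'(A) = \sum_(p >= 2) p (beta_p beta_p^T) (.) A^(.)(p - 1). *)
Definition xi' (beta : nat -> 'cV[R]_n) A : 'M[R]_n :=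
  \matrix_(i, j) limn (fun N => \sum_(2 <= p < N)
    p%:R * (beta p *m (beta p)^T) i j * A i j ^+ p.-1).

End Matrices.

(* The functions live on R, but only their values on [0, n] are constrained;
   the functional, the distance and the set csA depend only on these.
   As x(0) is pinned to 0, right-continuity is required on ]0, n[ only: a jump
   of x at 0 (an atom at 0 of the measure whose distribution function is x) is
   admissible.  Right-continuity at 0 as well would exclude the L^1-limits
   of 1_{t >= 1/k}, so that the set csA below would not be closed, and the
   minimum could fail to exist (already for n = 1, h = 0 and beta = 0). *)
Record cs_pair (R : realType) (n : nat) (Q : 'M[R]_n) := CSPair {
  csx : R -> R ;
  csPhi : R -> 'M[R]_n ;
  csx_range : forall t, 0 <= t <= n%:R -> 0 <= csx t <= 1 ;
  csx_nondecreasing : forall s t, 0 <= s -> s <= t -> t <= n%:R ->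
    csx s <= csx t ;
  csx_right_continuous : forall t, 0 < t < n%:R ->
    csx s @[s --> t^'+] --> csx t ;
  csx0 : csx 0 = 0 ;
  csxn : csx n%:R = 1 ;
  csPhi_psd : forall t, 0 <= t <= n%:R -> psdmx (csPhi t) ;
  csPhi_lipschitz : forall s t i j, 0 <= s <= n%:R -> 0 <= t <= n%:R ->
    `|csPhi t i j - csPhi s i j| <= `|t - s| ;
  csPhi_monotone : forall s t, 0 <= s -> s <= t -> t <= n%:R ->
    psdmx (csPhi t - csPhi s) ;
  csPhi_trace : forall t, 0 <= t <= n%:R -> \tr (csPhi t) = t ;
  csPhi0 : csPhi 0 = 0 ;
  csPhin : csPhi n%:R = Q
}.

Section Functional.
Context {R : realType} {n : nat} {Q : 'M[R]_n}.
Implicit Types p q : cs_pair Q.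

Local Notation mu := (@lebesgue_measure R).

(* Total functions: [derive1] has an irrelevant value on the null set where an
   entry of Phi is not differentiable. *)
Definition csPhi' p (t : R) : 'M[R]_n :=
  \matrix_(i, j) derive1 (fun s => csPhi p s i j) t.

Definition cs_tx p : R := inf [set t | 0 <= t <= n%:R /\ 1 <= csx p t].

Definition cs_gap p : 'M[R]_n := Q - csPhi p (cs_tx p).

Definition cs_dom : set (cs_pair Q) := [set p | 0 < \det (cs_gap p)].

Definition cs_hatPhi p (t : R) : 'M[R]_n :=
  \matrix_(i, j) \int[mu]_(s in `[t, n%:R]) (csx p s * csPhi' p s i j).

Definition CrisantiSommers (h : 'cV[R]_n) (beta : nat -> 'cV[R]_n) p : R :=
  2^-1 *
  (\int[mu]_(t in `[0, n%:R])
      (csx p t * mx_inner (xi' beta (csPhi p t) + h *m h^T) (csPhi' p t))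
   + ln (\det (csPhi p n%:R - csPhi p (cs_tx p)))
   + \int[mu]_(t in `[0, cs_tx p])
      mx_inner (invmx (cs_hatPhi p t)) (csPhi' p t)).

Definition csx_dist p q : R :=
  \int[mu]_(t in `[0, n%:R]) `|csx p t - csx q t|.

Definition csPhi_dist p q : R :=
  \big[Num.max/0]_(i < n) \big[Num.max/0]_(j < n)
    sup [set `|csPhi p t i j - csPhi q t i j| | t in `[0, n%:R]].

Definition cs_dist p q : R := csx_dist p q + csPhi_dist p q.

End Functional.

Section Topology.
Context {R : realType} {n : nat} {Q : 'M[R]_n}.
Implicit Types p q r : cs_pair Q.

Local Notation mu := (@lebesgue_measure R).

Lemma cs_distxx p : cs_dist p p = 0.
Proof.
rewrite /cs_dist /csx_dist /csPhi_dist.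
under eq_Rintegral do rewrite subrr normr0.
rewrite Rintegral_cst// mul0r add0r; apply/eqP; rewrite eq_le; apply/andP; split.
  apply/bigmax_leP; split=> // i _; apply/bigmax_leP; split=> // j _.
  apply: ge_sup; first by exists `|csPhi p 0 i j - csPhi p 0 i j|, 0 => //=;
    rewrite in_itv/= lexx ler0n.
  by move=> _ [t _ <-]; rewrite subrr normr0.
exact: bigmax_ge_id.
Qed.

Lemma cs_dist_sym p q : cs_dist p q = cs_dist q p.
Proof.
rewrite /cs_dist /csx_dist /csPhi_dist; congr (_ + _).
  by apply: eq_Rintegral => t _; rewrite distrC.
apply: eq_bigr => i _; apply: eq_bigr => j _; congr sup.
by apply: eq_imagel => t _; rewrite distrC.
Qed.

Let I0n : set R := `[0, n%:R].

Let measurable_I0n : measurable I0n. Proof. exact: measurable_itv. Qed.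

Let clamp (t : R) : R := Num.min (Num.max t 0) n%:R.

Let measurable_csx p : measurable_fun I0n (csx p).
Proof.
apply: (eq_measurable_fun (csx p \o clamp)).
  move=> t; rewrite inE /I0n /= in_itv /= => /andP[t0 tn].
  by rewrite /clamp (max_idPl t0) (min_idPl tn).
apply: nondecreasing_measurable; [exact: measurable_I0n|move=> s t st /=].
apply: csx_nondecreasing.
- by rewrite /clamp le_min ler0n andbT le_max lexx orbT.
- by rewrite /clamp le_min !ge_min lexx orbT andbT ge_max !le_max st lexx orbT.
- by rewrite /clamp ge_min lexx orbT.
Qed.

Let integrable_csx p q :
  mu.-integrable I0n (EFin \o (fun t => `|csx p t - csx q t|)).
Proof.
apply: measurable_bounded_integrable; first exact: measurable_I0n.
- by rewrite /= lebesgue_measure_itv /=; case: ifPn => // _; rewrite -EFinB ltry.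
- apply: measurableT_comp => //; apply: measurable_funB; exact: measurable_csx.
exists 1; split; first exact: num_real.
move=> M M1 t; rewrite /I0n /= in_itv /= => tn; rewrite normr_id.
have /andP[p0 p1] := csx_range p tn; have /andP[q0 q1] := csx_range q tn.
apply: le_trans (ltW M1); rewrite ler_norml; apply/andP; split.
  by rewrite lerBrDr (le_trans _ p0)// addrC subr_le0.
by rewrite lerBlDr (le_trans p1)// lerDl.
Qed.

Let csx_dist_triangle q p r : csx_dist p r <= csx_dist p q + csx_dist q r.
Proof.
rewrite /csx_dist -RintegralD; try exact: integrable_csx; last first.
  exact: measurable_I0n.
apply: le_Rintegral; first exact: measurable_I0n.
- exact: integrable_csx.
- have /= := @integrableD _ _ _ mu I0n measurable_I0n _ _
    (integrable_csx p q) (integrable_csx q r).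
  exact.
by move=> t _; exact: ler_distD.
Qed.

Let has_ubound_csPhi p q i j :
  has_ubound [set `|csPhi p t i j - csPhi q t i j| | t in I0n].
Proof.
exists (n%:R + n%:R) => _ [t It <-].
have tn : 0 <= t <= n%:R by move: It; rewrite /I0n /= in_itv.
have bnd (s : cs_pair Q) : `|csPhi s t i j| <= n%:R.
  have := @csPhi_lipschitz _ _ _ s 0 t i j _ tn.
  rewrite csPhi0 mxE !subr0 lexx ler0n => /(_ isT) /le_trans; apply.
  by case/andP: tn => t0 tn; rewrite ger0_norm.
by apply: (le_trans (ler_normB _ _)); rewrite lerD.
Qed.

Let csPhi_dist_triangle q p r :
  csPhi_dist p r <= csPhi_dist p q + csPhi_dist q r.
Proof.
have le_dist (s1 s2 : cs_pair Q) (t : R) i j : I0n t ->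
    `|csPhi s1 t i j - csPhi s2 t i j| <= csPhi_dist s1 s2.
  move=> t0n; pose S k l : R :=
    sup [set `|csPhi s1 u k l - csPhi s2 u k l| | u in I0n].
  apply: (@le_trans _ _ (S i j)).
    have /ubP ub := ub_le_sup (has_ubound_csPhi s1 s2 i j).
    by apply: ub; exists t.
  apply: (@le_trans _ _ (\big[Num.max/0]_(l < n) S i l)).
    exact: (le_bigmax _ (S i)).
  exact: (le_bigmax _ (fun k => \big[Num.max/0]_(l < n) S k l)).
have ge0 (s1 s2 : cs_pair Q) : 0 <= csPhi_dist s1 s2 by exact: bigmax_ge_id.
apply/bigmax_leP; split=> [|i _]; first exact: addr_ge0.
apply/bigmax_leP; split=> [|j _]; first exact: addr_ge0.
apply: ge_sup.
  exists `|csPhi p 0 i j - csPhi r 0 i j|, 0 => //=.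
  by rewrite in_itv/= lexx ler0n.
move=> _ [t t0n <-].
by apply: (le_trans (ler_distD (csPhi q t i j) _ _)); rewrite lerD// le_dist.
Qed.

Lemma cs_dist_triangle q p r : cs_dist p r <= cs_dist p q + cs_dist q r.
Proof. by rewrite /cs_dist addrACA lerD. Qed.

Definition cs_ball p (e : R) : set (cs_pair Q) := [set q | cs_dist p q < e].

Definition cs_ent : set_system (cs_pair Q * cs_pair Q) := entourage_ cs_ball.

Definition cs_nbhs p : set_system (cs_pair Q) := nbhs_ cs_ent p.

Lemma cs_nbhsE : cs_nbhs = nbhs_ cs_ent. Proof. by []. Qed.

Lemma cs_ball_center p (e : R) : 0 < e -> cs_ball p e p.
Proof. by rewrite /cs_ball /= cs_distxx. Qed.

Lemma cs_ball_sym p q (e : R) : cs_ball p e q -> cs_ball q e p.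
Proof. by rewrite /cs_ball /= cs_dist_sym. Qed.

Lemma cs_ball_triangle p q r e1 e2 :
  cs_ball p e1 q -> cs_ball q e2 r -> cs_ball p (e1 + e2) r.
Proof.
rewrite /cs_ball /= => pq qr.
by rewrite (le_lt_trans (cs_dist_triangle q _ _))// ltrD.
Qed.

Lemma cs_entE : cs_ent = entourage_ cs_ball. Proof. by []. Qed.

HB.instance Definition _ := gen_eqMixin (cs_pair Q).
HB.instance Definition _ := gen_choiceMixin (cs_pair Q).
HB.instance Definition _ := hasNbhs.Build (cs_pair Q) cs_nbhs.
(* Two elements are at distance 0 iff they agree on [0, n], so this is the
   metric topology of the pairs of functions on [0, n]. *)
HB.instance Definition _ := @Nbhs_isPseudoMetric.Build R (cs_pair Q)
  cs_ent cs_nbhsE cs_ball cs_ball_center cs_ball_sym cs_ball_triangle cs_entE.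

End Topology.

Section Constants.
Context {R : realType} {n : nat}.
Implicit Types (h : 'cV[R]_n) (beta : nat -> 'cV[R]_n) (Q : 'M[R]_n).

Definition cs_exponent h beta Q : R :=
  mx_inner (h *m h^T + xi' beta Q) Q + n%:R - ln (\det Q).

Definition cs_T h beta Q : R :=
  n%:R - (Num.sqrt n%:R)^-1 * expR (- cs_exponent h beta Q).

Definition cs_L h beta Q : R := Num.sqrt n%:R * expR (cs_exponent h beta Q).

(* [`|_|] on matrices is the maximum of the absolute values of the entries.
   [cs_dom] is kept since [invmx A] is [A] when [A] is singular. *)
Definition csA Q (T L : R) : set (cs_pair Q) :=
  [set p | [/\ cs_dom p, (forall t, T <= t <= n%:R -> csx p t = 1)
             & `|invmx (cs_gap p)| <= L]].

End Constants.

Arguments csA {R n} Q T L _.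

(* Main.v *)
From HB Require Import structures.
Require Import Defs.
From mathcomp Require Import all_boot all_order all_algebra.
From mathcomp Require Import all_classical all_reals all_analysis.
From mathcomp Require Import measurable_realfun ring lra zify.

Set Implicit Arguments.
Unset Strict Implicit.
Unset Printing Implicit Defensive.

Import Order.TTheory GRing.Theory Num.Theory.
Import numFieldNormedType.Exports.

Local Open Scope classical_set_scope.
Local Open Scope ring_scope.

(* Round x up to a step function with values in {j/k} and cut the path at the
   times where x reaches j/k.  On such step functions the entropy term is a
   telescoping sum of log-determinants, and raising all levels by 1/k moves t_x
   back by one cut and lowers twice the functional by at least
   (log|Q| - log|Q - Phi(t_x)| - n - <xi'(Q) + h h^T, Q>)/k, for t_x before the move.
   Raise the levels as long as this is nonnegative: in the end |Q - Phi(t_x)| >=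
   exp(-(<xi'(Q) + h h^T, Q> + n - log|Q|)), which bounds (Q - Phi(t_x))^-1 by L.
   As k grows the rounding error vanishes, so the infimum is that over csA.  There
   the functional is locally Lipschitz, by perturbation of determinants and
   inverses and by integrating by parts against the monotone x and hatPhi^-1, and
   csA is compact by a Helly-type selection argument. *)

(** * Positive semidefinite matrices *)

(** Neither [Phi'] nor [t_x] is continuous for the distance. [Phi'] only occurs in integrals against
    functions of bounded variation, so uniform closeness of the paths is enough. Once [x = 1], the
    log-determinant and the integral trade off exactly, so the entropy can be computed from any
    later cut, and two pairs can share one. In a limit [t_x] may drop below the limit of the [t_x];
    this only enlarges the gap [Q - Phi(t_x)], and the bound on its inverse is put in a form
    monotone in the gap.

    The terms of the exponent have separate origins. [<xi'(Q) + h h^T, Q>] bounds the energy cost of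
    raising [x] by one unit: [xi'] is monotone in the Loewner order by the Schur product theorem,
    and [Phi'] integrates to [Q]. The gain [log|Q| - log|Q - Phi(t_x)| - n] is that of a single
    layer with base [A = Q - Phi(t_x)] and increment [B = Phi(t_x)], where [A + B = Q] and [n]
    bounds the trace of [(A + B)^-1 B]. The raising stops at the latest at the cut 0, where the gap
    is [Q], above the threshold. As the gap has diagonal entries at most 1, its inverse has entries
    at most the inverse of its determinant. *)

Section PosSemiDef.
Context {R : realType}.

Definition qform n (A : 'M[R]_n) (v : 'cV[R]_n) : R := (v^T *m A *m v) 0 0.

Lemma qformE n (A : 'M[R]_n) v :
  qform A v = \sum_i \sum_j v i 0 * A i j * v j 0.
Proof.
rewrite /qform mxE exchange_big/=; apply: eq_bigr => j _.
by rewrite mxE mulr_suml; apply: eq_bigr => i _; rewrite mxE.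
Qed.

Lemma qformD n (A B : 'M[R]_n) v : qform (A + B) v = qform A v + qform B v.
Proof. by rewrite /qform mulmxDr mulmxDl mxE. Qed.

Lemma qformN n (A : 'M[R]_n) v : qform (- A) v = - qform A v.
Proof. by rewrite /qform mulmxN mulNmx mxE. Qed.

Lemma qformB n (A B : 'M[R]_n) v : qform (A - B) v = qform A v - qform B v.
Proof. by rewrite qformD qformN. Qed.

Lemma qformZ n c (A : 'M[R]_n) v : qform (c *: A) v = c * qform A v.
Proof. by rewrite /qform -scalemxAr -scalemxAl mxE. Qed.

Lemma qformZv n c (A : 'M[R]_n) v : qform A (c *: v) = c ^+ 2 * qform A v.
Proof. by rewrite /qform [(_ *: _)^T]linearZ/= -!scalemxAl -scalemxAr scalerA mxE -expr2. Qed.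

Lemma psd_ge0 n (A : 'M[R]_n) v : psdmx A -> 0 <= qform A v.
Proof. by case=> _; exact. Qed.

Lemma pdmx_psd n (A : 'M[R]_n) : pdmx A -> psdmx A.
Proof.
case=> sA pA; split=> // v; have [->|v0] := eqVneq v 0; last by apply/ltW/pA.
by rewrite mulmx0 mxE.
Qed.

Lemma psdmx0 n : psdmx (0 : 'M[R]_n).
Proof. by split=> [|v]; rewrite ?trmx0// mulmx0 mul0mx mxE. Qed.

Lemma psdmxD n (A B : 'M[R]_n) : psdmx A -> psdmx B -> psdmx (A + B).
Proof.
move=> [sA pA] [sB pB]; split=> [|v]; first by rewrite linearD/= sA sB.
by rewrite -/(qform _ _) qformD; apply: addr_ge0; [exact: pA|exact: pB].
Qed.

Lemma psdmxZ n c (A : 'M[R]_n) : 0 <= c -> psdmx A -> psdmx (c *: A).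
Proof.
move=> c0 [sA pA]; split=> [|v]; first by rewrite linearZ/= sA.
by rewrite -/(qform _ _) qformZ; apply: mulr_ge0 => //; exact: pA.
Qed.

Lemma psdmx_sum n I (r : seq I) (P : pred I) (F : I -> 'M[R]_n) :
  (forall i, P i -> psdmx (F i)) -> psdmx (\sum_(i <- r | P i) F i).
Proof. by move=> h; elim/big_ind : _ => //; [exact: psdmx0|exact: psdmxD]. Qed.

Lemma pdmxDr n (A B : 'M[R]_n) : pdmx A -> psdmx B -> pdmx (A + B).
Proof.
move=> [sA pA] [sB pB]; split=> [|v v0]; first by rewrite linearD/= sA sB.
by rewrite -/(qform _ _) qformD; apply: ltr_pwDl; [exact: pA|exact: pB].
Qed.

Lemma psdmx_tr_mul m n (C : 'M[R]_(m, n)) : psdmx (C^T *m C).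
Proof.
split=> [|v]; first by rewrite trmx_mul trmxK.
rewrite mulmxA -trmx_mul -mulmxA mxE sumr_ge0// => i _.
by rewrite mxE -expr2 sqr_ge0.
Qed.

Lemma psdmx_congr m n (C : 'M[R]_(m, n)) (A : 'M[R]_m) :
  psdmx A -> psdmx (C^T *m A *m C).
Proof.
move=> [sA pA]; split=> [|v]; first by rewrite !trmx_mul trmxK sA mulmxA.
have -> : v^T *m (C^T *m A *m C) *m v = (C *m v)^T *m A *m (C *m v).
  by rewrite trmx_mul !mulmxA.
exact: pA.
Qed.

Lemma qform_delta n (A : 'M[R]_n) i j :
  (((delta_mx i 0 : 'cV[R]_n)^T *m A *m (delta_mx j 0 : 'cV[R]_n)) 0 0) = A i j.
Proof. by rewrite trmx_delta -rowE -colE !mxE. Qed.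

Lemma psdmx_diag_ge0 n (A : 'M[R]_n) i : psdmx A -> 0 <= A i i.
Proof. by move=> [_ /(_ (delta_mx i 0))]; rewrite qform_delta. Qed.

Lemma psdmx_sym n (A : 'M[R]_n) i j : psdmx A -> A i j = A j i.
Proof. by move=> [sA _]; rewrite -[in LHS]sA mxE. Qed.

(** The quadratic form at [e i + s *: e j], a polynomial of degree two in [s]; choices of [s] give
    the inequalities for 2 x 2 minors. *)
Lemma psdmx_pair n (A : 'M[R]_n) i j s : psdmx A ->
  0 <= A i i + s * (A i j *+ 2) + s ^+ 2 * A j j.
Proof.
move=> pA; pose e k := delta_mx k 0 : 'cV[R]_n.
have [_ /(_ (e i + s *: e j))] := pA.
have -> : (e i + s *: e j)^T = (e i)^T + s *: (e j)^T.
  by apply/matrixP => k l; rewrite !mxE.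
rewrite !mulmxDl !mulmxDr -!scalemxAl -!scalemxAr.
have E (k l : 'M[R]_1) : (k + l) 0 0 = k 0 0 + l 0 0 by rewrite mxE.
have Z c (k : 'M[R]_1) : (c *: k) 0 0 = c * k 0 0 by rewrite mxE.
rewrite !(E, Z) !qform_delta (psdmx_sym j i pA).
by move=> /le_trans; apply; rewrite mulr2n; lra.
Qed.

Lemma psdmx_off_diag n (A : 'M[R]_n) i j : psdmx A ->
  `|A i j| <= (A i i + A j j) / 2.
Proof.
move=> pA; have h := psdmx_pair i j ^~ pA.
by have := h 1; have := h (-1); rewrite ler_norml; move=> *; apply/andP; split; lra.
Qed.

Lemma psdmx_cauchy n (A : 'M[R]_n) i j : psdmx A ->
  A i j ^+ 2 <= A i i * A j j.
Proof.
move=> pA; have h := psdmx_pair i j ^~ pA.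
have [j0|j0] := eqVneq (A j j) 0.
  rewrite j0 mulr0; have [->|i0] := eqVneq (A i j) 0; first by rewrite expr0n.
  (* With [A j j = 0] the polynomial is affine in [s], and this [s] gives it the value -1. *)
  have := h (- (A i i + 1) / (A i j *+ 2)); rewrite j0 mulr0 addr0.
  by rewrite mulfVK ?mulrn_eq0//; lra.
have jp : 0 < A j j by rewrite lt_neqAle eq_sym j0 psdmx_diag_ge0.
(* The minimizer in [s]. *)
have := h (- A i j / A j j).
rewrite -(pmulr_lge0 _ jp) => /le_trans; rewrite -subr_ge0; apply.
by rewrite le_eqVlt; apply/orP; left; apply/eqP; field.
Qed.

(** Induction by Schur complement. Pivots may vanish: if [a = 0] then the row [r] is zero by
    [psdmx_cauchy], and the convention [0^-1 = 0] keeps the formulas below correct. *)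
Lemma psdmx_cholesky n (A : 'M[R]_n) : psdmx A ->
  exists2 U : 'M[R]_n, A = U^T *m U & forall i j : 'I_n, (j < i)%N -> U i j = 0.
Proof.
elim: n A => [|n IH] A pA.
  by exists 0 => [|[]//]; apply/matrixP; case.
pose a := A 0 0; pose r := ursubmx (A : 'M[R]_(1 + n)); pose D := drsubmx (A : 'M[R]_(1 + n)).
have sA : A^T = A by case: pA.
have a0 : 0 <= a by exact: psdmx_diag_ge0.
have EA : A = block_mx a%:M r r^T D :> 'M[R]_(1 + n).
  rewrite -[LHS](@submxK _ 1 n 1 n); congr block_mx.
    by apply/matrixP=> i j; rewrite !ord1 !mxE/= mulr1n; congr (A _ _); exact/val_inj.
  by rewrite /r trmx_ursub sA.
have qA (v : 'cV[R]_(1 + n)) : 0 <= (v^T *m block_mx a%:M r r^T D *m v) 0 0.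
  by rewrite -EA; case: pA.
have /IH[U' DU' U't] : psdmx (D - a^-1 *: (r^T *m r)).
  split=> [|w].
    by rewrite linearB/= linearZ/= trmx_mul trmxK /D trmx_drsub sA.
  (* For a given [w], the vector that minimizes the form in its first coordinate: the form becomes
     that of the Schur complement. *)
  have := qA (col_mx (- a^-1 *: (r *m w)) w : 'cV[R]_(1 + n)).
  rewrite tr_col_mx mul_row_block mul_row_col.
  set b := r *m w; have Eb : w^T *m r^T = b^T by rewrite trmx_mul.
  have -> : w^T *m (D - a^-1 *: (r^T *m r)) *m w =
            w^T *m D *m w - a^-1 *: (b^T *m b).
    rewrite mulmxBr mulmxBl -scalemxAr -scalemxAl; congr (_ - _ *: _).
    by rewrite !mulmxA Eb -mulmxA.
  rewrite !mulmxDl -[_ *m r *m w]mulmxA -/b Eb [(_ *: b)^T]linearZ/=.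
  have [->|an0] := eqVneq a 0.
    rewrite invr0 oppr0 !scale0r !mul0mx !mulmx0.
    by rewrite !add0r subr0.
  rewrite -!scalemxAl -!scalemxAr !scalerA mul_mx_scalar -!scalemxAl !scalerA !mxE/=.
  rewrite !big_ord1 !mxE/=.
  by move=> /le_trans; apply; rewrite le_eqVlt; apply/orP; left; apply/eqP; field.
pose s := Num.sqrt a.
have ssa : s * s = a by rewrite -expr2 sqr_sqrtr.
have r0 : a = 0 -> r = 0.
  move=> aE; apply/matrixP=> i j; rewrite !ord1 !mxE; apply/eqP.
  rewrite -sqrf_eq0 eq_le sqr_ge0 andbT.
  have := psdmx_cauchy (lshift n (0 : 'I_1)) (rshift 1 j) pA.
  have -> : A (lshift n (0 : 'I_1)) (lshift n (0 : 'I_1)) = a.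
    by congr (A _ _); exact/val_inj.
  by rewrite aE mul0r.
have ssr : s *: (s^-1 *: r) = r.
  rewrite scalerA; have [s0|s0] := eqVneq s 0; last by rewrite divff// scale1r.
  by rewrite r0 ?scaler0// -ssa s0 mul0r.
exists (block_mx s%:M (s^-1 *: r) 0 U' : 'M[R]_(1 + n)).
  rewrite EA (@tr_block_mx _ 1 n 1 n) (@mulmx_block _ 1 n 1 n 1 n).
  rewrite !trmx0 !mul0mx !mulmx0 !addr0 tr_scalar_mx mul_scalar_mx scale_scalar_mx ssa.
  rewrite mul_scalar_mx mul_mx_scalar ssr.
  have -> : (s^-1 *: r)^T = s^-1 *: r^T by rewrite [LHS]linearZ.
  have -> : s *: (s^-1 *: r^T) = r^T.
    by rewrite -[in RHS]ssr [in RHS]linearZ/= [in RHS]linearZ.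
  by rewrite -DU' -scalemxAl -scalemxAr scalerA -invfM ssa [_ + (_ - _)]addrC subrK.
move=> i j; rewrite -(fintype.splitK (i : 'I_(1 + n))) -(fintype.splitK (j : 'I_(1 + n))).
case: (fintype.split (i : 'I_(1 + n))) => i'; case: (fintype.split (j : 'I_(1 + n))) => j' /=.
- by rewrite !ord1.
- by rewrite !ord1.
- by move=> _; rewrite [LHS](@block_mxEdl _ 1 n 1 n) mxE.
by rewrite ltnS => ji; rewrite [LHS](@block_mxEdr _ 1 n 1 n); exact: U't.
Qed.

Lemma det_utrig n (U : 'M[R]_n) : (forall i j : 'I_n, (j < i)%N -> U i j = 0) ->
  \det U = \prod_i U i i.
Proof.
move=> Ut; rewrite -det_tr det_trig; first by apply: eq_bigr => i _; rewrite mxE.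
by apply/is_trig_mxP => i j ij; rewrite mxE Ut.
Qed.

Lemma psdmx_det_ge0 n (A : 'M[R]_n) : psdmx A -> 0 <= \det A.
Proof.
by case/psdmx_cholesky => U -> _; rewrite det_mulmx det_tr -expr2 sqr_ge0.
Qed.

(** Hadamard's inequality: in a Cholesky factorization [A i i] is [U i i ^+ 2] plus other squares,
    and the determinant is the product of the [U i i ^+ 2]. *)
Lemma psdmx_det_le_diag n (A : 'M[R]_n) : psdmx A -> \det A <= \prod_i A i i.
Proof.
case/psdmx_cholesky => U -> Ut; rewrite det_mulmx det_tr (det_utrig Ut).
rewrite -big_split/=; apply: ler_prod => i _.
rewrite -expr2 sqr_ge0/= mxE (bigD1 i)//= mxE -expr2 lerDl.
by apply: sumr_ge0 => k _; rewrite mxE -expr2 sqr_ge0.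
Qed.

Lemma pdmx_det_gt0 n (A : 'M[R]_n) : pdmx A -> 0 < \det A.
Proof.
move=> pA; rewrite lt_neqAle (psdmx_det_ge0 (pdmx_psd pA)) andbT eq_sym.
apply/negP => /eqP/eqP/det0P[v v0 vA].
have [_ /(_ v^T)] := pA; rewrite trmx_eq0 v0 => /(_ isT).
by rewrite trmxK vA mul0mx mxE ltxx.
Qed.

Lemma pdmx_unit n (A : 'M[R]_n) : pdmx A -> A \in unitmx.
Proof. by move=> /pdmx_det_gt0 d0; rewrite unitmxE unitfE gt_eqF. Qed.

Lemma psdmx_pdmx n (A : 'M[R]_n) : psdmx A -> \det A != 0 -> pdmx A.
Proof.
move=> pA d0; split; first by case: pA.
move=> v v0; rewrite -/(qform _ _) lt_neqAle psd_ge0// andbT eq_sym.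
have [U EA _] := psdmx_cholesky pA.
apply/negP => /eqP; rewrite /qform EA mulmxA -trmx_mul -mulmxA => q0.
have Uv : U *m v = 0.
  apply/matrixP => i j; rewrite ord1 [RHS]mxE; apply/eqP; rewrite -sqrf_eq0.
  move: q0; rewrite mxE => /eqP; rewrite psumr_eq0; last first.
    by move=> k _; rewrite mxE -expr2 sqr_ge0.
  by move/allP/(_ i); rewrite mem_index_enum mxE -expr2 => /(_ isT).
have Uu : U \in unitmx.
  rewrite unitmxE unitfE; apply: contraNneq d0 => U0.
  by rewrite EA det_mulmx U0 mulr0.
by move: v0; rewrite -[v](mulKmx Uu) Uv mulmx0 eqxx.
Qed.

Lemma psdmx_inner_ge0 n (A B : 'M[R]_n) : psdmx A -> psdmx B -> 0 <= mx_inner A B.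
Proof.
case/psdmx_cholesky => U -> _ pB.
rewrite /mx_inner -mulmxA mxtrace_mulC; apply: sumr_ge0 => i _.
by apply: psdmx_diag_ge0; have := psdmx_congr U^T pB; rewrite trmxK.
Qed.

Lemma mx_innerC n (A B : 'M[R]_n) : mx_inner A B = mx_inner B A.
Proof. exact: mxtrace_mulC. Qed.

Lemma mx_innerDl n (A B C : 'M[R]_n) :
  mx_inner (A + B) C = mx_inner A C + mx_inner B C.
Proof. by rewrite /mx_inner mulmxDl mxtraceD. Qed.

Lemma mx_innerNl n (A C : 'M[R]_n) : mx_inner (- A) C = - mx_inner A C.
Proof. by rewrite /mx_inner mulNmx linearN. Qed.

Lemma mx_innerBl n (A B C : 'M[R]_n) :
  mx_inner (A - B) C = mx_inner A C - mx_inner B C.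
Proof. by rewrite mx_innerDl mx_innerNl. Qed.

Lemma mx_innerZl n c (A C : 'M[R]_n) : mx_inner (c *: A) C = c * mx_inner A C.
Proof. by rewrite /mx_inner -scalemxAl mxtraceZ. Qed.

Lemma mx_innerBr n (A B C : 'M[R]_n) :
  mx_inner C (A - B) = mx_inner C A - mx_inner C B.
Proof. by rewrite mx_innerC mx_innerBl !(mx_innerC C). Qed.

Lemma mx_innerZr n c (A C : 'M[R]_n) : mx_inner C (c *: A) = c * mx_inner C A.
Proof. by rewrite mx_innerC mx_innerZl (mx_innerC C). Qed.

Lemma mx_innerE n (A B : 'M[R]_n) : mx_inner A B = \sum_i \sum_j A i j * B j i.
Proof. by apply: eq_bigr => i _; rewrite mxE. Qed.

Lemma mx_inner_le n (A B C : 'M[R]_n) : psdmx (B - A) -> psdmx C ->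
  mx_inner A C <= mx_inner B C.
Proof. by move=> AB pC; rewrite -subr_ge0 -mx_innerBl psdmx_inner_ge0. Qed.

Lemma pdmx_inv n (A : 'M[R]_n) : pdmx A -> pdmx (invmx A).
Proof.
move=> pA; have uA := pdmx_unit pA; have [sA qA] := pA.
have sI : (invmx A)^T = invmx A by rewrite trmx_inv sA.
split=> // v v0.
have := qA (invmx A *m v); rewrite trmx_mul sI -!mulmxA mulKVmx// mulmxA.
apply; apply: contraNneq v0 => v0.
by rewrite -[v](mulKVmx uA) v0 mulmx0.
Qed.

(** The square [qform A (w - invmx A *m v)] expanded. With equality at [w = invmx A *m v], the form
    of the inverse is a supremum over [w]; antitonicity of the inverse and the definition of
    [gap_bound] rest on this. *)
Lemma qform_inv_dual n (A : 'M[R]_n) (v w : 'cV[R]_n) : pdmx A ->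
  2 * (w^T *m v) 0 0 - qform A w <= qform (invmx A) v.
Proof.
move=> pA; have uA := pdmx_unit pA; have [sA _] := pA.
have := psd_ge0 (w - invmx A *m v) (pdmx_psd pA); rewrite /qform.
have -> : (w - invmx A *m v)^T = w^T - v^T *m invmx A.
  by rewrite linearB/= trmx_mul trmx_inv sA.
rewrite mulmxBl mulmxKV// mulmxBr !mulmxBl [w^T *m A *m (_ *m _)]mulmxA mulmxK//.
have E (k l : 'M[R]_1) : (k - l) 0 0 = k 0 0 - l 0 0 by rewrite !mxE.
have -> : v^T *m w = w^T *m v.
  by apply/matrixP => i j; rewrite !ord1 !mxE; apply: eq_bigr => k _; rewrite !mxE mulrC.
by rewrite -!mulmxA !E; lra.
Qed.

Lemma qform_inv_attained n (A : 'M[R]_n) (v : 'cV[R]_n) : pdmx A ->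
  qform (invmx A) v = 2 * ((invmx A *m v)^T *m v) 0 0 - qform A (invmx A *m v).
Proof.
move=> pA; have uA := pdmx_unit pA; have [sA _] := pA.
by rewrite /qform trmx_mul trmx_inv sA -!mulmxA mulKVmx//; lra.
Qed.

(** The supremum over [w] of [2 <w, v> - qform A w] decreases as [A] grows. *)
Lemma psdmx_invB n (A B : 'M[R]_n) : pdmx A -> pdmx B -> psdmx (B - A) ->
  psdmx (invmx A - invmx B).
Proof.
move=> pA pB AB; split.
  by rewrite linearB/= !trmx_inv; case: pA => -> _; case: pB => -> _.
move=> v; rewrite -/(qform _ _) qformB subr_ge0 (qform_inv_attained _ pB).
apply: le_trans (qform_inv_dual v (invmx B *m v) pA).
by rewrite lerB// -subr_ge0 -qformB psd_ge0.
Qed.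

End PosSemiDef.

(** * Inequalities for log-determinants *)

Section LogDet.
Context {R : realType}.

(** The tangent inequality of the concave function log det. For [B = U^T *m U] and [X] the
    congruence of [A] by [invmx U] it reads [ln (\det X) <= \tr X - n], that is Hadamard's
    inequality followed by [ln x <= x - 1] on the diagonal. *)
Lemma pdmx_lndetB n (A B : 'M[R]_n) : pdmx A -> pdmx B ->
  ln (\det A) - ln (\det B) <= mx_inner (invmx B) (A - B).
Proof.
move=> pA pB; have [U EB _] := psdmx_cholesky (pdmx_psd pB).
have uB := pdmx_unit pB.
have uU : U \in unitmx by move: uB; rewrite EB unitmx_mul => /andP[].
pose X := (invmx U)^T *m A *m invmx U.
have pX : psdmx X by exact/psdmx_congr/pdmx_psd.
have dX : \det X = \det A / \det B.
  have dU : \det U != 0 by rewrite -unitfE -unitmxE.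
  by rewrite /X EB !det_mulmx !det_tr det_inv; field.
have dX0 : 0 < \det X by rewrite dX divr_gt0 ?pdmx_det_gt0.
have tX : \tr X = mx_inner (invmx B) A.
  have -> : invmx B = invmx U *m (invmx U)^T.
    apply: (can_inj (mulKmx uB)); rewrite mulmxV// EB -mulmxA mulKVmx//.
    by rewrite -trmx_mul mulVmx// trmx1.
  by rewrite /mx_inner -[in RHS]mulmxA [RHS]mxtrace_mulC.
have -> : ln (\det A) - ln (\det B) = ln (\det X).
  by rewrite dX ln_div// posrE pdmx_det_gt0.
rewrite mx_innerBr -tX /mx_inner mulVmx// mxtrace1.
apply: (@le_trans _ _ (ln (\prod_i X i i))).
  rewrite ler_ln ?posrE//; first exact: psdmx_det_le_diag.
  exact: lt_le_trans (psdmx_det_le_diag pX).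
have Xp i : 0 < X i i.
  rewrite lt_neqAle (psdmx_diag_ge0 _ pX) andbT eq_sym.
  apply: contraTneq (lt_le_trans dX0 (psdmx_det_le_diag pX)) => Xi.
  by rewrite (bigD1 i)//= Xi mul0r ltxx.
rewrite /mxtrace -[n in n%:R]card_ord -sum1_card natr_sum -sumrB.
(* Positivity is carried along so that [lnM] applies at each factor. *)
have : (0 < \prod_i X i i) /\ (ln (\prod_i X i i) <= \sum_i (X i i - 1)).
  elim/big_ind2 : _ => [|a b c d [a0 ab] [c0 cd]|i _].
  - by rewrite ln1.
  - by split; [exact: mulr_gt0|rewrite lnM ?posrE// lerD].
  - by split => //; have := @le_ln1Dx _ (X i i - 1); rewrite [1 + _]addrC subrK; apply; rewrite ltrBrDl subrr.
by case.
Qed.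

Lemma pdmx_lndet_le n (A B : 'M[R]_n) : pdmx A -> pdmx B -> psdmx (B - A) ->
  ln (\det A) <= ln (\det B).
Proof.
move=> pA pB AB; rewrite -subr_le0; apply: le_trans (pdmx_lndetB pA pB) _.
rewrite -opprB mx_innerC mx_innerNl oppr_le0 psdmx_inner_ge0//.
exact/pdmx_psd/pdmx_inv.
Qed.

(** By Cramer's rule the entry is a principal minor divided by [\det A]; Hadamard's inequality
    bounds the minor by a product of diagonal entries at most 1. *)
Lemma pdmx_inv_diag_le n (A : 'M[R]_n) i : pdmx A -> (forall j, A j j <= 1) ->
  invmx A i i <= (\det A)^-1.
Proof.
move=> pA A1; rewrite /invmx pdmx_unit// !mxE.
rewrite ler_piMr ?invr_ge0 ?(ltW (pdmx_det_gt0 pA))//.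
rewrite /cofactor -signr_odd addnn odd_double expr0 mul1r.
have [U EA _] := psdmx_cholesky (pdmx_psd pA).
have -> : row' i (col' i A) = (col' i U)^T *m col' i U.
  by apply/matrixP => a b; rewrite EA !mxE; apply: eq_bigr => k _; rewrite !mxE.
apply: le_trans (psdmx_det_le_diag (psdmx_tr_mul (col' i U))) _.
apply: Num.Theory.prodr_ile1 => a _.
have -> : ((col' i U)^T *m col' i U) a a = A (lift i a) (lift i a).
  by rewrite EA !mxE; apply: eq_bigr => k _; rewrite !mxE.
by rewrite A1 psdmx_diag_ge0//; exact: pdmx_psd.
Qed.

End LogDet.

(** * Log-determinants and step functions *)

Section LogDetSlope.
Context {R : realType}.

Definition lndet n (A : 'M[R]_n) : R := ln (\det A).

(** The integral of [<hatPhi^-1, Phi'>] over an interval on which [x = c], [Phi] increases by [B]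
    and [hatPhi] ends at [A] (see [bint_inv_lndet]). It is the mean of [lndet_deriv A B] over
    [[0, c]]. *)
Definition lndet_slope n (A B : 'M[R]_n) (c : R) : R :=
  (lndet (A + c *: B) - lndet A) / c.

Definition lndet_deriv n (A B : 'M[R]_n) (s : R) : R :=
  mx_inner (invmx (A + s *: B)) B.

(** Errors of order [1/M] of uniform subdivisions are discarded in this form. *)
Lemma ge0_archimedean (x K : R) :
  (forall M : nat, (1 < M)%N -> - K / M%:R <= x) -> 0 <= x.
Proof.
move=> h; rewrite leNgt; apply/negP => x0.
have K0 : 0 < K.
  by case: (ltP 0 K) => // K0; have := h 2%N isT; lra.
have := archi_boundP (ltW (divr_gt0 K0 (_ : 0 < - x))); rewrite oppr_gt0 => /(_ x0).
set M := Num.bound _ => KM.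
have := h M.+2 isT; apply/negP; rewrite -ltNge ltr_pdivlMr ?ltr0n//.
rewrite ltrNr -mulNr mulrC -ltr_pdivrMr ?oppr_gt0//.
by apply: lt_trans KM _; rewrite ltr_nat.
Qed.

Section fixed.
Variables (n : nat) (A B : 'M[R]_n).
Hypotheses (pA : pdmx A) (pB : psdmx B).

Lemma pdmx_ray s : 0 <= s -> pdmx (A + s *: B).
Proof. by move=> s0; apply: pdmxDr => //; exact: psdmxZ. Qed.

Lemma lndet_rayB s t : 0 <= s -> 0 <= t ->
  lndet (A + t *: B) - lndet (A + s *: B) <= (t - s) * lndet_deriv A B s.
Proof.
move=> s0 t0; apply: le_trans (pdmx_lndetB (pdmx_ray t0) (pdmx_ray s0)) _.
by rewrite opprD addrACA subrr add0r -scalerBl mx_innerZr.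
Qed.

Lemma lndet_deriv_ge0 s : 0 <= s -> 0 <= lndet_deriv A B s.
Proof.
by move=> s0; apply: psdmx_inner_ge0 => //; exact/pdmx_psd/pdmx_inv/pdmx_ray.
Qed.

(** The right-end Riemann sum for the mean of [lndet_deriv A B] over [[0, c]]; it is a lower sum
    because the derivative decreases. *)
Definition lndet_riemann M c : R :=
  M%:R^-1 * \sum_(0 <= i < M) lndet_deriv A B (c * (i.+1%:R / M%:R)).

(** By concavity each increment of log det lies between [c / M] times the derivatives at its two
    ends. Upper and lower sums differ by a telescoping sum, at most [lndet_deriv A B 0 / M]. *)
Lemma lndet_slope_riemann M c : (0 < M)%N -> 0 < c ->
  lndet_riemann M c <= lndet_slope A B c <=
    lndet_riemann M c + lndet_deriv A B 0 / M%:R.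
Proof.
move=> M0 c0; have Mp : (0 : R) < M%:R by rewrite ltr0n.
pose f i := lndet (A + (c * (i%:R / M%:R)) *: B).
have r0 i : 0 <= c * (i%:R / M%:R) by rewrite mulr_ge0 ?(ltW c0)// divr_ge0 ?ler0n.
have rB i : c * (i.+1%:R / M%:R) - c * (i%:R / M%:R) = c / M%:R.
  by rewrite -mulrBr -mulrBl -natrB// subSnn mul1r.
have -> : lndet_slope A B c = c^-1 * \sum_(0 <= i < M) (f i.+1 - f i).
  rewrite telescope_sumr// /f divff ?gt_eqF// mulr1 mul0r mulr0 scale0r addr0.
  by rewrite mulrC.
have lo i : c / M%:R * lndet_deriv A B (c * (i.+1%:R / M%:R)) <= f i.+1 - f i.
  have := lndet_rayB (r0 i.+1) (r0 i); rewrite -/(f _) -/(f _) -[_ - _ i.+1]opprB.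
  by rewrite -[(_ - _) in X in _ <= X]opprB rB mulNr lerN2.
have hi i : f i.+1 - f i <= c / M%:R * lndet_deriv A B (c * (i%:R / M%:R)).
  by have := lndet_rayB (r0 i) (r0 i.+1); rewrite rB.
have E g : M%:R^-1 * \sum_(0 <= i < M) g i = c^-1 * \sum_(0 <= i < M) (c / M%:R * g i) :> R.
  by rewrite -mulr_sumr !mulrA mulVf ?mul1r// gt_eqF.
apply/andP; split.
  rewrite /lndet_riemann E ler_wpM2l ?invr_ge0 ?(ltW c0) ?(ltW Mp)//.
  by apply: ler_sum => i _; exact: lo.
apply: (@le_trans _ _
  (M%:R^-1 * \sum_(0 <= i < M) lndet_deriv A B (c * (i%:R / M%:R)))).
  rewrite E ler_wpM2l ?invr_ge0 ?(ltW c0) ?(ltW Mp)//.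
  by apply: ler_sum => i _; exact: hi.
rewrite /lndet_riemann [_ / _]mulrC -mulrDr ler_wpM2l ?invr_ge0 ?(ltW c0) ?(ltW Mp)//.
rewrite -lerBlDl -sumrB; pose g i := lndet_deriv A B (c * (i%:R / M%:R)).
rewrite (eq_bigr (fun i => - (g i.+1 - g i))); last by move=> i _; rewrite opprB.
rewrite sumrN telescope_sumr// opprB /g mul0r mulr0 gerBl.
exact: lndet_deriv_ge0.
Qed.

End fixed.

(** A finite-difference form of the fact that the second derivative of log det along [B] increases
    with the base: the left side for [X] is [e <X^-1, B (X + e B)^-1 B>], and both inverses decrease
    as [X] grows. *)
Lemma lndet_derivB_antitone n (X Y B : 'M[R]_n) e :
  pdmx X -> psdmx (Y - X) -> psdmx B -> 0 <= e ->
  mx_inner (invmx Y - invmx (Y + e *: B)) B <=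
  mx_inner (invmx X - invmx (X + e *: B)) B.
Proof.
move=> pX XY pB e0.
have pY : pdmx Y by rewrite -[Y](subrK X) addrC; exact: pdmxDr.
have pX1 := pdmx_ray pX pB e0; have pY1 := pdmx_ray pY pB e0.
have XY1 : psdmx (Y + e *: B - (X + e *: B)) by rewrite opprD addrACA subrr addr0.
have E Z : pdmx Z -> pdmx (Z + e *: B) -> mx_inner (invmx Z - invmx (Z + e *: B)) B =
    e * mx_inner (invmx Z) (B *m invmx (Z + e *: B) *m B).
  move=> pZ pZ1; rewrite -mx_innerZr /mx_inner.
  have -> : invmx Z - invmx (Z + e *: B) = invmx Z *m (e *: B) *m invmx (Z + e *: B).
    have -> : e *: B = Z + e *: B - Z by rewrite addrC addKr.
    rewrite mulmxBr mulmxBl [Z + (_ - Z)]addrC subrK mulmxK ?pdmx_unit//.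
    by rewrite mulVmx ?pdmx_unit// mul1mx.
  by rewrite -!scalemxAr -!scalemxAl !mulmxA.
have sB : B^T = B by case: pB.
have pBB Z : pdmx Z -> psdmx (B *m invmx Z *m B).
  by move=> pZ; rewrite -{1}sB; apply/psdmx_congr/pdmx_psd/pdmx_inv.
rewrite !E// ler_wpM2l//.
apply: (@le_trans _ _ (mx_inner (invmx Y) (B *m invmx (X + e *: B) *m B))).
  (* Cyclicity of the trace exchanges the two inverses, so that each can be compared in the first
     argument. *)
  have cyc Z W : mx_inner Z (B *m W *m B) = mx_inner W (B *m Z *m B).
    by rewrite /mx_inner mulmxA mxtrace_mulC !mulmxA mxtrace_mulC -!mulmxA.
  rewrite cyc [X in _ <= X]cyc; apply: mx_inner_le; last exact: pBB.
  exact: psdmx_invB.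
by apply: mx_inner_le; [exact: psdmx_invB|exact: pBB].
Qed.

(** The Riemann sums are compared node by node with [lndet_derivB_antitone]: at ratio [r] the
    increment [(c' - c) r] is the same for both bases, and [A' + (c + d) r B] dominates
    [A + c r B]. *)
Lemma lndet_slopeB_antitone n (A A' B : 'M[R]_n) c c' d :
  pdmx A -> psdmx (A' - A) -> psdmx B -> 0 < c -> c <= c' -> 0 <= d ->
  lndet_slope A' B (c + d) - lndet_slope A' B (c' + d) <=
  lndet_slope A B c - lndet_slope A B c'.
Proof.
move=> pA AA' pB c0 cc' d0.
have pA' : pdmx A' by rewrite -[A'](subrK A) addrC; exact: pdmxDr.
rewrite -subr_ge0.
(* Two of the four slopes are bounded by their upper sums; the constant collects the two errors. *)
apply: (@ge0_archimedean _ (lndet_deriv A B 0 + lndet_deriv A' B 0)) => M M1.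
have M0 : (0 < M)%N by apply: ltn_trans M1.
have c'0 : 0 < c' by exact: lt_le_trans cc'.
have /andP[+ _] := lndet_slope_riemann pA pB M0 c0.
have /andP[_ +] := lndet_slope_riemann pA pB M0 c'0.
have /andP[_ +] := lndet_slope_riemann pA' pB M0 (ltr_pwDl c0 d0).
have /andP[+ _] := lndet_slope_riemann pA' pB M0 (ltr_pwDl c'0 d0).
have : lndet_riemann A' B M (c + d) - lndet_riemann A' B M (c' + d) <=
       lndet_riemann A B M c - lndet_riemann A B M c'.
  rewrite /lndet_riemann -!mulrBr ler_wpM2l ?invr_ge0 ?ler0n// -!sumrB.
  apply: ler_sum => i _; set r := i.+1%:R / M%:R.
  have r0 : 0 <= r by rewrite divr_ge0 ?ler0n.
  rewrite /lndet_deriv -!mx_innerBl.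
  have -> : A + (c' * r) *: B = A + (c * r) *: B + ((c' - c) * r) *: B.
    by rewrite -addrA -scalerDl -mulrDl; congr (_ + (_ * _) *: _); ring.
  have -> : A' + ((c' + d) * r) *: B =
            A' + ((c + d) * r) *: B + ((c' - c) * r) *: B.
    by rewrite -addrA -scalerDl -mulrDl; congr (_ + (_ * _) *: _); ring.
  apply: lndet_derivB_antitone => //.
  - by apply: pdmx_ray => //; rewrite mulr_ge0// ltW.
  - rewrite opprD addrACA -scalerBl -mulrBl [c + d]addrC addrK.
    by apply: psdmxD => //; apply: psdmxZ => //; exact: mulr_ge0.
  - by rewrite mulr_ge0// subr_ge0.
by rewrite opprD mulrDl !mulNr => *; lra.
Qed.

(** Adjacent layers at the same level merge, as the increments of log det telescope. *)
Lemma lndet_slopeD n (A B1 B2 : 'M[R]_n) c :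
  lndet_slope (A + c *: B2) B1 c + lndet_slope A B2 c = lndet_slope A (B1 + B2) c.
Proof.
rewrite /lndet_slope -mulrDl.
have -> : A + c *: (B1 + B2) = A + c *: B2 + c *: B1.
  by rewrite scalerDr [c *: B1 + _]addrC addrA.
by congr (_ / _); ring.
Qed.

(** The rate at which the slope drops decreases in [c], so it is at least its value at [c = 1],
    which is [l - <(A + B)^-1, B> >= l - n]. Discretely: [d] is cut into [M] steps of length [e],
    and each drop is compared with that of the step from [1 - e] to 1. *)
Lemma lndet_slopeB_lower n (A B : 'M[R]_n) c d : pdmx A -> psdmx B ->
  0 < c -> 0 <= d -> c + d <= 1 ->
  d * (lndet (A + B) - lndet A - n%:R) <= lndet_slope A B c - lndet_slope A B (c + d).
Proof.
move=> pA pB c0 d0 cd1; set l := lndet (A + B) - lndet A.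
have pAA : psdmx (A - A) by rewrite subrr; exact: psdmx0.
have l0 : 0 <= l.
  rewrite subr_ge0; apply: pdmx_lndet_le => //; first exact: pdmxDr.
  by rewrite addrC addKr.
rewrite -subr_ge0; apply: (@ge0_archimedean _ (6 * n%:R * d)) => M M1.
have Mp : (0 : R) < M%:R by rewrite ltr0n (ltn_trans _ M1).
have M2 : (2 : R) <= M%:R by rewrite ler_nat.
pose e := d / M%:R; have e0 : 0 <= e by rewrite divr_ge0 ?(ltW Mp).
have eM : e * M%:R = d by rewrite divfK ?gt_eqF.
have d1 : d < 1 by lra.
have e12 : e <= M%:R^-1 by rewrite ler_piMl ?invr_ge0 ?(ltW Mp) ?(ltW d1).
have M12 : M%:R^-1 <= 2^-1 :> R by rewrite lef_pV2 ?posrE.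
have -> : lndet_slope A B c - lndet_slope A B (c + d) =
    \sum_(0 <= i < M) (lndet_slope A B (c + i%:R * e) - lndet_slope A B (c + i.+1%:R * e)).
  under eq_bigr do rewrite -opprB.
  rewrite sumrN telescope_sumr// mul0r addr0 [_ * e]mulrC eM.
  by rewrite opprB.
have s1 : lndet_slope A B 1 = l by rewrite /lndet_slope scale1r divr1.
pose s := 1 - e.
have sp : 0 < s by rewrite /s; lra.
have step i : (i < M)%N -> lndet_slope A B s - l <=
    lndet_slope A B (c + i%:R * e) - lndet_slope A B (c + i.+1%:R * e).
  move=> iM; have ie : i.+1%:R * e <= d.
    by rewrite -eM mulrC ler_wpM2l// ler_nat.
  have cie : 0 < c + i%:R * e by rewrite ltr_pwDl// mulr_ge0.
  have := @lndet_slopeB_antitone n A A B (c + i%:R * e) (c + i.+1%:R * e)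
            (1 - (c + i.+1%:R * e)) pA pAA pB cie.
  rewrite -natr1 in ie *.
  rewrite lerD2l ler_wpM2r ?lerDl//; rewrite subr_ge0 [c + (_ + _) * e + _]addrC subrK s1.
  have -> : c + i%:R * e + (1 - (c + (i%:R + 1) * e)) = s by rewrite /s; ring.
  by apply => //; lra.
apply: (@le_trans _ _ (M%:R * (lndet_slope A B s - l) - d * (l - n%:R))); last first.
  rewrite lerD2r mulr_natl -[in X in X <= _](subn0 M) -sumr_const_nat.
  by apply: ler_sum_nat => i /andP[_]; exact: step.
(* As [s *: B = X - A], the product is [n - <X^-1, A>]: the origin of the term [n] in the
   exponent. *)
have k1 : lndet_deriv A B s * s <= n%:R.
  have pX := pdmx_ray pA pB (ltW sp).
  have EX : s *: B = A + s *: B - A by rewrite addrC addKr.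
  rewrite mulrC -mx_innerZr; move: pX EX; set X := A + s *: B => pX ->.
  rewrite mx_innerBr {1}/mx_inner mulVmx ?pdmx_unit// mxtrace1 gerBl.
  by apply: psdmx_inner_ge0; apply: pdmx_psd => //; exact: pdmx_inv.
(* Concavity: the tangent at [s] lies above log det at 1. *)
have sl : l - e * lndet_deriv A B s <= s * lndet_slope A B s.
  rewrite /lndet_slope [s * _]mulrC divfK ?gt_eqF//.
  have := lndet_rayB pA pB (ltW sp) ler01; rewrite scale1r subKr -/(s).
  by rewrite /l; lra.
have n0 : (0 : R) <= n%:R by exact: ler0n.
have : s * s * (lndet_slope A B s - l) >= e * s * l - e * n%:R.
  have h : s * (l - e * lndet_deriv A B s) <= s * (s * lndet_slope A B s).
    by rewrite ler_wpM2l// ltW.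
  have h2 : e * (lndet_deriv A B s * s) <= e * n%:R by rewrite ler_wpM2l.
  have -> : e = 1 - s by rewrite /s; ring.
  have hs : (1 - s) = e by rewrite /s; ring.
  rewrite -hs in h h2; nra.
move=> h.
have e1 : e <= 2^-1 by lra.
(* Division by [s * s]; the 6 comes from [1 <= (1 - e)^2 (1 + 6 e)] for [0 <= e <= 1/2]. *)
have key : e * l - e * n%:R - 6 * e * e * n%:R <= lndet_slope A B s - l.
  have ss : 0 < s * s by exact: mulr_gt0.
  rewrite -(ler_pM2l ss); apply: le_trans h.
  have -> : s = 1 - e by [].
  have q1 : (1 - e) * (1 - e) * (e * l) <= e * (1 - e) * l.
    have u : 0 <= (1 - e) * (e * (e * l)) by rewrite !mulr_ge0//; lra.
    by rewrite -subr_ge0 (le_trans u)// le_eqVlt; apply/orP; left; apply/eqP; ring.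
  have q2 : 1 <= (1 - e) * (1 - e) * (1 + 6 * e).
    have u : 0 <= e * ((1 - 2 * e) * (4 - 3 * e)) by rewrite !mulr_ge0//; lra.
    by rewrite -subr_ge0 (le_trans u)// le_eqVlt; apply/orP; left; apply/eqP; ring.
  have en := mulr_ge0 e0 n0.
  have := ler_wpM2l en q2; rewrite mulr1 => q3.
  by nra.
have := ler_wpM2l (ltW Mp) key => key2.
have ed : e * e * M%:R <= d / M%:R by rewrite -mulrA eM mulrC ler_wpM2l.
have := ler_wpM2r n0 ed => ed2.
have Me : M%:R * e = d by rewrite mulrC.
have E1 : M%:R * (e * l - e * n%:R - 6 * e * e * n%:R) =
   d * l - d * n%:R - 6 * (e * e * M%:R * n%:R) by rewrite -Me; ring.
rewrite E1 in key2.
have E2 : - (6 * n%:R * d) / M%:R = - 6 * (d / M%:R * n%:R) by ring.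
rewrite E2; lra.
Qed.

End LogDetSlope.

Section Layers.
Context {R : realType}.
Variables (n m : nat) (P : nat -> 'M[R]_n).
Hypotheses (pPm : pdmx (P m)) (dP : forall l, (l < m)%N -> psdmx (P l - P l.+1)).

(* [P l] stands for [Q - Phi] at the [l]-th cut and [c l] for the value of [x]
   between the cuts [l] and [l + 1]: then [layer_mx c l] is [hatPhi] at the cut [l]
   and [layer_sum c m] is the integral of [<hatPhi^-1, Phi'>] up to the cut [m]. *)
Definition layer_mx (c : nat -> R) (j : nat) : 'M[R]_n :=
  P m + \sum_(j <= l < m) c l *: (P l - P l.+1).

Definition layer_sum (c : nat -> R) (k : nat) : R :=
  \sum_(0 <= l < k) lndet_slope (layer_mx c l.+1) (P l - P l.+1) (c l).

Lemma layer_mxS c j : (j < m)%N ->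
  layer_mx c j = layer_mx c j.+1 + c j *: (P j - P j.+1).
Proof. by move=> jm; rewrite /layer_mx big_ltn// addrCA addrC -addrA. Qed.

Lemma layer_mx_pd c j : (forall l, (l < m)%N -> 0 <= c l) -> pdmx (layer_mx c j).
Proof.
move=> c0; apply: pdmxDr => //; rewrite big_nat_cond; apply: psdmx_sum => l.
by rewrite andbT => /andP[_ lm]; apply: psdmxZ; [exact: c0|exact: dP].
Qed.

Lemma psdmx_layers k l : (k <= l)%N -> (l <= m)%N -> psdmx (P k - P l).
Proof.
elim: l => [|l IH]; first by rewrite leqn0 => /eqP-> _; rewrite subrr; exact: psdmx0.
rewrite leq_eqVlt => /predU1P[->|kl] lm; first by rewrite subrr; exact: psdmx0.
have -> : P k - P l.+1 = (P k - P l) + (P l - P l.+1) by rewrite addrA subrK.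
by apply: psdmxD; [apply: IH => //; exact: ltnW|exact: dP].
Qed.

Variables (c : nat -> R) (d : R).
Hypotheses (c0 : forall l, (l < m)%N -> 0 < c l)
  (cS : forall l, (l.+1 < m)%N -> c l <= c l.+1) (d0 : 0 <= d).

Let c' l := c l + d.

(* Since the slope differences are antitone in the level, equating the level of
   the first layers to that of the next one decreases the left-hand side; once
   they agree, the slopes add up to that of a single layer. *)
Lemma layer_sum_merge j : (j < m)%N ->
  lndet_slope (layer_mx c j.+1) (P 0%N - P j.+1) (c j) -
  lndet_slope (layer_mx c' j.+1) (P 0%N - P j.+1) (c' j) <=
  layer_sum c j.+1 - layer_sum c' j.+1.
Proof.
have c'0 l : (l < m)%N -> 0 <= c' l by move=> lm; rewrite addr_ge0// ltW// c0.
have c0' l : (l < m)%N -> 0 <= c l by move=> lm; rewrite ltW// c0.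
elim: j => [|j IH] jm; first by rewrite /layer_sum !big_nat1.
rewrite /layer_sum ![\sum_(0 <= l < j.+2) _]big_nat_recr//= -/(layer_sum c j.+1).
rewrite -/(layer_sum c' j.+1).
have -> : P 0%N - P j.+2 = (P 0%N - P j.+1) + (P j.+1 - P j.+2).
  by rewrite addrA subrK.
rewrite -!(lndet_slopeD _ (P 0%N - P j.+1) (P j.+1 - P j.+2)) -!layer_mxS//.
have := IH (ltnW jm).
have /= := @lndet_slopeB_antitone R n (layer_mx c j.+1) (layer_mx c' j.+1)
  (P 0%N - P j.+1) (c j) (c j.+1) d (layer_mx_pd _ c0') _
  (psdmx_layers (leq0n _) (ltnW jm)) (c0 (ltnW jm)) (cS jm) d0.
suff p : psdmx (layer_mx c' j.+1 - layer_mx c j.+1).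
  by move=> /(_ p); rewrite -/(c' j) -/(c' j.+1) => *; lra.
rewrite /layer_mx opprD addrACA subrr add0r -sumrB big_nat_cond.
apply: psdmx_sum => l; rewrite andbT => /andP[_ lm].
by rewrite -scalerBl /c' addrC addrA addNr add0r; apply: psdmxZ => //; exact: dP.
Qed.

(** Once merged at the level of the last one, the layers form a single layer with base [P m],
    whatever the levels, and increment [P 0 - P m]; [lndet_slopeB_lower] applies to it. *)
Lemma layer_sum_lower : (0 < m)%N -> c m.-1 + d <= 1 ->
  d * (lndet (P 0%N) - lndet (P m) - n%:R) <= layer_sum c m - layer_sum c' m.
Proof.
move=> m0 cd1; have mE := prednK m0; have lm : (m.-1 < m)%N by rewrite mE.
have := layer_sum_merge lm; rewrite mE; apply: le_trans.
have E e : layer_mx e m = P m by rewrite /layer_mx big_geq// addr0.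
rewrite !E; have := @lndet_slopeB_lower R n (P m) (P 0%N - P m) (c m.-1) d pPm
  (psdmx_layers (leq0n _) (leqnn _)) (c0 lm) d0 cd1.
by rewrite [P m + _]addrC subrK.
Qed.

End Layers.

(** * Lipschitz functions and integrals on an interval *)

Section MeasurableDerivative.
Context {R : realType}.

Lemma natSinv_lt (d : R) : 0 < d -> exists k : nat, k.+1%:R^-1 < d.
Proof.
move=> d0; exists (Num.truncn d^-1).
by rewrite invf_plt ?posrE ?ltr0n// truncnS_gt.
Qed.

Variable f : R -> R.

Definition diffquot (t h : R) : R := h^-1 * (f (h + t) - f t).

Lemma derivable_diffquot t : derivable f t 1 <-> cvg (diffquot t h @[h --> 0^']).
Proof.
rewrite /derivable (_ : diffquot t = fun h => h^-1 *: ((f \o shift t) (h *: 1) - f t))//.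
by apply/funext => h /=; rewrite [h%:A]mulr1.
Qed.

Lemma diffquot_cvg t : derivable f t 1 -> diffquot t h @[h --> 0^'] --> derive1 f t.
Proof. exact: (derivable_diffquot t).1. Qed.

Let small (k : nat) (h : R) := 0 < `|h| < k.+1%:R^-1.

(** The Cauchy criterion with precisions [1/(m+1)] and [1/(k+1)], so that the quantifiers over
    precisions are countable. *)
Lemma derivable_cauchy t : derivable f t 1 <->
  forall m : nat, exists k : nat, forall h h', small k h -> small k h' ->
    `|diffquot t h - diffquot t h'| <= m.+1%:R^-1.
Proof.
rewrite derivable_diffquot; split.
  move=> /cvg_ex[l ql] m; have e0 : (0 : R) < m.+1%:R^-1 / 2 by rewrite divr_gt0// invr_gt0.
  have /cvgrPdist_lt/(_ _ e0)[d /= d0 dq] := ql.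
  have [k kd] := natSinv_lt d0.
  have h1 h : small k h -> `|l - diffquot t h| < m.+1%:R^-1 / 2.
    move=> /andP[h0 hk]; apply: dq; last by rewrite -normr_gt0.
    by rewrite /= sub0r normrN (lt_trans hk).
  exists k => h h' /h1 qh /h1 qh'.
  rewrite [leRHS]splitr (le_trans (ler_distD l _ _))// distrC lerD// ltW//.
move=> cau; apply/cauchy_cvgP/cauchy_ballP => e e0.
have [m me] := natSinv_lt e0.
have [k kq] := cau m.
have s0 : \forall h \near 0^', small k h.
  exists k.+1%:R^-1 => /=; first by rewrite invr_gt0.
  by move=> h /=; rewrite sub0r normrN => hk h0; rewrite /small normr_gt0 h0.
exists (diffquot t @` small k, diffquot t @` small k).
  by split; apply: filterS s0 => h hk; exists h.
move=> [_ _] [/= [h hk <-] [h' h'k <-]].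
by rewrite -ball_normE /ball_/=; apply: le_lt_trans me; exact: kq.
Qed.

Hypothesis cf : continuous f.

Lemma continuous_diffquot h : continuous (diffquot ^~ h).
Proof.
move=> t; apply: cvgM; first exact: cvg_cst.
apply: cvgB; last exact: cf.
by apply: continuous_comp; [apply: cvgD; [exact: cvg_cst|exact: cvg_id]|exact: cf].
Qed.

Lemma measurable_derivable : measurable [set t | derivable f t 1].
Proof.
(* The union over the uncountably many [h], [h'] is open, since the quotients are continuous in
   [t]. *)
rewrite (_ : [set t | _] = \bigcap_m \bigcup_k ~` \bigcup_(hh in [set hh : R * R | small k hh.1 /\ small k hh.2])
  [set t | m.+1%:R^-1 < `|diffquot t hh.1 - diffquot t hh.2|]).
  apply: bigcapT_measurable => m; apply: bigcupT_measurable => k.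
  apply: measurableC; apply: open_measurable; apply: bigcup_open => -[h h'] _ /=.
  have -> : [set t | m.+1%:R^-1 < `|diffquot t h - diffquot t h'|] =
    (fun t => `|diffquot t h - diffquot t h'|) @^-1` [set x | m.+1%:R^-1 < x] by [].
  apply: open_comp; last exact: open_gt.
  move=> t _; apply: cvg_norm; apply: cvgB; exact: continuous_diffquot.
apply/seteqP; split => t /=.
  move=> /derivable_cauchy h m _; have [k kh] := h m; exists k => //=.
  by move=> -[[h1 h2] /= [s1 s2]]; rewrite ltNge kh.
move=> h; apply/derivable_cauchy => m; have [k _ kh] := h m I.
exists k => h1 h2 s1 s2; rewrite leNgt; apply/negP => lt12.
by apply: kh; exists (h1, h2).
Qed.

Lemma measurable_derive1 : measurable_fun setT (derive1 f).
Proof.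
pose D := [set t | derivable f t 1]; pose u (k : nat) : R := k.+1%:R^-1.
(* Off [D] the limit defining [derive1] does not exist and takes the default value [point]; the
   approximating sequence is constant there. *)
apply: (@measurable_fun_cvg _ _ _ _
  (fun k t => if t \in D then diffquot t (u k) else point)).
  move=> k; apply: measurable_fun_ifT => //; last first.
    by apply: continuous_measurable_fun; exact: continuous_diffquot.
  apply: (measurable_fun_bool true); rewrite setTI (_ : _ @^-1` _ = D).
    exact: measurable_derivable.
  by apply/seteqP; split => t /=; [exact: set_mem|exact: mem_set].
move=> t _ /=; have [tD|tD] := boolP (t \in D); last first.
  have ndt : ~ cvg (diffquot t h @[h --> 0^']).
    move=> cq; have td := (derivable_diffquot t).2 cq.
    by case/negP: tD; apply/mem_set.
  rewrite (_ : derive1 f t = point); first exact: cvg_cst.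
  exact: (dvgP ndt).
have qt := diffquot_cvg (set_mem tD).
apply/cvgrPdist_lt => e e0.
have /cvgrPdist_lt/(_ _ e0)[d /= d0 dq] := qt.
have [N Nd] := natSinv_lt d0.
exists N => // k /= Nk; apply: dq; last by rewrite invr_eq0.
rewrite /= sub0r normrN /u ger0_norm ?invr_ge0//; apply: le_lt_trans Nd.
by rewrite lef_pV2 ?posrE// ler_nat.
Qed.

End MeasurableDerivative.

Section LipschitzDerivative.
Context {R : realType}.
Local Notation mu := (@lebesgue_measure R).

Lemma lipschitz1_continuous (f : R -> R) :
  (forall s t, `|f t - f s| <= `|t - s|) -> continuous f.
Proof.
move=> hf x; apply/cvgrPdist_lt => e e0; exists e => // t /=.
exact: le_lt_trans.
Qed.

Section stieltjes.
Variable g : R -> R.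
Hypotheses (ndg : {homo g : x y / x <= y})
  (lg : forall s t, s <= t -> g t - g s <= t - s).

Let ndg' : {homo (fun t => t - g t) : x y / x <= y}.
Proof. by move=> x y xy; have := lg xy; lra. Qed.

Let rcg : forall x, g @ at_right x --> g x.
Proof.
apply: right_continuousW; apply: lipschitz1_continuous => s t.
wlog st : s t / s <= t => [h|].
  by case: (leP s t) => [|/ltW] st; [|rewrite distrC [`|t - s|]distrC]; exact: h.
by rewrite !ger0_norm ?subr_ge0//; [exact: lg|exact: ndg].
Qed.

Let rcg' : forall x, (fun t => t - g t) @ at_right x --> x - g x.
Proof.
move=> x; apply: cvgB; last exact: rcg.
by apply: cvg_at_right_filter; exact: cvg_id.
Qed.

Let G : cumulative R R := HB.pack g (isCumulative.Build R _ R g ndg rcg).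
Let G' : cumulative R R :=
  HB.pack (fun t => t - g t) (isCumulative.Build R _ R (fun t => t - g t) ndg' rcg').

Let nu := lebesgue_stieltjes_measure G.
Let nu' := lebesgue_stieltjes_measure G'.

Let stieltjes_itv (H : cumulative R R) x y : x <= y ->
  lebesgue_stieltjes_measure H `]x, y]%classic = (H y - H x)%:E.
Proof.
move=> xy; rewrite /lebesgue_stieltjes_measure /measure_extension.
rewrite measurable_mu_extE; last exact: is_ocitv.
exact: wlength_itv_bnd.
Qed.

(** The Stieltjes measures of [g] and of [t - g t] add up to Lebesgue measure, on half-open
    intervals by direct computation and then everywhere by uniqueness. *)
Let nu_le_mu A : measurable A -> (nu A <= mu A)%E.
Proof.
move=> mA; suff E X : ocitv X -> mu X = measure_add nu nu' X.
  by rewrite (etrans (lebesgue_measure_unique E mA) (measure_addE nu nu' A)) leeDl.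
move=> [[x y] _ <-] /=; rewrite measure_addE.
have [xy|yx] := leP x y; last by rewrite set_itv_ge ?bnd_simp -?leNgt ?(ltW yx)// !measure0 adde0.
have -> : mu `]x, y]%classic = (y - x)%:E by exact: (stieltjes_itv idfun xy).
have Eg : nu `]x, y]%classic = (g y - g x)%:E by exact: (stieltjes_itv G xy).
have Eg' : nu' `]x, y]%classic = (y - g y - (x - g x))%:E by exact: (stieltjes_itv G' xy).
transitivity ((g y - g x)%:E + (y - g y - (x - g x))%:E)%E; last first.
  by rewrite -[X in (X + _)%E]Eg -[X in (_ + X)%E]Eg'.
by rewrite -EFinD; congr EFin; ring.
Qed.

(** A measure below Lebesgue measure is absolutely continuous, so Radon--Nikodym applies;
    restricting to []a, b]] makes it finite. *)
Lemma monotone_lipschitz_density a b : a < b -> exists h : R -> R,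
  mu.-integrable setT (EFin \o h) /\
  forall x, a <= x <= b -> g x - g a = \int[mu]_(t in `]a, x]) h t.
Proof.
move=> ab; have mab : measurable (`]a, b]%classic : set (measurableTypeR R)).
  exact: measurable_itv.
have fab : (nu `]a, b]%classic < +oo)%E by rewrite [X in (X < _)%E](stieltjes_itv G (ltW ab)) ltry.
pose nuab : {finite_measure set (measurableTypeR R) -> \bar R} := mfrestr mab fab.
have dom : nuab `<< mu.
  apply/null_content_dominatesP => A mA A0; apply/eqP; rewrite eq_le measure_ge0 andbT.
  rewrite -A0 (le_trans (nu_le_mu _))//; first exact: measurableI.
  by apply: le_measure; rewrite ?inE//; exact: measurableI.
have [h [h0 hfin hint hE]] := radon_nikodym_sigma_finite dom.
have EF : EFin \o (fine \o h) = h by apply/funext => x /=; rewrite fineK.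
exists (fine \o h); rewrite EF; split=> // x /andP[ax xb].
rewrite /Rintegral -[RHS]/(fine (\int[mu]_(t in `]a, x]) (EFin \o (fine \o h)) t)%E) EF.
rewrite -hE; last exact: measurable_itv.
rewrite [X in fine X](_ : _ = nu `]a, x]%classic); first by rewrite [X in fine X](stieltjes_itv G ax).
rewrite /nuab/= /mfrestr /mrestr; congr (nu _); apply/seteqP; split => t /=.
  by move=> [].
by rewrite !in_itv/= => /andP[-> tx]; rewrite tx (le_trans tx).
Qed.

(** Near an interior point [g] is [g a] plus the primitive of the density, which Lebesgue's theorem
    differentiates almost everywhere. *)
Lemma monotone_lipschitz_ftc a b : a < b -> exists h : R -> R,
  [/\ mu.-integrable setT (EFin \o h),
    (forall x, a <= x <= b -> g x - g a = \int[mu]_(t in `]a, x]) h t) &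
    {ae mu, forall t, t \in `]a, b[ -> is_derive t 1 g (h t)}].
Proof.
move=> ab; have [h [hint hE]] := monotone_lipschitz_density ab.
exists h; split => //.
have loc : locally_integrable [set: R] h.
  by apply: open_integrable_locally => //; exact: openT.
have ii y : mu.-integrable [set` Interval (BRight a) (BRight y)] (EFin \o h).
  by apply: integrableS hint => //; exact: measurable_itv.
pose F x := \int[mu]_(t in `]a, x]) h t.
have : {ae mu, forall x, (BRight a < BRight x)%O -> derivable F x 1 /\ derive1 F x = h x}.
  exact: (FTC1 ii loc).
apply: filterS; first exact: (ae_filter_ringOfSetsType mu).
move=> t ht; rewrite in_itv/= => /andP[at_ tb].
have [|dF EF] := ht; first by rewrite bnd_simp.
rewrite -EF derive1E.
apply: (@near_eq_is_derive _ _ _ (fun x => g a + F x)).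
  have : \forall x \near t, x \in `]a, b[.
    by apply: near_in_itvoo; rewrite in_itv/= at_ tb.
  apply: filterS => x; rewrite in_itv/= => /andP[ax xb].
  rewrite /F -(hE x); first by rewrite addrC subrK.
  by rewrite (ltW ax) (ltW xb).
rewrite -[X in is_derive _ _ _ X]add0r.
have dFt : is_derive t (1 : R) F ('D_1 F t) by exact: derivableP.
exact: (is_deriveD (is_derive_cst (g a) t (1 : R)) dFt).
Qed.

End stieltjes.

End LipschitzDerivative.

Section LipschitzFTC.
Context {R : realType}.
Local Notation mu := (@lebesgue_measure R).

Lemma bounded_integrable (f : R -> R) (a b : R) (M : R) (i j : bool) :
  measurable_fun [set` Interval (BSide i a) (BSide j b)] f ->
  (forall t, t \in Interval (BSide i a) (BSide j b) -> `|f t| <= M) ->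
  mu.-integrable [set` Interval (BSide i a) (BSide j b)] (EFin \o f).
Proof.
move=> mf fM; apply: measurable_bounded_integrable => //.
- by rewrite /= lebesgue_measure_itv /=; case: ifPn => // _; rewrite -EFinB ltry.
exists M; split; first exact: num_real.
move=> N MN t /= tI; apply: le_trans (ltW MN); exact: fM.
Qed.

Lemma derive1_lipschitz_le1 (f : R -> R) (a b t : R) :
  (forall s t, a <= s <= b -> a <= t <= b -> `|f t - f s| <= `|t - s|) ->
  a < t < b -> derivable f t 1 -> `|derive1 f t| <= 1.
Proof.
move=> hf /andP[at_ tb] /diffquot_cvg /cvg_norm /cvgr_to_le; apply.
have d0 : 0 < Num.min (t - a) (b - t) by rewrite lt_min !subr_gt0 at_ tb.
exists (Num.min (t - a) (b - t)) => //; move=> h /=; rewrite sub0r normrN lt_min => /andP[h1 h2] h0.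
rewrite /diffquot normrM normfV ler_pdivrMl ?normr_gt0// mulr1.
rewrite (le_trans (hf _ _ _ _))// ?addrK// ?(ltW at_) ?(ltW tb)//.
by move: h1 h2; rewrite !ltr_norml => /andP[? ?] /andP[? ?]; apply/andP; split; lra.
Qed.

Lemma lipschitz1_ftc (f : R -> R) (a b : R) : a < b ->
  (forall s t, `|f t - f s| <= `|t - s|) ->
  {ae mu, forall t, t \in `]a, b[ -> derivable f t 1} /\
  forall s t, a <= s -> s <= t -> t <= b ->
    \int[mu]_(x in `]s, t[) derive1 f x = f t - f s.
Proof.
(* [g] and [id - g] are nondecreasing, so the Stieltjes measure of [g] has a
   density for Lebesgue measure, which differentiates to [derive1 g] a.e. *)
move=> ab hf; pose g t := (f t + t) / 2.
have hf' s t : s <= t -> - (t - s) <= f t - f s <= t - s.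
  by move=> st; rewrite -ler_norml (le_trans (hf _ _))// ger0_norm// subr_ge0.
have ndg : {homo g : x y / x <= y}.
  by move=> x y xy; rewrite /g; have /andP[] := hf' _ _ xy; lra.
have lg s t : s <= t -> g t - g s <= t - s.
  by move=> xy; rewrite /g; have /andP[] := hf' _ _ xy; lra.
have [h [hint hE hD]] := monotone_lipschitz_ftc ndg lg ab.
have cf := lipschitz1_continuous hf.
have fD (t : R) : is_derive t (1 : R) g (h t) -> is_derive t (1 : R) f (2 * h t - 1).
  move=> gD; rewrite (_ : f = 2 \*: g - id); last first.
    by apply/funext => x; rewrite /g !fctE /= /GRing.scale/=; field.
  exact: is_deriveB.
have aeD : {ae mu, forall t, t \in `]a, b[ -> is_derive t (1 : R) f (2 * h t - 1)}.
  apply: filterS hD; first exact: (ae_filter_ringOfSetsType mu).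
  by move=> t ht /ht; exact: fD.
split.
  apply: filterS aeD; first exact: (ae_filter_ringOfSetsType mu).
  by move=> t ht /ht[].
have hi (i : interval R) : mu.-integrable [set` i] (EFin \o h).
  by apply: integrableS hint => //; exact: measurable_itv.
move=> s t as_ st tb.
have -> : \int[mu]_(x in `]s, t[) derive1 f x = \int[mu]_(x in `]s, t[) (2 * h x - 1).
  congr fine; apply: ae_eq_integral => //.
  - apply/measurable_EFinP; apply: measurable_funTS; exact: measurable_derive1.
  - apply/measurable_EFinP; apply: measurable_funB => //.
    apply: measurable_funM => //; apply/measurable_EFinP; exact: measurable_int (hi _).
  - apply: filterS aeD; first exact: (ae_filter_ringOfSetsType mu).
    move=> x hx /=; rewrite in_itv/= => /andP[sx xt]; congr EFin.
    have [|_ dxE] := hx; first by rewrite in_itv/= (le_lt_trans as_)// (lt_le_trans xt).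
    by rewrite derive1E.
have h1i i j : mu.-integrable [set` Interval (BSide i s) (BSide j t)] (EFin \o (fun=> 1 : R)).
  by apply: (@bounded_integrable _ _ _ 1) => // x _; rewrite normr1.
have h2i i j : mu.-integrable [set` Interval (BSide i s) (BSide j t)] (EFin \o (fun x => 2 * h x)).
  have := @integrableZl _ _ R mu _ (measurable_itv (Interval (BSide i s) (BSide j t)))
    2 _ (hi _).
  by rewrite /=.
rewrite RintegralB//.
rewrite Rintegral_itv_bndo_bndc//.
rewrite Rintegral_cst//= lebesgue_measure_itv/= RintegralZl//.
have gE : \int[mu]_(x in `]s, t]) h x = g t - g s.
  have -> : g t - g s = (g t - g a) - (g s - g a) by ring.
  rewrite !hE ?as_ ?tb ?(le_trans st) ?(le_trans as_)//.
  by rewrite (Rintegral_itvB (hi _)) ?bnd_simp.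
rewrite gE /g; case: ifPn; rewrite lte_fin => ts /=; first by lra.
have -> : t = s by apply/eqP; rewrite eq_le st leNgt ts.
by rewrite !subrr; lra.
Qed.

(** Truncating the argument to [[a, b]] does not increase distances. Entries of [Phi] are
    constrained on [[0, n]] only, and the results for the whole line apply to this extension. *)
Lemma lipschitz1_on_clamp (f : R -> R) (a b : R) : a <= b ->
  (forall s t, a <= s <= b -> a <= t <= b -> `|f t - f s| <= `|t - s|) ->
  exists g : R -> R, (forall s t, `|g t - g s| <= `|t - s|) /\
    forall t, a <= t <= b -> g t = f t.
Proof.
move=> ab hf; pose c t := Num.min (Num.max t a) b.
have cI t : a <= c t <= b.
  by rewrite /c ge_min lexx orbT andbT le_min ab le_max lexx orbT.
have cE t : a <= t <= b -> c t = t.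
  by move=> /andP[at_ tb]; rewrite /c (max_idPl at_) (min_idPl tb).
exists (f \o c); split=> [s t|t tI] /=; last by rewrite cE.
apply: le_trans (hf _ _ (cI _) (cI _)) _.
wlog st : s t / s <= t => [H|].
  by case: (leP s t) => [|/ltW] st; [|rewrite distrC [`|t - s|]distrC]; exact: H.
have cst_ : c s <= c t.
  by rewrite /c le_min !ge_min ge_max !le_max st !lexx !orbT.
rewrite !ger0_norm ?subr_ge0// lerBlDl -lerBlDr {2}/c le_min; apply/andP; split.
  have sm : s <= Num.max s a by rewrite le_max lexx.
  have am : a <= Num.max s a by rewrite le_max lexx orbT.
  have : c t <= Num.max t a by rewrite /c ge_min lexx.
  move=> /le_trans h; rewrite lerBlDr; apply: h; rewrite ge_max.
  by apply/andP; split; lra.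
by have /andP[_] := cI t; lra.
Qed.

Lemma lipschitz1_on_ftc (f : R -> R) (a b : R) : a < b ->
  (forall s t, a <= s <= b -> a <= t <= b -> `|f t - f s| <= `|t - s|) ->
  [/\ measurable (`]a, b[ `&` [set t | derivable f t 1]),
    measurable_fun `]a, b[ (derive1 f),
    {ae mu, forall t, t \in `]a, b[ -> derivable f t 1} &
    forall s t, a <= s -> s <= t -> t <= b ->
      \int[mu]_(x in `]s, t[) derive1 f x = f t - f s].
Proof.
move=> ab hf; have [g [hg gE]] := lipschitz1_on_clamp (ltW ab) hf.
have nE t : t \in `]a, b[ -> {near t, g =1 f}.
  move=> tI; have : \forall x \near t, x \in `]a, b[ by exact: near_in_itvoo.
  apply: filterS => x; rewrite in_itv/= => /andP[ax xb].
  by apply: gE; rewrite !ltW.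
have dE t : t \in `]a, b[ -> derivable f t 1 <-> derivable g t 1.
  move=> tI; split; apply: near_eq_derivable; last exact: nE.
  by apply: filterS (nE _ tI) => x ->.
have d1E t : t \in `]a, b[ -> derive1 g t = derive1 f t.
  by move=> tI; rewrite !derive1E; apply: near_eq_derive; exact: nE.
have [aeg ig] := lipschitz1_ftc ab hg.
have cg := lipschitz1_continuous hg.
split.
- rewrite (_ : _ `&` _ = `]a, b[%classic `&` [set t | derivable g t 1]).
    by apply: measurableI; [exact: measurable_itv|exact: measurable_derivable].
  by apply/seteqP; split => t /= [tI] /(dE _ tI).
- apply: (eq_measurable_fun (derive1 g)).
    by move=> t; rewrite inE => /= tI; exact: d1E.
  by apply: measurable_funTS; exact: measurable_derive1.
- apply: filterS aeg; first exact: (ae_filter_ringOfSetsType mu).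
  by move=> t ht tI; apply/(dE _ tI)/ht.
move=> s t as_ st tb; rewrite -!gE ?as_ ?tb ?(le_trans st) ?(le_trans as_)//.
rewrite -(ig s t as_ st tb); apply: eq_Rintegral => x; rewrite inE/= in_itv/= => /andP[sx xt].
by rewrite d1E// in_itv/= (le_lt_trans as_)// (lt_le_trans xt).
Qed.

End LipschitzFTC.

(** * Bounded measurable integrands and integration by parts *)

Section BoundedMeasurable.
Context {R : realType}.
Local Notation mu := (@lebesgue_measure R).
Implicit Types (f g w V : R -> R) (a b : R).

(** A class of integrable functions closed under sums and products, so that side conditions follow
    from the shape of the integrand. *)
Definition bmeas a b f := measurable_fun `[a, b] f /\
  exists M, forall t, a <= t <= b -> `|f t| <= M.

Lemma bmeas_cst a b c : bmeas a b (fun=> c).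
Proof. by split; [exact: measurable_cst|exists `|c|]. Qed.

Lemma bmeas_sub a b a' b' f : a <= a' -> b' <= b -> bmeas a b f -> bmeas a' b' f.
Proof.
move=> aa' bb' [mf [M fM]]; split.
  apply: measurable_funS mf; first exact: measurable_itv.
  by move=> t /=; rewrite !in_itv/= => /andP[/(le_trans aa')-> /le_trans->].
by exists M => t /andP[at_ tb]; apply: fM; rewrite (le_trans aa')// (le_trans tb).
Qed.

Lemma bmeasD a b f g : bmeas a b f -> bmeas a b g -> bmeas a b (fun t => f t + g t).
Proof.
move=> [mf [M fM]] [mg [N gN]]; split; first exact: measurable_funD.
exists (M + N) => t tI; apply: le_trans (ler_normD _ _) _.
by rewrite lerD ?fM ?gN.
Qed.

Lemma bmeasN a b f : bmeas a b f -> bmeas a b (fun t => - f t).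
Proof.
move=> [mf [M fM]]; split; first exact: measurableT_comp.
by exists M => t tI; rewrite normrN fM.
Qed.

Lemma bmeasB a b f g : bmeas a b f -> bmeas a b g -> bmeas a b (fun t => f t - g t).
Proof. by move=> bf bg; apply: bmeasD => //; exact: bmeasN. Qed.

Lemma bmeasM a b f g : bmeas a b f -> bmeas a b g -> bmeas a b (fun t => f t * g t).
Proof.
move=> [mf [M fM]] [mg [N gN]]; split; first exact: measurable_funM.
by exists (M * N) => t tI; rewrite normrM ler_pM ?fM ?gN.
Qed.

Lemma bmeas_norm a b f : bmeas a b f -> bmeas a b (fun t => `|f t|).
Proof.
move=> [mf [M fM]]; split; first exact: measurableT_comp.
by exists M => t tI; rewrite normr_id fM.
Qed.

Lemma bmeas_sum a b (I : Type) (r : seq I) (F : I -> R -> R) :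
  (forall i, bmeas a b (F i)) -> bmeas a b (fun t => \sum_(i <- r) F i t).
Proof.
move=> bF; elim: r => [|i r IH].
  by under [X in bmeas _ _ X]funext do rewrite big_nil; exact: bmeas_cst.
by under [X in bmeas _ _ X]funext do rewrite big_cons; exact: bmeasD.
Qed.

Lemma bmeas_eq a b f g : (forall t, a <= t <= b -> f t = g t) ->
  bmeas a b f -> bmeas a b g.
Proof.
move=> fg [mf [M fM]]; split.
  by apply: eq_measurable_fun mf => t; rewrite inE/= in_itv/=; exact: fg.
by exists M => t tI; rewrite -fg// fM.
Qed.

Lemma bmeas_integrable a b f : bmeas a b f -> mu.-integrable `[a, b] (EFin \o f).
Proof. by move=> [mf [M fM]]; apply: (@bounded_integrable _ _ _ _ M) => // t; rewrite in_itv; exact: fM. Qed.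

Lemma bmeas_nondecreasing a b f : (forall s t, a <= s -> s <= t -> t <= b -> f s <= f t) ->
  bmeas a b f.
Proof.
move=> nf; have [ab|ba] := leP a b; last first.
  split; first by rewrite set_itv_ge ?bnd_simp -?ltNge//; exact: measurable_fun_set0.
  by exists 0 => t /andP[at_ tb]; have := le_lt_trans (le_trans at_ tb) ba; rewrite ltxx.
split; last first.
  exists (`|f a| + `|f b|) => t /andP[at_ tb].
  have := nf _ _ (lexx a) at_ tb; have := nf _ _ at_ tb (lexx b).
  have := ler_norm (f b); have := ler_norm (- f a); rewrite normrN.
  have := normr_ge0 (f a); have := normr_ge0 (f b).
  by rewrite ler_norml => *; apply/andP; split; lra.
pose c t := Num.min (Num.max t a) b.
apply: (eq_measurable_fun (f \o c)).
  move=> t; rewrite inE/= in_itv/= => /andP[at_ tb].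
  by rewrite /c (max_idPl at_) (min_idPl tb).
apply: nondecreasing_measurable => [|s t st /=]; first exact: measurable_itv.
apply: nf.
- by rewrite /c le_min ab andbT le_max lexx orbT.
- by rewrite /c le_min !ge_min lexx orbT andbT ge_max !le_max st lexx orbT.
- by rewrite /c ge_min lexx orbT.
Qed.

(** Bounded variation in the form [|dw| <= dV], which spares a Stieltjes integral against [w]; [V]
    is then nondecreasing. *)
Definition varbound a b w V :=
  forall s t, a <= s -> s <= t -> t <= b -> `|w t - w s| <= V t - V s.

(** Jordan decomposition: [w + V] and [V] are nondecreasing. *)
Lemma varbound_bmeas a b w V : varbound a b w V -> bmeas a b w.
Proof.
move=> wV; apply: (@bmeas_eq _ _ (fun t => (w t + V t) - V t)).
  by move=> t _; rewrite addrK.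
by apply: bmeasB; apply: bmeas_nondecreasing => s t as_ st tb;
  have := wV s t as_ st tb; rewrite ler_norml => /andP[? ?]; lra.
Qed.

Lemma bint_eq a b f g : (forall t, a <= t <= b -> f t = g t) ->
  \int[mu]_(t in `[a, b]) f t = \int[mu]_(t in `[a, b]) g t.
Proof. by move=> fg; apply: eq_Rintegral => t; rewrite inE/= in_itv/=; exact: fg. Qed.

Lemma bint_le a b f g : bmeas a b f -> bmeas a b g ->
  (forall t, a <= t <= b -> f t <= g t) ->
  \int[mu]_(t in `[a, b]) f t <= \int[mu]_(t in `[a, b]) g t.
Proof.
move=> bf bg fg; apply: le_Rintegral.
- exact: measurable_itv.
- exact: bmeas_integrable.
- exact: bmeas_integrable.
by move=> t /=; rewrite in_itv/=; exact: fg.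
Qed.

Lemma bintD a b f g : bmeas a b f -> bmeas a b g ->
  \int[mu]_(t in `[a, b]) (f t + g t) =
  \int[mu]_(t in `[a, b]) f t + \int[mu]_(t in `[a, b]) g t.
Proof.
move=> bf bg; apply: RintegralD; [exact: measurable_itv|exact: bmeas_integrable..].
Qed.

Lemma bintB a b f g : bmeas a b f -> bmeas a b g ->
  \int[mu]_(t in `[a, b]) (f t - g t) =
  \int[mu]_(t in `[a, b]) f t - \int[mu]_(t in `[a, b]) g t.
Proof.
move=> bf bg; apply: RintegralB; [exact: measurable_itv|exact: bmeas_integrable..].
Qed.

Lemma bintZ a b f c : bmeas a b f ->
  \int[mu]_(t in `[a, b]) (c * f t) = c * \int[mu]_(t in `[a, b]) f t.
Proof.
move=> bf; apply: RintegralZl; [exact: measurable_itv|exact: bmeas_integrable].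
Qed.

Lemma bint_cst a b c : a <= b -> \int[mu]_(t in `[a, b]) c = c * (b - a).
Proof.
move=> ab; rewrite Rintegral_cst; last exact: measurable_itv.
rewrite /= lebesgue_measure_itv/= lte_fin; case: ifPn => //=.
by rewrite -leNgt => ba; have -> : a = b by [apply/eqP; rewrite eq_le ab ba]; rewrite subrr.
Qed.

Lemma bint_set1 a f : \int[mu]_(t in `[a, a]) f t = 0.
Proof. by rewrite set_itv1 Rintegral_set1. Qed.

Lemma bint_split a b c f : a <= b -> b <= c -> bmeas a c f ->
  \int[mu]_(t in `[a, c]) f t =
  \int[mu]_(t in `[a, b]) f t + \int[mu]_(t in `[b, c]) f t.
Proof.
move=> ab bc bf; have fi := bmeas_integrable bf.
have := @Rintegral_itvB R f (BLeft a) (BRight c) b fi.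
rewrite !bnd_simp => /(_ ab bc) => E.
have fi' : mu.-integrable `]b, c] (EFin \o f).
  apply: integrableS fi; [exact: measurable_itv|exact: measurable_itv|].
  by move=> t /=; rewrite !in_itv/= => /andP[/ltW/(le_trans ab)-> ->].
by rewrite -(Rintegral_itv_obnd_cbnd fi') -E addrC subrK.
Qed.

Lemma bint_sum a b (I : Type) (r : seq I) (F : I -> R -> R) :
  (forall i, bmeas a b (F i)) ->
  \int[mu]_(t in `[a, b]) (\sum_(i <- r) F i t) =
  \sum_(i <- r) \int[mu]_(t in `[a, b]) F i t.
Proof.
move=> bF; elim: r => [|i r IH].
  rewrite big_nil; under eq_Rintegral do rewrite big_nil.
  by rewrite Rintegral_cst ?mul0r//; exact: measurable_itv.
rewrite big_cons -IH -bintD//; last exact: bmeas_sum.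
by apply: bint_eq => t _; rewrite big_cons.
Qed.

Lemma bint_norm a b f M : a <= b -> bmeas a b f ->
  (forall t, a <= t <= b -> `|f t| <= M) ->
  `|\int[mu]_(t in `[a, b]) f t| <= M * (b - a).
Proof.
move=> ab bf fM.
apply: le_trans (le_normr_Rintegral _ (bmeas_integrable bf)) _.
  exact: measurable_itv.
rewrite -bint_cst//.
by apply: bint_le => //; [exact: bmeas_norm|exact: bmeas_cst].
Qed.

Lemma bint_ge0 a b f : (forall t, a <= t <= b -> 0 <= f t) ->
  0 <= \int[mu]_(t in `[a, b]) f t.
Proof. by move=> f0; apply: Rintegral_ge0 => t /=; rewrite in_itv/=; exact: f0. Qed.

(* Summing the hypothesis over finer and finer uniform subdivisions makes the
   term [K * (t - s)] disappear. *)
Lemma additive_bound (d : R -> R -> R) V (e K a b : R) : a <= b -> 0 <= K ->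
  (forall s t u, a <= s -> s <= t -> t <= u -> u <= b -> d s u = d s t + d t u) ->
  (forall s t, a <= s -> s <= t -> t <= b ->
    `|d s t| <= (e + K * (t - s)) * (V t - V s)) ->
  `|d a b| <= e * (V b - V a).
Proof.
move=> ab K0 dD dV; rewrite -subr_ge0.
apply: (@ge0_archimedean _ _ (K * (b - a) * (V b - V a))) => M M1.
have M0 : (0 < M)%N by apply: ltn_trans M1.
have Mp : (0 : R) < M%:R by rewrite ltr0n.
pose r i := a + (b - a) * (i%:R / M%:R) : R.
have r0 : r 0%N = a by rewrite /r mul0r mulr0 addr0.
have rM : r M = b by rewrite /r divff ?gt_eqF// mulr1 addrC subrK.
have rS i : r i.+1 - r i = (b - a) / M%:R by rewrite /r -natr1; ring.
have rnd i j : (i <= j)%N -> r i <= r j.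
  move=> ij; rewrite lerD2l ler_wpM2l ?subr_ge0// ler_wpM2r ?invr_ge0 ?ler0n//.
  by rewrite ler_nat.
have ra i : a <= r i by rewrite -r0 rnd.
have dsum k : (k <= M)%N -> d a (r k) = d a a + \sum_(0 <= i < k) d (r i) (r i.+1).
  elim: k => [|k IH] kM; first by rewrite big_nil r0 addr0.
  rewrite big_nat_recr//= addrA -IH ?(ltnW kM)// -dD// ?rnd//.
  by rewrite -rM rnd.
have d0 : d a a = 0.
  by have := dD a a a (lexx a) (lexx a) (lexx a) ab => ?; lra.
have : `|d a b| <= \sum_(0 <= i < M) (e + K * ((b - a) / M%:R)) * (V (r i.+1) - V (r i)).
  rewrite -rM dsum// d0 add0r; apply: le_trans (ler_norm_sum _ _ _) _.
  apply: ler_sum_nat => i /andP[_ iM].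
  have := dV (r i) (r i.+1) (ra i) (rnd _ _ (leqnSn i)).
  by rewrite rS rM; apply; rewrite -rM rnd.
rewrite -mulr_sumr telescope_sumr// r0 rM => h.
have E : (e + K * ((b - a) / M%:R)) * (V b - V a) =
  e * (V b - V a) + K * (b - a) * (V b - V a) / M%:R by ring.
by move: h; rewrite E mulNr; lra.
Qed.

(** Only the sup norm [e] of [g] enters the bound. For two paths [g] is the difference of two
    entries, which may be small while the difference of the derivatives is not; 2 bounds the
    latter. *)
Lemma bint_by_parts_bound a b w V g g' (M e : R) : a <= b ->
  varbound a b w V -> bmeas a b g' -> (forall t, a <= t <= b -> `|g' t| <= 2) ->
  (forall s t, a <= s -> s <= t -> t <= b ->
    \int[mu]_(x in `[s, t]) g' x = g t - g s) ->
  (forall t, a <= t <= b -> `|w t| <= M) ->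
  (forall t, a <= t <= b -> `|g t| <= e) ->
  `|\int[mu]_(t in `[a, b]) (w t * g' t)| <= e * (V b - V a + 2 * M).
Proof.
move=> ab wV bg' g'2 gE wM ge.
have bw := varbound_bmeas wV.
have bwg : bmeas a b (fun t => w t * g' t) by exact: bmeasM.
have Vnd s t : a <= s -> s <= t -> t <= b -> 0 <= V t - V s.
  by move=> as_ st tb; apply: le_trans (wV _ _ as_ st tb).
(* Minus the integral of [g] against [dw]. It is additive in the interval, and on a short one
   replacing [w] by [w s] costs [2 (t - s)] times the variation. *)
pose d s t := \int[mu]_(x in `[s, t]) (w x * g' x) - (w t * g t - w s * g s).
have : `|d a b| <= e * (V b - V a).
  apply: (@additive_bound _ _ _ 2) => //.
    move=> s t u as_ st tu ub; rewrite /d (@bint_split s t u)//; first by ring.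
    exact: bmeas_sub bwg.
  move=> s t as_ st tb.
  have sI x : s <= x <= t -> a <= x <= b.
    by move=> /andP[sx xt]; rewrite (le_trans as_)// (le_trans xt).
  have bg's : bmeas s t g' by exact: bmeas_sub bg'.
  have -> : d s t = \int[mu]_(x in `[s, t]) ((w x - w s) * g' x) - (w t - w s) * g t.
    rewrite (@bint_eq _ _ (fun x => (w x - w s) * g' x) (fun x => w x * g' x - w s * g' x)).
      rewrite bintB ?bintZ//; last 2 first.
        exact: bmeas_sub bwg.
        by apply: bmeasM => //; exact: bmeas_cst.
      by rewrite gE// /d; ring.
    by move=> x _; rewrite mulrBl.
  apply: le_trans (ler_normB _ _) _.
  have h1 : `|\int[mu]_(x in `[s, t]) ((w x - w s) * g' x)| <= 2 * (V t - V s) * (t - s).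
    apply: bint_norm => //.
      by apply: bmeasM => //; apply: bmeasB; [exact: bmeas_sub bw|exact: bmeas_cst].
    move=> x xI; have /andP[sx xt] := xI.
    rewrite normrM mulrC ler_pM//; first by apply: g'2; exact: sI.
    have := wV s x as_ sx (le_trans xt tb) => /le_trans; apply.
    have := Vnd x t (le_trans as_ sx) xt tb; lra.
  have h2 : `|(w t - w s) * g t| <= (V t - V s) * e.
    by rewrite normrM ler_pM// ?wV// ge// tb (le_trans as_).
  by lra.
rewrite /d => h.
have e1 : `|w b * g b| <= M * e by rewrite normrM ler_pM// ?wM ?ge// lexx ab.
have e2 : `|w a * g a| <= M * e by rewrite normrM ler_pM// ?wM ?ge// lexx ab.
have -> : e * (V b - V a + 2 * M) = e * (V b - V a) + (M * e + M * e) by ring.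
move: h e1 e2; set I := \int[mu]_(_ in _) _; set k1 := w b * g b; set k2 := w a * g a.
move=> h e1 e2; have -> : I = (I - (k1 - k2)) + (k1 - k2) by rewrite subrK.
apply: le_trans (ler_normD _ _) (lerD h _).
by apply: le_trans (ler_normB _ _) (lerD e1 e2).
Qed.

End BoundedMeasurable.

(** * The density of a path *)

Lemma cvg_bigsum (R : realType) (T I : Type) (F : set_system T) (FF : Filter F)
    (r : seq I) (f : I -> T -> R) (l : I -> R) :
  (forall i, f i x @[x --> F] --> l i) ->
  \sum_(i <- r) f i x @[x --> F] --> \sum_(i <- r) l i.
Proof.
move=> fl; elim: r => [|i r IH].
  by rewrite big_nil; under eq_cvg do rewrite big_nil; exact: cvg_cst.
by rewrite big_cons; under eq_cvg do rewrite big_cons; exact: cvgD.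
Qed.

Section PairDensity.
Context {R : realType} {n : nat}.
Local Notation mu := (@lebesgue_measure R).

(** A version of [Phi'] that is semidefinite and bounded at every point, so that Loewner
    inequalities can be used under the integral. *)
Definition mx_density (N : R) (Phi phi : R -> 'M[R]_n) : Prop :=
  [/\ forall i j, bmeas 0 N (fun t => phi t i j),
    forall t, 0 <= t <= N -> psdmx (phi t),
    forall t i j, 0 <= t <= N -> `|phi t i j| <= 1 &
    forall s t i j, 0 <= s -> s <= t -> t <= N ->
      \int[mu]_(x in `[s, t]) phi x i j = Phi t i j - Phi s i j].

Variables (Q : 'M[R]_n) (p : cs_pair Q).
Hypothesis n0 : (0 < n)%N.
Let N : R := n%:R.
Let N0 : 0 < N. Proof. by rewrite ltr0n. Qed.

Let e i j (t : R) := csPhi p t i j.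

Let e_lip i j s t : 0 <= s <= N -> 0 <= t <= N -> `|e i j t - e i j s| <= `|t - s|.
Proof. exact: csPhi_lipschitz. Qed.

Let D : set R := `]0, N[%classic `&` [set t | forall i j, derivable (e i j) t 1].

Let DE : D = \bigcap_(i in [set: 'I_n]) \bigcap_(j in [set: 'I_n])
   (`]0, N[ `&` [set t | derivable (e i j) t 1]).
Proof.
apply/seteqP; split => t /=; first by move=> [tI td] i _ j _; split; [exact: tI|exact: td].
move=> h; split => [|i j]; last by have [] := h i I j I.
by have [] := h (Ordinal n0) I (Ordinal n0) I.
Qed.

Let mD : measurable D.
Proof.
rewrite DE; apply: fin_bigcap_measurable => // i _.
apply: fin_bigcap_measurable => // j _.
by have [h _ _ _] := lipschitz1_on_ftc N0 (@e_lip i j); exact: h.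
Qed.

Let aeF := ae_filter_ringOfSetsType mu.

Let aeD : {ae mu, forall t, t \in `]0, N[ -> D t}.
Proof.
have h i j : {ae mu, forall t, t \in `]0, N[ -> derivable (e i j) t 1}.
  by have [_ _ h _] := lipschitz1_on_ftc N0 (@e_lip i j).
have := filter_forall aeF (fun i => filter_forall aeF (h i)).
by apply: filterS => t ht tI; split => // i j; exact: ht.
Qed.

(** Off [D] the value of [csPhi'] may fail to be semidefinite; it is replaced by 0 there, which
    changes it on a null subset of [[0, N]] only. *)
Definition cs_density (t : R) : 'M[R]_n :=
  if t \in D then csPhi' p t else 0.

Let quotE i j t : D t -> diffquot (e i j) t h @[h --> 0^'] --> csPhi' p t i j.
Proof. by move=> [_ /(_ i j) dt]; rewrite mxE; exact: diffquot_cvg dt. Qed.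

(** For negative [h] both the increment and [h^-1] change sign. *)
Let quot_psd t : D t -> \forall h \near 0^', 0 <= h + t <= N /\
  psdmx (h^-1 *: (csPhi p (h + t) - csPhi p t)).
Proof.
move=> [/=]; rewrite in_itv/= => /andP[t0 tN] _.
exists (Num.min t (N - t)) => /=; first by rewrite lt_min t0 subr_gt0.
move=> h /=; rewrite sub0r normrN lt_min => /andP[ht hN] h0.
have /andP[h1 h2] : - t < h < t by rewrite -ltr_norml.
have /andP[h3 h4] : - (N - t) < h < N - t by rewrite -ltr_norml.
split; first by apply/andP; split; lra.
have [hp|hn] := ltP 0 h.
  by apply: psdmxZ; [rewrite invr_ge0 ltW|apply: csPhi_monotone; lra].
rewrite -opprB scalerN -scaleNr -invrN; apply: psdmxZ.
  by rewrite invr_ge0; lra.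
by apply: csPhi_monotone; lra.
Qed.

Let csPhi'_psd t : D t -> psdmx (csPhi' p t).
Proof.
move=> Dt; split.
  apply/matrixP => i j; rewrite mxE.
  apply: (cvg_unique _ (quotE (i := j) (j := i) Dt)) => //.
  apply: cvg_trans (quotE (i := i) (j := j) Dt); apply: near_eq_cvg.
  apply: filterS (quot_psd Dt) => h [_ ph].
  by have := psdmx_sym i j ph; rewrite !mxE.
move=> v; rewrite -/(qform _ _) qformE.
pose q h := qform (h^-1 *: (csPhi p (h + t) - csPhi p t)) v.
have qc : q h @[h --> 0^'] --> \sum_i \sum_j v i 0 * csPhi' p t i j * v j 0.
  rewrite /q; under eq_cvg do rewrite qformE.
  apply: cvg_bigsum => i; apply: cvg_bigsum => j.
  apply: cvgM; last exact: cvg_cst.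
  apply: cvgM; first exact: cvg_cst.
  apply: cvg_trans (quotE (i := i) (j := j) Dt); apply: near_eq_cvg.
  by apply: nearW => h; rewrite !mxE.
apply: (cvgr_to_ge qc).
by apply: filterS (quot_psd Dt) => h [_ ph]; exact: psd_ge0.
Qed.

Let meas_csPhi' i j : measurable_fun `[0, N] (fun t => csPhi' p t i j).
Proof.
apply: (@measurable_fun_itv_cc _ _ _ false true).
rewrite (_ : (fun t => _) = derive1 (e i j)); last by apply/funext => t; rewrite mxE.
by have [_ h _ _] := lipschitz1_on_ftc N0 (@e_lip i j).
Qed.

Let meas_density i j : measurable_fun `[0, N] (fun t => cs_density t i j).
Proof.
rewrite (_ : (fun t => _) = fun t => \1_D t * csPhi' p t i j); last first.
  apply/funext => t; rewrite /cs_density indicE.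
  by case: ifP => _; rewrite ?mul1r// mul0r mxE.
by apply: measurable_funM => //; exact: measurable_indic.
Qed.

Let ae_density : {ae mu, forall t, `[0, N]%classic t -> csPhi' p t = cs_density t}.
Proof.
have aeN (c : R) : {ae mu, forall t, t != c}.
  exists [set c]; split; [exact: measurable_set1|exact: lebesgue_measure_set1|].
  by move=> t /= /negP; rewrite negbK => /eqP.
apply: (@filterS _ _ aeF _ _ _ (@filterI _ _ aeF _ _ aeD (@filterI _ _ aeF _ _ (aeN 0) (aeN N)))).
move=> t [ht [t0 tN]] /=; rewrite in_itv/= => /andP[t0' tN'].
rewrite /cs_density mem_set//; apply: ht.
by rewrite in_itv/= lt_neqAle eq_sym t0 t0' lt_neqAle tN.
Qed.

Let density_le1 t i j : `|cs_density t i j| <= 1.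
Proof.
rewrite /cs_density; case: ifPn => [/set_mem[tI dt]|_]; last by rewrite mxE normr0.
rewrite mxE; apply: (@derive1_lipschitz_le1 _ _ 0 N); first by move=> u v; exact: e_lip.
  by move: tI; rewrite /= in_itv.
exact: dt.
Qed.

Let ae_int (F : R -> 'M[R]_n -> R) a b : 0 <= a -> b <= N ->
  measurable_fun `[a, b] (fun t => F t (csPhi' p t)) ->
  measurable_fun `[a, b] (fun t => F t (cs_density t)) ->
  \int[mu]_(t in `[a, b]) F t (csPhi' p t) =
  \int[mu]_(t in `[a, b]) F t (cs_density t).
Proof.
move=> a0 bN m1 m2; congr fine; apply: ae_eq_integral.
- exact: measurable_itv.
- exact/measurable_EFinP.
- exact/measurable_EFinP.
apply: (@filterS _ _ aeF _ _ _ ae_density).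
move=> t ht /=; rewrite in_itv/= => /andP[at_ tb].
by rewrite ht//= in_itv/= (le_trans a0)// (le_trans tb).
Qed.

Let msub a b (f : R -> R) : 0 <= a -> b <= N -> measurable_fun `[0, N] f ->
  measurable_fun `[a, b] f.
Proof.
move=> a0 bN; apply: measurable_funS; first exact: measurable_itv.
by move=> t /=; rewrite !in_itv/= => /andP[/(le_trans a0)-> /le_trans->].
Qed.

Lemma cs_density_int_entry (x : R -> R) a b i j : 0 <= a -> b <= N -> bmeas a b x ->
  \int[mu]_(t in `[a, b]) (x t * csPhi' p t i j) =
  \int[mu]_(t in `[a, b]) (x t * cs_density t i j).
Proof.
move=> a0 bN [mx _]; apply: (ae_int (F := fun t A => x t * A i j)) => //.
  by apply: measurable_funM => //; exact: msub.
by apply: measurable_funM => //; exact: msub.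
Qed.

Lemma cs_density_int_inner (w : R -> 'M[R]_n) a b : 0 <= a -> b <= N ->
  (forall i j, bmeas a b (fun t => w t i j)) ->
  \int[mu]_(t in `[a, b]) mx_inner (w t) (csPhi' p t) =
  \int[mu]_(t in `[a, b]) mx_inner (w t) (cs_density t).
Proof.
move=> a0 bN bw; apply: (ae_int (F := fun t A => mx_inner (w t) A)) => //.
  under [X in measurable_fun _ X]funext do rewrite mx_innerE.
  apply: measurable_sum => i; apply: measurable_sum => j.
  by apply: measurable_funM; [have [] := bw i j|exact: msub].
under [X in measurable_fun _ X]funext do rewrite mx_innerE.
apply: measurable_sum => i; apply: measurable_sum => j.
by apply: measurable_funM; [have [] := bw i j|exact: msub].
Qed.

Lemma cs_densityP : mx_density N (csPhi p) cs_density.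
Proof.
split=> [i j|t _|t i j _|s t i j s0 st tN].
- by split => //; exists 1 => t _.
- rewrite /cs_density; case: ifPn => [/set_mem|_]; first exact: csPhi'_psd.
  exact: psdmx0.
- exact: density_le1.
have <- : \int[mu]_(x in `[s, t]) csPhi' p x i j = \int[mu]_(x in `[s, t]) cs_density x i j.
  by apply: (ae_int (F := fun _ A => A i j)) => //; exact: msub.
have [_ _ _ h] := lipschitz1_on_ftc N0 (@e_lip i j).
rewrite -[RHS](h s t)//.
have mst : measurable_fun `[s, t] (fun x => (csPhi' p x i j)%:E).
  by apply/measurable_EFinP; exact: msub.
have mo : measurable_fun `]s, t] (fun x => (csPhi' p x i j)%:E).
  apply: measurable_funS mst; first exact: measurable_itv.
  by apply: subset_itvr; rewrite bnd_simp.
have moo : measurable_fun `]s, t[ (fun x => (csPhi' p x i j)%:E).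
  apply: measurable_funS mst; first exact: measurable_itv.
  exact: subset_itv_oo_cc.
transitivity (\int[mu]_(x in `]s, t[) csPhi' p x i j).
  by rewrite /Rintegral integral_itv_bndo_bndc// integral_itv_obnd_cbnd.
by apply: eq_Rintegral => x _; rewrite mxE.
Qed.

End PairDensity.

(** * Integrals along a path *)

Section MatrixBounds.
Context {R : realType} {n : nat}.
Implicit Types A B X : 'M[R]_n.

Lemma psdmx_diag_le_tr X i : psdmx X -> X i i <= \tr X.
Proof.
move=> pX; rewrite /mxtrace (bigD1 i)//= lerDl sumr_ge0// => j _.
exact: psdmx_diag_ge0.
Qed.

Lemma psdmx_entry_le_tr X i j : psdmx X -> `|X i j| <= \tr X.
Proof.
move=> pX; apply: le_trans (psdmx_off_diag i j pX) _.
by have := psdmx_diag_le_tr i pX; have := psdmx_diag_le_tr j pX; lra.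
Qed.

Lemma psdmx_inner_le_tr A B : psdmx A -> psdmx B ->
  mx_inner A B <= n%:R * (\tr A * \tr B).
Proof.
move=> pA pB; rewrite mx_innerE.
have trB : 0 <= \tr B by apply: sumr_ge0 => i _; exact: psdmx_diag_ge0.
apply: (@le_trans _ _ (\sum_(i < n) \sum_(j < n) (A i i + A j j) / 2 * \tr B)).
  apply: ler_sum => i _; apply: ler_sum => j _; apply: le_trans (ler_norm _) _.
  by rewrite normrM ler_pM// ?psdmx_off_diag// psdmx_entry_le_tr.
under eq_bigr do rewrite -mulr_suml.
rewrite -mulr_suml mulrA ler_wpM2r//.
under eq_bigr do rewrite -mulr_suml big_split/= sumr_const card_ord.
rewrite -mulr_suml big_split/= sumr_const card_ord sumrMnl -/(\tr A).
by rewrite -[_ *+ n]mulr_natl le_eqVlt; apply/orP; left; apply/eqP; field.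
Qed.

End MatrixBounds.

Section PathIntegrals.
Context {R : realType} {n : nat} {Q : 'M[R]_n}.
Local Notation mu := (@lebesgue_measure R).
Variable p : cs_pair Q.
Hypothesis n0 : (0 < n)%N.
Let N : R := n%:R.
Let phi := cs_density p.
Let Phi := csPhi p.

Lemma density_bmeas a b i j : 0 <= a -> b <= N -> bmeas a b (fun t => phi t i j).
Proof. by move=> a0 bN; have [h _ _ _] := cs_densityP p n0; exact: bmeas_sub (h i j). Qed.

Lemma density_psd t : 0 <= t <= N -> psdmx (phi t).
Proof. by have [_ h _ _] := cs_densityP p n0; exact: h. Qed.

Lemma density_int s t i j : 0 <= s -> s <= t -> t <= N ->
  \int[mu]_(x in `[s, t]) phi x i j = Phi t i j - Phi s i j.
Proof. by have [_ _ _ h] := cs_densityP p n0; exact: h. Qed.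

Lemma bmeas_inner (w : R -> 'M[R]_n) a b : 0 <= a -> b <= N ->
  (forall i j, bmeas a b (fun t => w t i j)) ->
  bmeas a b (fun t => mx_inner (w t) (phi t)).
Proof.
move=> a0 bN bw; under [X in bmeas _ _ X]funext do rewrite mx_innerE.
apply: bmeas_sum => i; apply: bmeas_sum => j; apply: bmeasM => //.
exact: density_bmeas.
Qed.

Lemma bint_inner_cst (A : 'M[R]_n) s t : 0 <= s -> s <= t -> t <= N ->
  \int[mu]_(x in `[s, t]) mx_inner A (phi x) = mx_inner A (Phi t - Phi s).
Proof.
move=> s0 st tN; rewrite mx_innerE.
rewrite (bint_eq (g := fun x => \sum_i \sum_j A i j * phi x j i)); last first.
  by move=> x _; rewrite mx_innerE.
have b i j : bmeas s t (fun x => A i j * phi x j i).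
  by apply: bmeasM; [exact: bmeas_cst|exact: density_bmeas].
rewrite bint_sum => [|i]; last exact: bmeas_sum.
apply: eq_bigr => i _; rewrite bint_sum => [|j]; last exact: b.
apply: eq_bigr => j _; rewrite bintZ; last exact: density_bmeas.
by rewrite density_int// !mxE.
Qed.

Lemma bint_inner_bounds (w : R -> 'M[R]_n) (A B : 'M[R]_n) s t :
  0 <= s -> s <= t -> t <= N ->
  (forall i j, bmeas s t (fun x => w x i j)) ->
  (forall x, s <= x <= t -> psdmx (w x - A)) ->
  (forall x, s <= x <= t -> psdmx (B - w x)) ->
  mx_inner A (Phi t - Phi s) <= \int[mu]_(x in `[s, t]) mx_inner (w x) (phi x) <=
  mx_inner B (Phi t - Phi s).
Proof.
move=> s0 st tN bw wA wB; rewrite -!bint_inner_cst//.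
have xI x : s <= x <= t -> 0 <= x <= N.
  by move=> /andP[sx xt]; rewrite (le_trans s0)// (le_trans xt).
have bc C : bmeas s t (fun x => mx_inner C (phi x)).
  by apply: bmeas_inner => // i j; exact: bmeas_cst.
have bwi : bmeas s t (fun x => mx_inner (w x) (phi x)) by exact: bmeas_inner.
apply/andP; split; apply: bint_le => // x xst; apply: mx_inner_le.
- exact: wA.
- by apply: density_psd; exact: xI.
- exact: wB.
- by apply: density_psd; exact: xI.
Qed.

(** The integral of [y] against [dPhi]; for [y = csx p] and [t = N] it is [cs_hatPhi p s]. The
    function [y] is free because the reduction rounds [x] and keeps the path. *)
Definition mxint (y : R -> R) s t : 'M[R]_n :=
  \matrix_(i, j) \int[mu]_(x in `[s, t]) (y x * phi x i j).

Lemma mxint_split y s t u : 0 <= s -> s <= t -> t <= u -> u <= N -> bmeas s u y ->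
  mxint y s u = mxint y s t + mxint y t u.
Proof.
move=> s0 st tu uN byy; apply/matrixP => i j; rewrite !mxE; apply: bint_split => //.
by apply: bmeasM => //; exact: density_bmeas.
Qed.

Lemma mxint_psd y s t : 0 <= s -> t <= N -> bmeas s t y ->
  (forall x, s <= x <= t -> 0 <= y x) -> psdmx (mxint y s t).
Proof.
move=> s0 tN byy y0.
have xI x : s <= x <= t -> 0 <= x <= N.
  by move=> /andP[sx xt]; rewrite (le_trans s0)// (le_trans xt).
split=> [|v].
  apply/matrixP => i j; rewrite !mxE; apply: bint_eq => x /xI/density_psd pd.
  by rewrite (psdmx_sym _ _ pd).
have b i j : bmeas s t (fun x => v i 0 * (y x * phi x i j) * v j 0).
  apply: bmeasM; last exact: bmeas_cst.
  apply: bmeasM; first exact: bmeas_cst.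
  by apply: bmeasM => //; exact: density_bmeas.
have -> : (v^T *m mxint y s t *m v) 0 0 =
    \int[mu]_(x in `[s, t]) (\sum_i \sum_j v i 0 * (y x * phi x i j) * v j 0).
  rewrite -/(qform _ _) qformE bint_sum => [|i]; last exact: bmeas_sum.
  apply: eq_bigr => i _; rewrite bint_sum => [|j]; last exact: b.
  apply: eq_bigr => j _.
  rewrite (bint_eq (g := fun x => (v i 0 * v j 0) * (y x * phi x i j))); last first.
    by move=> x _; ring.
  rewrite bintZ; last by apply: bmeasM => //; exact: density_bmeas.
  by rewrite mxE; ring.
apply: bint_ge0 => x xst.
have -> : \sum_i \sum_j v i 0 * (y x * phi x i j) * v j 0 = y x * qform (phi x) v.
  rewrite qformE mulr_sumr; apply: eq_bigr => i _; rewrite mulr_sumr.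
  by apply: eq_bigr => j _; ring.
by rewrite mulr_ge0 ?y0// psd_ge0//; apply: density_psd; exact: xI.
Qed.

Lemma mxintB y z s t : 0 <= s -> t <= N -> bmeas s t y -> bmeas s t z ->
  mxint y s t - mxint z s t = mxint (fun x => y x - z x) s t.
Proof.
move=> s0 tN byy bz; apply/matrixP => i j; rewrite !mxE.
have b w : bmeas s t w -> bmeas s t (fun x => w x * phi x i j).
  by move=> bw; apply: bmeasM => //; exact: density_bmeas.
by rewrite -bintB; [apply: bint_eq => x _; ring|exact: b..].
Qed.

(** Between two cuts a step function is known on the open interval only. *)
Lemma bint_eq_oo (f g : R -> R) a b : a <= b -> bmeas a b f -> bmeas a b g ->
  (forall t, a < t < b -> f t = g t) ->
  \int[mu]_(t in `[a, b]) f t = \int[mu]_(t in `[a, b]) g t.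
Proof.
move=> ab bf bg fg.
have E h : bmeas a b h -> \int[mu]_(t in `[a, b]) h t = \int[mu]_(t in `]a, b[) h t.
  move=> /bmeas_integrable hi.
  have i1 : mu.-integrable `]a, b] (EFin \o h).
    apply: integrableS hi; [exact: measurable_itv|exact: measurable_itv|].
    by apply: subset_itvr; rewrite bnd_simp.
  have i2 : mu.-integrable `]a, b[ (EFin \o h).
    apply: integrableS hi; [exact: measurable_itv|exact: measurable_itv|].
    exact: subset_itv_oo_cc.
  by rewrite -Rintegral_itv_obnd_cbnd// -Rintegral_itv_bndo_bndc.
rewrite !E//; apply: eq_Rintegral => t; rewrite inE/= in_itv/=; exact: fg.
Qed.

Lemma mxint_cst y c s t : 0 <= s -> s <= t -> t <= N -> bmeas s t y ->
  (forall x, s < x < t -> y x = c) -> mxint y s t = c *: (Phi t - Phi s).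
Proof.
move=> s0 st tN byy yc; apply/matrixP => i j; rewrite !mxE.
have bp : bmeas s t (fun x => phi x i j) by exact: density_bmeas.
rewrite (bint_eq_oo (g := fun x => c * phi x i j))//; first last.
- by move=> x /yc ->.
- by apply: bmeasM => //; exact: bmeas_cst.
- exact: bmeasM.
by rewrite bintZ// density_int.
Qed.

(** The increments of the inverse are semidefinite, and the trace of a semidefinite matrix bounds
    all its entries: one [V] serves every entry. *)
Lemma invmx_antitone_varbound (H : R -> 'M[R]_n) a b i j :
  (forall t, a <= t <= b -> pdmx (H t)) ->
  (forall s t, a <= s -> s <= t -> t <= b -> psdmx (H s - H t)) ->
  varbound a b (fun t => invmx (H t) i j) (fun t => \tr (invmx (H t))).
Proof.
move=> pH dH s t as_ st tb.
have pi : psdmx (invmx (H t) - invmx (H s)).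
  apply: psdmx_invB; last exact: dH.
    by apply: pH; rewrite tb (le_trans as_).
  by apply: pH; rewrite as_ (le_trans st).
have := psdmx_entry_le_tr i j pi; rewrite !mxE => /le_trans; apply.
by rewrite linearB.
Qed.

(* Both sides lie between the Riemann sums with the integrand [invmx (H x)],
   which is monotone, evaluated at the two ends of each subinterval. *)
Lemma bint_inv_lndet (H : R -> 'M[R]_n) c a b : 0 <= a -> a <= b -> b <= N -> 0 < c ->
  (forall t, a <= t <= b -> pdmx (H t)) ->
  (forall s t, a <= s -> s <= t -> t <= b -> H s - H t = c *: (Phi t - Phi s)) ->
  \int[mu]_(x in `[a, b]) mx_inner (invmx (H x)) (phi x) =
  (lndet (H a) - lndet (H b)) / c.
Proof.
move=> a0 ab bN c0 pH HE.
have pP s t : a <= s -> s <= t -> t <= b -> psdmx (Phi t - Phi s).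
  by move=> as_ st tb; apply: csPhi_monotone => //; [exact: le_trans as_|exact: le_trans bN].
have dH s t : a <= s -> s <= t -> t <= b -> psdmx (H s - H t).
  by move=> as_ st tb; rewrite HE//; apply: psdmxZ; [exact: ltW|exact: pP].
have bH s t i j : a <= s -> t <= b -> bmeas s t (fun x => invmx (H x) i j).
  move=> as_ tb; apply: bmeas_sub as_ tb _.
  exact/varbound_bmeas/invmx_antitone_varbound.
pose d s t := \int[mu]_(x in `[s, t]) mx_inner (invmx (H x)) (phi x) -
  (lndet (H s) - lndet (H t)) / c.
(* [additive_bound] is used with [e = 0]: on [[s, t]] the two Riemann terms differ by at most
   [N (t - s)] times the increment of the trace of the inverse. *)
suff : `|d a b| <= 0 * (\tr (invmx (H b)) - \tr (invmx (H a))).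
  by rewrite mul0r normr_le0 => /eqP; rewrite /d => /subr0_eq.
apply: (@additive_bound _ d (fun t => \tr (invmx (H t))) _ N) => //.
- move=> s t u as_ st tu ub; rewrite /d (@bint_split _ s t u)//.
    by rewrite !mulrBl; ring.
  apply: bmeas_inner; [exact: le_trans as_|exact: le_trans bN|].
  by move=> i j; exact: bH.
move=> s t as_ st tb; rewrite add0r.
have s0 : 0 <= s by exact: le_trans as_.
have tN : t <= N by exact: le_trans bN.
have pHs : pdmx (H s) by apply: pH; rewrite as_ (le_trans st).
have pHt : pdmx (H t) by apply: pH; rewrite tb (le_trans as_).
have /andP[i1 i2] : mx_inner (invmx (H s)) (Phi t - Phi s) <=
    \int[mu]_(x in `[s, t]) mx_inner (invmx (H x)) (phi x) <=
    mx_inner (invmx (H t)) (Phi t - Phi s).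
  apply: bint_inner_bounds => //.
  - by move=> i j; exact: bH.
  - move=> x /andP[sx xt]; apply: psdmx_invB => //.
      by apply: pH; rewrite (le_trans as_)// (le_trans xt).
    by apply: dH => //; exact: le_trans tb.
  move=> x /andP[sx xt]; apply: psdmx_invB => //.
    by apply: pH; rewrite (le_trans as_)// (le_trans xt).
  by apply: dH => //; exact: le_trans sx.
have j1 : mx_inner (invmx (H s)) (Phi t - Phi s) <= (lndet (H s) - lndet (H t)) / c.
  rewrite ler_pdivlMr// mulrC -mx_innerZr -HE// -opprB.
  have := pdmx_lndetB pHt pHs; rewrite -[H t - H s]opprB [X in _ <= X]mx_innerC mx_innerNl mx_innerC.
  by rewrite -/(lndet _) -/(lndet _); lra.
have j2 : (lndet (H s) - lndet (H t)) / c <= mx_inner (invmx (H t)) (Phi t - Phi s).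
  rewrite ler_pdivrMr// [X in _ <= X]mulrC -mx_innerZr -HE//.
  exact: pdmx_lndetB.
have up : mx_inner (invmx (H t)) (Phi t - Phi s) - mx_inner (invmx (H s)) (Phi t - Phi s) <=
    N * (t - s) * (\tr (invmx (H t)) - \tr (invmx (H s))).
  rewrite -mx_innerBl; apply: le_trans (psdmx_inner_le_tr _ (pP s t as_ st tb)) _.
    by apply: psdmx_invB => //; exact: dH.
  rewrite !linearB/= !csPhi_trace; last 2 first.
  - by rewrite s0 (le_trans st).
  - by rewrite tN (le_trans s0).
  by rewrite mulrAC mulrA.
by rewrite /d ler_norml; apply/andP; split; lra.
Qed.

End PathIntegrals.

(** * The series xi' *)

Section Hadamard.
Context {R : realType} {n : nat}.
Implicit Types A B : 'M[R]_n.

Definition hadamard A B : 'M[R]_n := \matrix_(i, j) (A i j * B i j).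

(** The Schur product theorem: for [A = U^T *m U] the form at [v] is the sum over [k] of the forms
    of [B] at the vectors with entries [U k i * v i 0]. *)
Lemma psdmx_hadamard A B : psdmx A -> psdmx B -> psdmx (hadamard A B).
Proof.
move=> pA pB; split=> [|v].
  by apply/matrixP => i j; rewrite !mxE (psdmx_sym _ _ pA) (psdmx_sym _ _ pB).
have [U EA _] := psdmx_cholesky pA.
rewrite -/(qform _ _) qformE.
have -> : \sum_i \sum_j v i 0 * hadamard A B i j * v j 0 =
    \sum_k qform B (\col_i (U k i * v i 0)).
  transitivity (\sum_i \sum_j \sum_k (U k i * v i 0) * B i j * (U k j * v j 0)).
    apply: eq_bigr => i _; apply: eq_bigr => j _.
    rewrite mxE EA mxE mulr_suml mulr_sumr mulr_suml; apply: eq_bigr => k _.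
    by rewrite mxE; ring.
  under eq_bigr do rewrite exchange_big/=.
  rewrite exchange_big/=; apply: eq_bigr => k _; rewrite qformE.
  by apply: eq_bigr => i _; apply: eq_bigr => j _; rewrite !mxE.
by apply: sumr_ge0 => k _; exact: psd_ge0.
Qed.

Definition hpow A k : 'M[R]_n := \matrix_(i, j) (A i j ^+ k).

Lemma hpowS A k : hpow A k.+1 = hadamard A (hpow A k).
Proof. by apply/matrixP => i j; rewrite !mxE exprS. Qed.

Lemma psdmx_hpow A k : psdmx A -> psdmx (hpow A k).
Proof.
move=> pA; elim: k => [|k IH]; last by rewrite hpowS; exact: psdmx_hadamard.
have -> : hpow A 0 = (const_mx 1 : 'rV[R]_n)^T *m const_mx 1.
  by apply/matrixP => i j; rewrite !mxE big_ord1 !mxE mulr1 expr0.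
exact: psdmx_tr_mul.
Qed.

(** The discrete product rule for Hadamard powers, with the Schur product theorem on each
    summand. *)
Lemma psdmx_hpowB A B k : psdmx A -> psdmx (B - A) -> psdmx (hpow B k - hpow A k).
Proof.
move=> pA AB; have pB : psdmx B by rewrite -[B](subrK A); exact: psdmxD.
elim: k => [|k IH].
  rewrite (_ : _ - _ = 0); first exact: psdmx0.
  by apply/matrixP => i j; rewrite !mxE !expr0 subrr.
have -> : hpow B k.+1 - hpow A k.+1 =
    hadamard (B - A) (hpow B k) + hadamard A (hpow B k - hpow A k).
  by apply/matrixP => i j; rewrite !mxE !exprS; ring.
by apply: psdmxD; apply: psdmx_hadamard => //; exact: psdmx_hpow.
Qed.

Lemma qform_limit (T : Type) (F : set_system T) {FF : Filter F} (G : T -> 'M[R]_n) A v :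
  (forall i j, G k i j @[k --> F] --> A i j) -> qform (G k) v @[k --> F] --> qform A v.
Proof.
move=> GA; rewrite qformE; under eq_cvg do rewrite qformE.
apply: cvg_bigsum => i; apply: cvg_bigsum => j.
by apply: cvgM; [apply: cvgM; [exact: cvg_cst|exact: GA]|exact: cvg_cst].
Qed.

Lemma psdmx_limit (T : Type) (F : set_system T) {FF : ProperFilter F} (G : T -> 'M[R]_n) A :
  (forall i j, G k i j @[k --> F] --> A i j) -> (\forall k \near F, psdmx (G k)) -> psdmx A.
Proof.
move=> GA pG; split=> [|v].
  apply/matrixP => i j; rewrite mxE; apply: (cvg_unique _ (GA j i)) => //.
  apply: cvg_trans (GA i j); apply: near_eq_cvg; apply: filterS pG => k pk.
  exact: psdmx_sym.
change (0 <= qform A v); have qc : qform (G k) v @[k --> F] --> qform A v by exact: qform_limit.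
have q0 : \forall k \near F, 0 <= qform (G k) v.
  by apply: filterS pG => k pk; exact: psd_ge0.
exact: (cvgr_to_ge qc q0).
Qed.

End Hadamard.

Section XiPrime.
Context {R : realType} {n : nat}.
Variable beta : nat -> 'cV[R]_n.
Hypothesis hsum : forall j : 'I_n,
  (\sum_(2 <= p <oo) (2 ^+ p * beta p j 0 ^+ 2)%:E < +oo)%E.

(** Dominates [p (p - 1) |beta_p(i) beta_p(j)|], by [p (p - 1) <= 2 ^ p] and the
    arithmetic-geometric inequality; this controls the series of [xi'] on [[-1, 1]] and its
    derivative at once. *)
Let b i j p : R := 2 ^+ p * (beta p i 0 ^+ 2 + beta p j 0 ^+ 2) / 2.

Let b_ge0 i j p : 0 <= b i j p.
Proof. by rewrite /b divr_ge0// mulr_ge0// ?exprn_ge0// addr_ge0// sqr_ge0. Qed.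

Lemma xi_bound : exists S : R, 0 <= S /\
  forall i j k, \sum_(2 <= p < k) b i j p <= S.
Proof.
have [S hS] : exists S : 'I_n -> R, forall j k,
    \sum_(2 <= p < k) 2 ^+ p * beta p j 0 ^+ 2 <= S j.
  exists (fun j => fine (\sum_(2 <= p <oo) (2 ^+ p * beta p j 0 ^+ 2)%:E)%E) => j k.
  have t0 p : (0 <= (2 ^+ p * beta p j 0 ^+ 2)%:E)%E.
    by rewrite lee_fin mulr_ge0 ?sqr_ge0 ?exprn_ge0.
  rewrite -lee_fin fineK; last first.
    by rewrite ge0_fin_numE// nneseries_ge0.
  rewrite -sumEFin; exact: nneseries_lim_ge.
have S0 j : 0 <= S j by have := hS j 0%N; rewrite big_geq.
exists (\sum_j S j); split; first exact: sumr_ge0.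
move=> i j k.
have le1 l : S l <= \sum_j S j by rewrite (bigD1 l)//= lerDl sumr_ge0.
have -> : \sum_(2 <= p < k) b i j p =
   (\sum_(2 <= p < k) 2 ^+ p * beta p i 0 ^+ 2 + \sum_(2 <= p < k) 2 ^+ p * beta p j 0 ^+ 2) / 2.
  by rewrite -big_split/= mulr_suml; apply: eq_bigr => p _; rewrite /b mulrDr.
by have := hS i k; have := hS j k; have := le1 i; have := le1 j; lra.
Qed.

Lemma expr_lipschitz (x y : R) k : `|x| <= 1 -> `|y| <= 1 ->
  `|x ^+ k - y ^+ k| <= k%:R * `|x - y|.
Proof.
move=> x1 y1; elim: k => [|k IH]; first by rewrite !expr0 subrr normr0 mul0r.
have -> : x ^+ k.+1 - y ^+ k.+1 = x * (x ^+ k - y ^+ k) + (x - y) * y ^+ k.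
  by rewrite !exprS; ring.
apply: le_trans (ler_normD _ _) _; rewrite !normrM -natr1 mulrDl mul1r.
apply: lerD.
  by apply: le_trans IH; rewrite ler_piMl.
by rewrite ler_piMr// normrX exprn_ile1.
Qed.

Lemma natr_le_expr2 p : (2 <= p)%N -> (p%:R : R) * p.-1%:R <= 2 ^+ p.
Proof.
move=> p2; rewrite -natrM -natrX ler_nat.
elim: p p2 => // p IH; rewrite leq_eqVlt => /predU1P[<-//|/= p2].
have := IH p2; rewrite expnS.
have : (p.*2 <= 2 ^ p)%N.
  elim: p p2 {IH} => // p IH; rewrite ltnS leq_eqVlt => /predU1P[<-//|/= p2].
  have := IH p2; rewrite expnS; rewrite -!muln2; lia.
case: p {IH} p2 => // p _ /=; rewrite -muln2; nia.
Qed.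

Let term i j p (x : R) : R := p%:R * (beta p *m (beta p)^T) i j * x ^+ p.-1.

Let coefE i j p : (beta p *m (beta p)^T) i j = beta p i 0 * beta p j 0.
Proof. by rewrite mxE big_ord1 !mxE. Qed.

Let coef_le i j p : (2 <= p)%N ->
  `|p%:R * (beta p *m (beta p)^T) i j| * p.-1%:R <= b i j p.
Proof.
move=> p2; rewrite coefE normrM ger0_norm ?ler0n// mulrAC /b -[2 ^+ p * _ / 2]mulrA.
apply: ler_pM; [by rewrite mulr_ge0 ?ler0n|exact: normr_ge0|exact: natr_le_expr2|].
rewrite ler_norml; have := sqr_ge0 (beta p i 0 - beta p j 0).
have := sqr_ge0 (beta p i 0 + beta p j 0); rewrite !expr2 => h1 h2.
by apply/andP; split; nra.
Qed.

Let term_le i j p x : (2 <= p)%N -> `|x| <= 1 -> `|term i j p x| <= b i j p.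
Proof.
move=> p2 x1; apply: le_trans (coef_le i j p2).
rewrite /term normrM ler_wpM2l//; apply: (@le_trans _ _ 1).
  by rewrite normrX exprn_ile1.
by rewrite ler1n; case: p p2 => // -[].
Qed.

(** The series is the difference of those of [term + b] and of [b], whose partial sums are
    nondecreasing and bounded. *)
Lemma xi'_cvg i j x : `|x| <= 1 -> cvgn (fun k => \sum_(2 <= p < k) term i j p x).
Proof.
move=> x1; have [S [S0 hS]] := xi_bound.
have E : (fun k => \sum_(2 <= p < k) term i j p x) =
    (fun k => \sum_(2 <= p < k) (term i j p x + b i j p)) -
    (fun k => \sum_(2 <= p < k) b i j p).
  apply/funext => k; rewrite !fctE -sumrB; apply: eq_bigr => p _.
  by rewrite addrK.
have nd (u : nat -> R) : (forall p, (2 <= p)%N -> 0 <= u p) ->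
    nondecreasing_seq (fun k => \sum_(2 <= p < k) u p).
  move=> u0; apply/nondecreasing_seqP => k.
  have [k2|k2] := leqP 2 k; first by rewrite big_nat_recr//= lerDl u0.
  by rewrite !big_geq// ltnW.
rewrite E; apply: is_cvgB; apply: nondecreasing_is_cvgn.
- apply: nd => p p2; have := term_le i j p2 x1; rewrite ler_norml => /andP[h _].
  by rewrite -lerBlDr sub0r.
- exists (S + S) => _ [k _ <-]; apply: (@le_trans _ _ (\sum_(2 <= p < k) (b i j p + b i j p))).
    apply: ler_sum_nat => p /andP[p2 _]; rewrite lerD2r.
    by apply: le_trans (ler_norm _) _; exact: term_le.
  by rewrite big_split/= lerD.
- by apply: nd => p _; exact: b_ge0.
- by exists S => _ [k _ <-]; exact: hS.
Qed.

(** On [[-1, 1]] the power [p.-1] is Lipschitz with constant [p.-1], and the resulting coefficients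
    are summable by [xi_bound]. *)
Lemma xi'_lipschitz : exists S : R, 0 <= S /\
  forall (A B : 'M[R]_n) i j, `|A i j| <= 1 -> `|B i j| <= 1 ->
    `|xi' beta A i j - xi' beta B i j| <= S * `|A i j - B i j|.
Proof.
have [S [S0 hS]] := xi_bound; exists S; split => // A B i j A1 B1.
rewrite !mxE.
have cA := @xi'_cvg i j _ A1; have cB := @xi'_cvg i j _ B1.
have nc : `|\sum_(2 <= p < k) term i j p (A i j) - \sum_(2 <= p < k) term i j p (B i j)|
    @[k --> \oo] -->
    `|limn (fun k => \sum_(2 <= p < k) term i j p (A i j)) -
      limn (fun k => \sum_(2 <= p < k) term i j p (B i j))|.
  by apply: cvg_norm; apply: cvgB; [exact: cA|exact: cB].
apply: (cvgr_to_le nc); apply: nearW => k; rewrite -sumrB.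
apply: le_trans (ler_norm_sum _ _ _) _.
apply: (@le_trans _ _ (\sum_(2 <= p < k) b i j p * `|A i j - B i j|)); last first.
  by rewrite -mulr_suml ler_wpM2r.
apply: ler_sum_nat => p /andP[p2 _]; rewrite /term -mulrBr normrM.
apply: le_trans (ler_wpM2r (normr_ge0 _) (coef_le i j p2)).
by rewrite -mulrA ler_wpM2l// expr_lipschitz.
Qed.

(** Each term is the Hadamard product of [beta_p beta_p^T] with a semidefinite difference of
    Hadamard powers, and semidefiniteness passes to the limit. *)
Lemma xi'_psdB (A B : 'M[R]_n) : psdmx A -> psdmx (B - A) ->
  (forall i j, `|A i j| <= 1) -> (forall i j, `|B i j| <= 1) ->
  psdmx (xi' beta B - xi' beta A).
Proof.
move=> pA AB A1 B1.
apply: (@psdmx_limit _ _ nat \oo _ (fun k => \matrix_(i, j) \sum_(2 <= p < k)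
   (term i j p (B i j) - term i j p (A i j)))).
  move=> i j; rewrite !mxE.
  under eq_cvg do rewrite mxE sumrB.
  exact: (cvgB (@xi'_cvg i j _ (B1 i j)) (@xi'_cvg i j _ (A1 i j))).
apply: nearW => k; have -> : \matrix_(i, j) \sum_(2 <= p < k)
   (term i j p (B i j) - term i j p (A i j)) =
   \sum_(2 <= p < k) p%:R *: hadamard (beta p *m (beta p)^T) (hpow B p.-1 - hpow A p.-1).
  apply/matrixP => i j; rewrite mxE summxE; apply: eq_bigr => p _.
  by rewrite /term !mxE; ring.
apply: psdmx_sum => p _; apply: psdmxZ; first exact: ler0n.
apply: psdmx_hadamard; last exact: psdmx_hpowB.
by have := psdmx_tr_mul (beta p)^T; rewrite trmxK.
Qed.

Lemma xi'0 : xi' beta 0 = 0.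
Proof.
apply/matrixP => i j; rewrite !mxE.
rewrite (_ : (fun k => _) = cst 0) ?lim_cst//.
apply/funext => k; apply: big1_seq => p /=; rewrite mem_index_iota => /andP[p2 _].
by rewrite expr0n; case: p p2 => // -[]// p _; rewrite mulr0.
Qed.

Lemma xi'_psd (A : 'M[R]_n) : psdmx A -> (forall i j, `|A i j| <= 1) ->
  psdmx (xi' beta A).
Proof.
move=> pA A1; rewrite -[xi' beta A]subr0 -xi'0; apply: xi'_psdB => //.
- exact: psdmx0.
- by rewrite subr0.
by move=> i j; rewrite mxE normr0.
Qed.

End XiPrime.

(** * The functional in terms of the density *)

Section PairFacts.
Context {R : realType} {n : nat} {Q : 'M[R]_n}.
Local Notation mu := (@lebesgue_measure R).
Variable p : cs_pair Q.
Hypothesis n0 : (0 < n)%N.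
Let N : R := n%:R.
Let N0 : 0 < N. Proof. by rewrite ltr0n. Qed.
Let N00 : 0 <= N. Proof. exact: ltW N0. Qed.

Lemma csx_bmeas a b : 0 <= a -> b <= N -> bmeas a b (csx p).
Proof.
move=> a0 bN; apply: bmeas_nondecreasing => s t as_ st tb.
by apply: csx_nondecreasing => //; [exact: le_trans as_|exact: le_trans bN].
Qed.

(** The generalized inverse of [x]: [x < c] strictly before this time and [c <= x] strictly after,
    while the value at the time itself is left open. *)
Definition cs_level (c : R) : R := inf [set t | 0 <= t <= N /\ c <= csx p t].

Lemma cs_txE : cs_tx p = cs_level 1.
Proof. by []. Qed.

Section level.
Variable c : R.
Hypothesis c1 : c <= 1.

Let L : set R := [set t | 0 <= t <= N /\ c <= csx p t].

Let L_N : L N.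
Proof. by split; [rewrite N00 lexx|rewrite csxn]. Qed.

Let L_lb : lbound L 0.
Proof. by move=> t [/andP[]]. Qed.

Lemma cs_level_ge0 : 0 <= cs_level c.
Proof. by apply: lb_le_inf; [exists N; exact: L_N|exact: L_lb]. Qed.

Lemma cs_level_le t : 0 <= t <= N -> c <= csx p t -> cs_level c <= t.
Proof. by move=> tN xt; apply: ge_inf; [exists 0; exact: L_lb|split]. Qed.

Lemma cs_level_leN : cs_level c <= N.
Proof. by apply: cs_level_le; [rewrite N00 lexx|rewrite csxn]. Qed.

Lemma csx_after_level t : cs_level c < t -> t <= N -> c <= csx p t.
Proof.
move=> ut tN; have ne : L !=set0 by exists N; exact: L_N.
have [s [/andP[s0 sN] xs] st] := inf_lt ne ut.
by apply: le_trans xs _; apply: csx_nondecreasing => //; exact: ltW.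
Qed.

Lemma csx_before_level t : 0 <= t -> t < cs_level c -> csx p t < c.
Proof.
move=> t0 tu; rewrite ltNge; apply/negP => cx.
have : cs_level c <= t.
  by apply: cs_level_le => //; rewrite t0 (le_trans (ltW tu))// cs_level_leN.
by rewrite leNgt tu.
Qed.

End level.

Lemma cs_level_homo c c' : c <= c' -> c' <= 1 -> cs_level c <= cs_level c'.
Proof.
move=> cc' c'1; rewrite /cs_level; apply: lb_le_inf.
  by exists N; split; [rewrite N00 lexx|rewrite csxn].
move=> t [tN xt]; apply: cs_level_le => //; exact: le_trans xt.
Qed.

Lemma cs_level0 : cs_level 0 = 0.
Proof.
apply/eqP; rewrite eq_le cs_level_ge0// andbT.
by apply: cs_level_le; [rewrite lexx|rewrite csx0].
Qed.

Lemma csx_after_tx t : cs_tx p < t -> t <= N -> csx p t = 1.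
Proof.
move=> ut tN; apply/eqP; rewrite eq_le (csx_after_level (lexx 1) ut tN) andbT.
have t0 : 0 <= t by rewrite (le_trans _ (ltW ut))// cs_level_ge0.
have /(csx_range p)/andP[_] : 0 <= t <= N by rewrite t0.
exact.
Qed.

Lemma csx_ge0 t : 0 <= t <= N -> 0 <= csx p t.
Proof. by move=> /(csx_range p) /andP[]. Qed.

Lemma csx_le1 t : 0 <= t <= N -> csx p t <= 1.
Proof. by move=> /(csx_range p) /andP[]. Qed.

Lemma csPhi_gap_psd t : 0 <= t <= N -> psdmx (Q - csPhi p t).
Proof. by move=> /andP[t0 tN]; have := csPhi_monotone p t0 tN (lexx N); rewrite csPhin. Qed.

Lemma cs_dom_pd : cs_dom p -> pdmx (cs_gap p).
Proof.
move=> dp; apply: psdmx_pdmx; last by rewrite gt_eqF.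
by apply: csPhi_gap_psd; rewrite cs_level_ge0// cs_level_leN.
Qed.

Lemma cs_hatPhiE t : 0 <= t -> cs_hatPhi p t = mxint p (csx p) t N.
Proof.
move=> t0; apply/matrixP => i j; rewrite !mxE.
by rewrite cs_density_int_entry//; exact: csx_bmeas.
Qed.

Section tail.
Variable y : R -> R.
Hypotheses (yb : bmeas 0 N y) (y0 : forall t, 0 <= t <= N -> 0 <= y t).

Let ybs a b : 0 <= a -> b <= N -> bmeas a b y.
Proof. by move=> a0 bN; exact: bmeas_sub yb. Qed.

Lemma mxint_tail_psdB s t : 0 <= s -> s <= t -> t <= N ->
  psdmx (mxint p y s N - mxint p y t N).
Proof.
move=> s0 st tN; rewrite (@mxint_split _ _ _ _ n0 y s t N)//; last exact: ybs.
rewrite addrK; apply: mxint_psd => //; first exact: ybs.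
by move=> x /andP[sx xt]; apply: y0; rewrite (le_trans s0)// (le_trans xt).
Qed.

Lemma mxint_tail1 t w : 0 <= w -> (forall s, w < s -> s <= N -> y s = 1) ->
  w <= t -> t <= N -> mxint p y t N = Q - csPhi p t.
Proof.
move=> w0 y1 wt tN; have t0 : 0 <= t by exact: le_trans wt.
rewrite (@mxint_cst _ _ _ _ n0 y 1)//; last 2 first.
- exact: ybs.
- by move=> x /andP[tx xN]; apply: y1 => //; [exact: le_lt_trans wt tx|exact: ltW].
by rewrite scale1r csPhin.
Qed.

(** The tail integral decreases in time, hence dominates its value [Q - Phi(w)] at the cut. *)
Lemma mxint_tail_pd t w : 0 <= w -> w <= N -> (forall s, w < s -> s <= N -> y s = 1) ->
  pdmx (Q - csPhi p w) -> 0 <= t <= w -> pdmx (mxint p y t N).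
Proof.
move=> w0 wN y1 pw /andP[t0 tw].
rewrite -[mxint _ _ t _](subrK (mxint p y w N)) addrC.
apply: pdmxDr; last exact: mxint_tail_psdB.
by rewrite (@mxint_tail1 w w)// w0.
Qed.

Lemma mxint_tail_inv_bmeas w i j a b : 0 <= w -> w <= N ->
  (forall s, w < s -> s <= N -> y s = 1) ->
  pdmx (Q - csPhi p w) -> 0 <= a -> b <= w ->
  bmeas a b (fun t => invmx (mxint p y t N) i j).
Proof.
move=> w0 wN y1 pw a0 bw; apply: bmeas_sub a0 bw _.
apply/varbound_bmeas/invmx_antitone_varbound.
  by move=> t tw; apply: (@mxint_tail_pd t w).
by move=> s t s0 st tw; apply: mxint_tail_psdB => //; exact: le_trans wN.
Qed.

(* With [y = 1] on [w, n] the tail integral is [Q - Phi] there, so the entropy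
   can be computed from any cut point [w' >= w]. *)
Lemma entropy_cut w w' : 0 <= w -> w <= w' -> w' <= N ->
  (forall s, w < s -> s <= N -> y s = 1) -> pdmx (Q - csPhi p w') ->
  lndet (Q - csPhi p w) +
    \int[mu]_(t in `[0, w]) mx_inner (invmx (mxint p y t N)) (cs_density p t) =
  lndet (Q - csPhi p w') +
    \int[mu]_(t in `[0, w']) mx_inner (invmx (mxint p y t N)) (cs_density p t).
Proof.
move=> w0 ww' w'N y1 pw'.
have w'0 : 0 <= w' by exact: le_trans ww'.
have y1' s : w' < s -> s <= N -> y s = 1.
  by move=> w's; apply: y1; exact: le_lt_trans w's.
rewrite (@bint_split _ 0 w w')//; last first.
  apply: bmeas_inner => // i j; exact: (@mxint_tail_inv_bmeas w').
rewrite (@bint_inv_lndet _ _ _ p n0 (fun t => mxint p y t N) 1 w w')//.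
- rewrite !(@mxint_tail1 _ w)//; last exact: le_trans w'N.
  by rewrite divr1; ring.
- move=> t /andP[wt tw']; apply: (@mxint_tail_pd t w') => //.
  by rewrite (le_trans w0).
move=> s t ws st tw'; rewrite !(@mxint_tail1 _ w)//; last 3 first.
- exact: le_trans st.
- exact: le_trans w'N.
- by rewrite (le_trans st)// (le_trans tw').
by rewrite scale1r; apply/matrixP => i j; rewrite !mxE; ring.
Qed.

End tail.

End PairFacts.

Section FunctionalFormula.
Context {R : realType} {n : nat}.
Local Notation mu := (@lebesgue_measure R).
Variables (h : 'cV[R]_n) (beta : nat -> 'cV[R]_n) (Q : 'M[R]_n).
Hypothesis n0 : (0 < n)%N.
Hypothesis hsum : forall j : 'I_n,
  (\sum_(2 <= p <oo) (2 ^+ p * beta p j 0 ^+ 2)%:E < +oo)%E.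
Hypothesis Q1 : forall j, Q j j = 1.
Let N : R := n%:R.
Let N0 : 0 < N. Proof. by rewrite ltr0n. Qed.
Let N00 : 0 <= N. Proof. exact: ltW N0. Qed.
Implicit Types p : cs_pair Q.

Definition cs_drift (A : 'M[R]_n) : 'M[R]_n := xi' beta A + h *m h^T.

Lemma psdmx_entry_le1 (A : 'M[R]_n) i j : psdmx A -> (forall k, A k k <= 1) ->
  `|A i j| <= 1.
Proof.
move=> pA A1; apply: le_trans (psdmx_off_diag i j pA) _.
by have := A1 i; have := A1 j; lra.
Qed.

Lemma csPhi_entry_le1 p t i j : 0 <= t <= N -> `|csPhi p t i j| <= 1.
Proof.
move=> tN; apply: psdmx_entry_le1 => [|k]; first exact: csPhi_psd.
by have := psdmx_diag_ge0 k (csPhi_gap_psd p tN); rewrite !mxE Q1 subr_ge0.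
Qed.

Lemma cs_Q_psd p : psdmx Q.
Proof. by rewrite -(csPhin p); apply: csPhi_psd; rewrite N00 lexx. Qed.

Lemma cs_drift_lipschitz : exists S : R, 0 <= S /\
  forall (A B : 'M[R]_n) i j, `|A i j| <= 1 -> `|B i j| <= 1 ->
    `|cs_drift A i j - cs_drift B i j| <= S * `|A i j - B i j|.
Proof.
have [S [S0 hS]] := xi'_lipschitz hsum; exists S; split => // A B i j A1 B1.
have -> : cs_drift A i j - cs_drift B i j = xi' beta A i j - xi' beta B i j.
  by rewrite /cs_drift ![(_ + _ : 'M[R]_n) i j]mxE; ring.
exact: hS.
Qed.

Lemma cs_drift_bmeas p a b i j : 0 <= a -> b <= N ->
  bmeas a b (fun t => cs_drift (csPhi p t) i j).
Proof.
move=> a0 bN; apply: bmeas_sub a0 bN _.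
have [S [S0 hS]] := cs_drift_lipschitz.
apply: (@varbound_bmeas _ _ _ _ (fun t => S * t)) => s t s0 st tN.
have sI : 0 <= s <= N by rewrite s0 (le_trans st).
have tI : 0 <= t <= N by rewrite tN (le_trans s0).
apply: le_trans (hS _ _ i j (csPhi_entry_le1 p i j tI) (csPhi_entry_le1 p i j sI)) _.
rewrite -mulrBr ler_wpM2l//.
by apply: le_trans (csPhi_lipschitz p i j sI tI) _; rewrite ger0_norm ?subr_ge0.
Qed.

Lemma cs_drift_psd A : psdmx A -> (forall k, A k k <= 1) -> psdmx (cs_drift A).
Proof.
move=> pA A1; apply: psdmxD.
  by apply: xi'_psd => // i j; exact: psdmx_entry_le1.
by have := psdmx_tr_mul h^T; rewrite trmxK.
Qed.

Lemma cs_drift_path_psd p t : 0 <= t <= N ->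
  psdmx (cs_drift (csPhi p t)) /\ psdmx (cs_drift Q - cs_drift (csPhi p t)).
Proof.
move=> tI; split.
  apply: cs_drift_psd => [|k]; first exact: csPhi_psd.
  by apply: le_trans (ler_norm _) _; exact: csPhi_entry_le1.
rewrite /cs_drift opprD addrACA subrr addr0; apply: xi'_psdB => //.
- exact: csPhi_psd.
- exact: csPhi_gap_psd.
- by move=> i j; exact: csPhi_entry_le1.
by move=> i j; apply: psdmx_entry_le1 => [|k]; [exact: cs_Q_psd p|rewrite Q1].
Qed.

(** In the energy and in the entropy the function [y] is separate from the pair, so that [x] can be
    changed along a fixed path; the cut [w] of the entropy is free for comparisons. *)
Definition cs_energy p (y : R -> R) : R :=
  \int[mu]_(t in `[0, N]) (y t * mx_inner (cs_drift (csPhi p t)) (cs_density p t)).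

Definition cs_entropy p (y : R -> R) (w : R) : R :=
  lndet (Q - csPhi p w) +
  \int[mu]_(t in `[0, w]) mx_inner (invmx (mxint p y t N)) (cs_density p t).

Lemma CrisantiSommersE p w : cs_dom p -> cs_tx p <= w -> w <= N ->
  pdmx (Q - csPhi p w) ->
  CrisantiSommers h beta p = 2^-1 * (cs_energy p (csx p) + cs_entropy p (csx p) w).
Proof.
move=> dp uw wN pw; have u0 := cs_level_ge0 p n0 (lexx 1).
have uN := cs_level_leN p n0 (lexx 1).
have xb := csx_bmeas p (lexx 0) (lexx N).
have x0 t : 0 <= t <= N -> 0 <= csx p t by exact: csx_ge0.
have x1 : forall s, cs_tx p < s -> s <= N -> csx p s = 1 by exact: csx_after_tx.
have pg : pdmx (Q - csPhi p (cs_tx p)) := cs_dom_pd n0 dp.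
rewrite /cs_entropy -(entropy_cut n0 xb x0 u0 uw wN x1 pw).
rewrite /CrisantiSommers -addrA; congr (_ * (_ + _)).
  rewrite (bint_eq (g := fun t =>
     mx_inner (csx p t *: cs_drift (csPhi p t)) (csPhi' p t))); last first.
    by move=> t _; rewrite mx_innerZl.
  rewrite cs_density_int_inner//; last first.
    move=> i j; under [X in bmeas _ _ X]funext do rewrite mxE.
    by apply: bmeasM => //; exact: cs_drift_bmeas.
  by apply: bint_eq => t _; rewrite mx_innerZl.
congr (_ + _); first by rewrite csPhin.
have bi i j : bmeas 0 (cs_tx p) (fun t => invmx (cs_hatPhi p t) i j).
  apply: (@bmeas_eq _ _ _ (fun t => invmx (mxint p (csx p) t N) i j)).
    by move=> t /andP[t0 _]; rewrite cs_hatPhiE.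
  exact: (mxint_tail_inv_bmeas n0 xb x0 i j u0 uN x1 pg (lexx 0) (lexx _)).
rewrite (cs_density_int_inner p n0 (lexx 0) uN bi).
by apply: bint_eq => t /andP[t0 _]; rewrite cs_hatPhiE.
Qed.

Lemma drift_inner_bmeas p a b : 0 <= a -> b <= N ->
  bmeas a b (fun t => mx_inner (cs_drift (csPhi p t)) (cs_density p t)).
Proof.
by move=> a0 bN; apply: bmeas_inner => // i j; exact: cs_drift_bmeas.
Qed.

Lemma drift_inner_ge0 p t : 0 <= t <= N ->
  0 <= mx_inner (cs_drift (csPhi p t)) (cs_density p t).
Proof.
move=> tI; apply: psdmx_inner_ge0; last exact: density_psd.
by have [] := cs_drift_path_psd p tI.
Qed.

(** The drift along the path is below its value at [Q] in the Loewner order, and the density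
    integrates to [Q]: the origin of [<xi'(Q) + h h^T, Q>] in the exponent. *)
Lemma cs_energyB_le p y z c : bmeas 0 N y -> bmeas 0 N z -> 0 <= c ->
  (forall t, 0 <= t <= N -> z t - y t <= c) ->
  cs_energy p z - cs_energy p y <= c * mx_inner (cs_drift Q) Q.
Proof.
move=> by_ bz c0 yz.
have bk := drift_inner_bmeas p (lexx 0) (lexx N).
have bc : bmeas 0 N (fun t => mx_inner (cs_drift Q) (cs_density p t)).
  by apply: bmeas_inner => // i j; exact: bmeas_cst.
have QE : mx_inner (cs_drift Q) Q =
    \int[mu]_(t in `[0, N]) mx_inner (cs_drift Q) (cs_density p t).
  by rewrite bint_inner_cst// csPhin csPhi0 subr0.
rewrite QE -bintZ// /cs_energy -bintB; [|exact: bmeasM..].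
apply: bint_le => [||t tI].
- by apply: bmeasB; exact: bmeasM.
- by apply: bmeasM => //; exact: bmeas_cst.
rewrite -mulrBl.
apply: (@le_trans _ _ (c * mx_inner (cs_drift (csPhi p t)) (cs_density p t))).
  by rewrite ler_wpM2r ?yz// drift_inner_ge0.
rewrite ler_wpM2l//; apply: mx_inner_le; last exact: density_psd.
by have [] := cs_drift_path_psd p tI.
Qed.

End FunctionalFormula.

(** * Reduction to csA *)

Section GapBound.
Context {R : realType} {n : nat}.
Implicit Types G : 'M[R]_n.

(* Since [(G^-1)_jj = sup_w (2 w_j - w^T G w)], this says that [G] is positive
   definite with entries of [G^-1] bounded by [L], in a form which is closed
   under limits and monotone in [G]. *)
Definition gap_bound (L : R) G : Prop :=
  psdmx G /\ forall (w : 'cV[R]_n) j, 2 * w j 0 - qform G w <= L.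

Lemma mx_norm_leP (A : 'M[R]_n) (L : R) : 0 <= L ->
  `|A| <= L <-> forall i j, `|A i j| <= L.
Proof.
move=> L0; have E : `|A| = \big[Num.max/0]_(ij : 'I_n * 'I_n) `|A ij.1 ij.2|.
  exact: mx_normrE.
rewrite E; split=> [AL i j|AL]; last by apply/bigmax_leP; split => // -[i j] _; exact: AL.
by apply: le_trans AL; exact: (le_bigmax _ (fun ij : 'I_n * 'I_n => `|A ij.1 ij.2|) (i, j)).
Qed.

(** Optimizing over the multiples of [w] turns the bound into a quadratic one; in other words [L G]
    dominates each [e_j e_j^T]. *)
Lemma gap_bound_sqr L G (w : 'cV[R]_n) j : 0 <= L -> gap_bound L G -> w j 0 ^+ 2 <= L * qform G w.
Proof.
move=> L0 [pG hG].
have h s : 2 * s * w j 0 - s ^+ 2 * qform G w <= L.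
  by have := hG (s *: w) j; rewrite mxE qformZv mulrA.
have q0 := psd_ge0 w pG.
have [qE|qn] := eqVneq (qform G w) 0.
  have [->|w0] := eqVneq (w j 0) 0; first by rewrite expr0n mulr_ge0.
  (* If the form vanishes at [w], the left side is linear in the multiple, and this multiple makes
     it [L + 1]. *)
  have := h ((L + 1) / (2 * w j 0)); rewrite qE mulr0 subr0.
  have -> : 2 * ((L + 1) / (2 * w j 0)) * w j 0 = L + 1 by field.
  by move=> ?; exfalso; lra.
have qp : 0 < qform G w by rewrite lt_neqAle eq_sym qn.
have := h (w j 0 / qform G w).
have -> : 2 * (w j 0 / qform G w) * w j 0 - (w j 0 / qform G w) ^+ 2 * qform G w =
   w j 0 ^+ 2 / qform G w by field.
by rewrite ler_pdivrMr.
Qed.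

Lemma gap_bound_pd L G : 0 <= L -> gap_bound L G -> pdmx G.
Proof.
move=> L0 hG; have [pG _] := hG; split; first by case: pG.
move=> v v0; rewrite -/(qform _ _) lt_neqAle psd_ge0// andbT eq_sym.
apply: contraNneq v0 => q0; apply/eqP/matrixP => j k; rewrite ord1 [RHS]mxE.
apply/eqP; rewrite -sqrf_eq0 eq_le sqr_ge0 andbT.
by have := @gap_bound_sqr L G v j L0 hG; rewrite q0 mulr0.
Qed.

Lemma gap_bound_mono L G G' : gap_bound L G -> psdmx (G' - G) -> gap_bound L G'.
Proof.
move=> [pG hG] GG'; split.
  by rewrite -[G'](subrK G); exact: psdmxD.
move=> w j; apply: le_trans (hG w j); rewrite lerD2l lerN2.
by rewrite -subr_ge0 -qformB psd_ge0.
Qed.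

Lemma qform_inv_diag G j : qform (invmx G) (delta_mx j 0) = invmx G j j.
Proof. exact: qform_delta. Qed.

Lemma dot_delta (w : 'cV[R]_n) j : (w^T *m delta_mx j 0 : 'M[R]_1) 0 0 = w j 0.
Proof. by rewrite -colE !mxE. Qed.

Lemma gap_boundP L G : 0 <= L -> psdmx G ->
  gap_bound L G <-> pdmx G /\ forall j, invmx G j j <= L.
Proof.
move=> L0 psG; split=> [hG|[pG iG]].
  have pG := gap_bound_pd L0 hG; split=> // j.
  rewrite -qform_inv_diag qform_inv_attained// dot_delta.
  by case: hG.
split=> // w j; apply: le_trans (iG j).
by rewrite -qform_inv_diag -(dot_delta w j); exact: qform_inv_dual.
Qed.

(** The inverse is semidefinite, so its diagonal bounds all its entries. *)
Lemma gap_bound_norm L G : 0 <= L -> psdmx G ->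
  gap_bound L G <-> 0 < \det G /\ `|invmx G| <= L.
Proof.
move=> L0 psG; split.
  move=> /(gap_boundP L0 psG)[pG iG]; split; first exact: pdmx_det_gt0.
  apply/(mx_norm_leP _ L0) => i j.
  have := psdmx_off_diag i j (pdmx_psd (pdmx_inv pG)).
  by have := iG i; have := iG j; lra.
move=> [dG] /(mx_norm_leP _ L0) iG; apply/(gap_boundP L0 psG); split.
  by apply: psdmx_pdmx => //; rewrite gt_eqF.
by move=> j; apply: le_trans (iG j j); exact: ler_norm.
Qed.

Lemma gap_bound_diag L G j : 0 <= L -> gap_bound L G -> 1 <= L * G j j.
Proof.
move=> L0 hG; have := gap_bound_sqr (delta_mx j 0) j L0 hG.
by rewrite mxE !eqxx expr1n /qform qform_delta.
Qed.

Lemma gap_bound_det L G : pdmx G -> (forall j, G j j <= 1) -> 0 < L ->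
  L^-1 <= \det G -> gap_bound L G.
Proof.
move=> pG G1 L0 dG; apply/gap_boundP; [exact: ltW|exact: pdmx_psd|split => // j].
apply: le_trans (pdmx_inv_diag_le j pG G1) _.
by rewrite -[L]invrK lef_pV2// posrE ?invr_gt0// pdmx_det_gt0.
Qed.

End GapBound.

Section CompactSet.
Context {R : realType} {n : nat}.
Variables (h : 'cV[R]_n) (beta : nat -> 'cV[R]_n) (Q : 'M[R]_n).
Hypothesis n0 : (0 < n)%N.
Hypothesis hsum : forall j : 'I_n,
  (\sum_(2 <= p <oo) (2 ^+ p * beta p j 0 ^+ 2)%:E < +oo)%E.
Hypothesis Q1 : forall j, Q j j = 1.
Hypothesis pQ : pdmx Q.
Let N : R := n%:R.
Let T := cs_T h beta Q.
Let L := cs_L h beta Q.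

Lemma cs_drift_inner_ge0 : 0 <= mx_inner (cs_drift h beta Q) Q.
Proof.
apply: psdmx_inner_ge0; last exact: pdmx_psd.
by apply: cs_drift_psd => // [|k]; [exact: pdmx_psd|rewrite Q1].
Qed.

Lemma lndet_Q_le0 : lndet Q <= 0.
Proof.
rewrite /lndet -ln1 ler_ln ?posrE ?ltr01 ?pdmx_det_gt0//.
apply: le_trans (psdmx_det_le_diag (pdmx_psd pQ)) _.
by rewrite big1.
Qed.

Lemma cs_exponentE : cs_exponent h beta Q =
  mx_inner (cs_drift h beta Q) Q + n%:R - lndet Q.
Proof. by rewrite /cs_exponent /cs_drift [h *m _ + _]addrC. Qed.

Lemma cs_exponent_gt0 : 0 < cs_exponent h beta Q.
Proof.
rewrite cs_exponentE; have := cs_drift_inner_ge0; have := lndet_Q_le0.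
have : (0 : R) < n%:R by rewrite ltr0n.
by lra.
Qed.

Lemma exp_le_cs_L : expR (cs_exponent h beta Q) <= L.
Proof.
have s1 : 1 <= Num.sqrt (n%:R : R).
  by rewrite -[leLHS]sqrtr1; apply: ler_wsqrtr; rewrite ler1n.
by rewrite /L /cs_L ler_peMl// expR_ge0.
Qed.

Lemma cs_L_gt1 : 1 < L.
Proof.
apply: lt_le_trans exp_le_cs_L; rewrite -expR0 ltr_expR; exact: cs_exponent_gt0.
Qed.

Lemma cs_TE : T = N - L^-1.
Proof. by rewrite /T /cs_T /L /cs_L expRN invfM. Qed.

Lemma cs_T_gt0 : 0 < T.
Proof.
rewrite cs_TE subr_gt0; apply: (@lt_le_trans _ _ 1); last by rewrite ler1n.
by rewrite invf_lt1 ?cs_L_gt1// (lt_trans ltr01 cs_L_gt1).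
Qed.

(** Right-continuity carries the value 1 from the right of [t_x] to [t_x]; it is available at
    interior points only. *)
Lemma csx_at_tx (p : cs_pair Q) : 0 < cs_tx p < N -> csx p (cs_tx p) = 1.
Proof.
move=> uI; have rc := @csx_right_continuous _ _ _ p _ uI; have /andP[u0 uN] := uI.
have near1 : \forall s \near (cs_tx p)^'+, csx p s = 1.
  near=> s; apply: (csx_after_tx n0); near: s; [exact: nbhs_right_gt|exact: nbhs_right_le].
have c1 : csx p s @[s --> (cs_tx p)^'+] --> (1 : R).
  have c1' : (fun=> (1 : R)) s @[s --> (cs_tx p)^'+] --> (1 : R) by exact: cvg_cst.
  by apply: cvg_trans c1'; apply: near_eq_cvg; apply: filterS near1 => s ->.
exact: (cvg_unique (@Rhausdorff R) rc c1).
Unshelve. all: by end_near. Qed.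

(* The condition on [T] is automatic: the diagonal entries of the gap are at least
   [1/L] and its trace is [n - t_x], so [t_x <= n - n/L <= T]. *)
Lemma csAP (p : cs_pair Q) : csA Q T L p <-> gap_bound L (cs_gap p).
Proof.
have L1 := cs_L_gt1; have L0 : 0 <= L by lra.
have uge0 := cs_level_ge0 p n0 (lexx 1).
have uleN := cs_level_leN p n0 (lexx 1).
have psG : psdmx (cs_gap p) by apply: csPhi_gap_psd; rewrite uge0 uleN.
split=> [[dp _ iG]|hG]; first by apply/(gap_bound_norm L0 psG).
have [dp iG] := (gap_bound_norm L0 psG).1 hG; split => // t /andP[Tt tN].
have trG : \tr (cs_gap p) = N - cs_tx p.
  rewrite /cs_gap linearB/= csPhi_trace ?uge0 ?uleN//; congr (_ - _).
  have NI : 0 <= N <= N by apply/andP; split; [exact: ler0n|exact: lexx].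
  by have := csPhi_trace p NI; rewrite csPhin.
have uT : cs_tx p <= T.
  rewrite cs_TE lerBrDl -lerBrDr -trG.
  have j0 := Ordinal n0; apply: (@le_trans _ _ (cs_gap p j0 j0)).
    rewrite -(ler_pM2l (_ : 0 < L)); last by lra.
    by rewrite divff ?gap_bound_diag//; apply: lt0r_neq0; lra.
  exact: psdmx_diag_le_tr.
have [utx|ntx] := ltP (cs_tx p) t; first exact: csx_after_tx.
have tE : t = cs_tx p by apply/eqP; rewrite eq_le ntx (le_trans uT Tt).
(* The remaining case is [t = t_x = T], an interior point since [0 < T < n]. *)
rewrite tE; apply: csx_at_tx; apply/andP; split.
  by rewrite -tE; apply: lt_le_trans Tt; exact: cs_T_gt0.
apply: le_lt_trans uT _; rewrite cs_TE gtrBl invr_gt0; lra.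
Qed.

End CompactSet.

(** * Step functions along a fixed path *)

Section StepPair.
Context {R : realType} {n : nat} {Q : 'M[R]_n}.
Local Notation mu := (@lebesgue_measure R).
Hypothesis n0 : (0 < n)%N.
Let N : R := n%:R.
Let N0 : 0 < N. Proof. by rewrite ltr0n. Qed.
Let N00 : 0 <= N. Proof. exact: ltW N0. Qed.

Variables (q : cs_pair Q) (k i : nat).
Hypothesis k0 : (0 < k)%N.
Let kp : (0 : R) < k%:R. Proof. by rewrite ltr0n. Qed.

(* [csx q] rounded up to the grid of step [1/k] and raised by [i/k]. *)
Definition step_x (t : R) : R :=
  if t <= 0 then 0
  else (minn (Num.truncn (k%:R * csx q t) + i.+1) k)%:R / k%:R.

Let kx0 t : 0 <= t <= N -> 0 <= k%:R * csx q t.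
Proof. by move=> tI; rewrite mulr_ge0 ?ler0n//; exact: csx_ge0. Qed.

Lemma step_x_range t : 0 <= t <= N -> 0 <= step_x t <= 1.
Proof.
move=> _; rewrite /step_x; case: ifP => _; first by rewrite lexx ler01.
by rewrite divr_ge0 ?ler0n//= ler_pdivrMr// mul1r ler_nat geq_minr.
Qed.

Lemma step_x_nondecreasing s t : 0 <= s -> s <= t -> t <= N -> step_x s <= step_x t.
Proof.
move=> s0 st tN; have tI : 0 <= t <= N by rewrite tN (le_trans s0).
rewrite {1}/step_x; case: ifPn => [_|]; first by have /andP[] := step_x_range tI.
rewrite -ltNge => sp; rewrite /step_x [t <= 0]leNgt (lt_le_trans sp st)/=.
rewrite ler_wpM2r ?invr_ge0 ?ler0n// ler_nat.
have : (Num.truncn (k%:R * csx q s) <= Num.truncn (k%:R * csx q t))%N.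
  by apply: le_truncn; rewrite ler_wpM2l ?ler0n//; exact: csx_nondecreasing.
by move=> h; rewrite leq_min geq_minr andbT geq_min leq_add2r h.
Qed.

(** Rounding by the floor plus one, not by the ceiling, preserves right-continuity: just to the
    right of [t] the floor of [k x] keeps its value. *)
Lemma step_x_right_continuous t : 0 < t < N -> step_x s @[s --> t^'+] --> step_x t.
Proof.
move=> tI; have /andP[t0 tN] := tI.
have tI' : 0 <= t <= N by rewrite !ltW.
have rc := @csx_right_continuous _ _ _ q _ tI.
set m := Num.truncn (k%:R * csx q t).
have : (m%:R <= k%:R * csx q t < m.+1%:R) by rewrite -truncn_eq ?kx0.
move=> /andP[m1 m2].
have nr : \forall s \near t^'+, csx q s < m.+1%:R / k%:R.
  by apply: (cvgr_lt _ rc); rewrite ltr_pdivlMr// mulrC.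
have ct : (fun=> step_x t) s @[s --> t^'+] --> step_x t by exact: cvg_cst.
apply: cvg_trans ct; apply: near_eq_cvg; near=> s.
have ts : t < s by near: s; exact: nbhs_right_gt.
have sN : s <= N by near: s; exact: nbhs_right_le.
have sx : csx q s < m.+1%:R / k%:R by near: s.
rewrite /step_x !leNgt t0 (lt_trans t0 ts)/=; congr ((minn (_ + _) _)%:R / _).
apply/esym/eqP; rewrite truncn_eq; last first.
  by apply: kx0; rewrite sN (le_trans (ltW t0))// ltW.
apply/andP; split; last by rewrite mulrC -ltr_pdivlMr.
apply: le_trans m1 _; rewrite ler_wpM2l ?ler0n//.
by apply: csx_nondecreasing => //; exact: ltW.
Unshelve. all: by end_near. Qed.

Lemma step_x0 : step_x 0 = 0.
Proof. by rewrite /step_x lexx. Qed.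

Lemma step_xn : step_x N = 1.
Proof.
rewrite /step_x leNgt N0/= csxn mulr1 natrK.
by rewrite (minn_idPr _) ?leq_addr// divff// gt_eqF.
Qed.

Definition step_pair : cs_pair Q :=
  CSPair step_x_range step_x_nondecreasing step_x_right_continuous step_x0 step_xn
    (csPhi_psd q) (csPhi_lipschitz q) (csPhi_monotone q) (csPhi_trace q)
    (csPhi0 q) (csPhin q).

(** The cuts do not depend on the raise [i]; only the values of the step function between them
    do. *)
Definition step_time (j : nat) : R := cs_level q (j%:R / k%:R).

Let jk1 j : (j <= k)%N -> (j%:R / k%:R : R) <= 1.
Proof. by move=> jk; rewrite ler_pdivrMr// mul1r ler_nat. Qed.

Lemma step_time_range j : (j <= k)%N -> 0 <= step_time j <= N.
Proof. by move=> jk; rewrite cs_level_ge0 ?cs_level_leN ?jk1. Qed.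

Lemma step_time_homo j j' : (j <= j')%N -> (j' <= k)%N -> step_time j <= step_time j'.
Proof.
move=> jj' j'k; apply: cs_level_homo; [by []| |exact: jk1].
by rewrite ler_wpM2r ?invr_ge0 ?ler0n// ler_nat.
Qed.

Lemma step_time0 : step_time 0 = 0.
Proof. by rewrite /step_time mul0r cs_level0. Qed.

Lemma step_timek : step_time k = cs_tx q.
Proof. by rewrite /step_time divff ?gt_eqF. Qed.

Lemma step_x_layer j t : (j < k)%N -> step_time j < t -> t < step_time j.+1 ->
  step_x t = (minn (j + i.+1) k)%:R / k%:R.
Proof.
move=> jk jt tj; have /andP[j0 jN] := step_time_range (ltnW jk).
have /andP[j0' jN'] := step_time_range jk.
have t0 : 0 < t by exact: le_lt_trans jt.
have tN : t <= N by rewrite (le_trans (ltW tj)).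
rewrite /step_x leNgt t0/=; congr ((minn (_ + _) _)%:R / _); apply/eqP.
rewrite truncn_eq; last by rewrite kx0// tN ltW.
apply/andP; split.
  by rewrite mulrC -ler_pdivrMr//; apply: csx_after_level => //; exact: jk1 (ltnW jk).
by rewrite mulrC -ltr_pdivlMr//; apply: csx_before_level => //; [exact: jk1|exact: ltW].
Qed.

(** One more raise makes the step function equal to 1 from one cut earlier on. *)
Lemma step_x_after j t : (j <= k)%N -> (k <= j + i.+1)%N -> step_time j < t -> t <= N ->
  step_x t = 1.
Proof.
move=> jk kij jt tN; have /andP[j0 jN] := step_time_range jk.
have t0 : 0 < t by exact: le_lt_trans jt.
rewrite /step_x leNgt t0/= (minn_idPr _) ?divff ?gt_eqF//.
apply: (leq_trans kij); rewrite leq_add2r truncn_ge_nat; last by rewrite kx0// tN ltW.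
by rewrite mulrC -ler_pdivrMr//; apply: csx_after_level => //; exact: jk1.
Qed.

End StepPair.

Section Reduction.
Context {R : realType} {n : nat}.
Local Notation mu := (@lebesgue_measure R).
Variables (h : 'cV[R]_n) (beta : nat -> 'cV[R]_n) (Q : 'M[R]_n).
Hypothesis n0 : (0 < n)%N.
Hypothesis hsum : forall j : 'I_n,
  (\sum_(2 <= p <oo) (2 ^+ p * beta p j 0 ^+ 2)%:E < +oo)%E.
Hypothesis Q1 : forall j, Q j j = 1.
Hypothesis pQ : pdmx Q.
Let N : R := n%:R.
Let N00 : 0 <= N. Proof. exact: ler0n. Qed.
Let L := cs_L h beta Q.
Local Notation CS := (CrisantiSommers h beta).

Variables (q : cs_pair Q) (k : nat).
Hypotheses (dq : cs_dom q) (k0 : (0 < k)%N).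
Let kp : (0 : R) < k%:R. Proof. by rewrite ltr0n. Qed.

Let st := step_time q k.
Let P j : 'M[R]_n := Q - csPhi q (st j).

Let st_range j : (j <= k)%N -> 0 <= st j <= N.
Proof. exact: step_time_range. Qed.

Let P_pd j : (j <= k)%N -> pdmx (P j).
Proof.
move=> jk; have /andP[j0 jN] := st_range jk.
have -> : P j = cs_gap q + (csPhi q (cs_tx q) - csPhi q (st j)).
  by apply/matrixP => a b; rewrite !mxE; ring.
apply: pdmxDr; first exact: cs_dom_pd.
apply: csPhi_monotone => //.
  by rewrite -(step_timek q k0); exact: step_time_homo.
exact: cs_level_leN.
Qed.

Let PB j : P j - P j.+1 = csPhi q (st j.+1) - csPhi q (st j).
Proof. by apply/matrixP => a b; rewrite !mxE; ring. Qed.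

Let PB_psd j : (j < k)%N -> psdmx (P j - P j.+1).
Proof.
move=> jk; rewrite PB; have /andP[j0 jN] := st_range (ltnW jk).
have /andP[j0' jN'] := st_range jk.
by apply: csPhi_monotone => //; exact: step_time_homo.
Qed.

Let step_bmeas i : bmeas 0 N (step_x q k i).
Proof. exact: (csx_bmeas (step_pair n0 q i k0) (lexx 0) (lexx N)). Qed.

Let step_ge0 i t : 0 <= t <= N -> 0 <= step_x q k i t.
Proof. by move=> tI; have /andP[] := step_x_range q i k0 tI. Qed.

Section entropy.
Variables (i m : nat).
Hypotheses (mk : (m <= k)%N) (mik : (m + i <= k)%N) (kmi : (k <= m + i.+1)%N).

Let y := step_x q k i.
Let c l : R := (l + i.+1)%:R / k%:R.
Let H t := mxint q y t N.

Let y1 t : st m < t -> t <= N -> y t = 1.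
Proof. exact: step_x_after. Qed.

Let y_layer l t : (l < m)%N -> st l < t -> t < st l.+1 -> y t = c l.
Proof.
move=> lm lt tl; rewrite /y (step_x_layer n0 i k0 _ lt tl); last exact: leq_trans mk.
rewrite (minn_idPl _)//; apply: leq_trans mik; rewrite addnS -addSn leq_add2r.
exact: lm.
Qed.

Let H_layer l s t : (l < m)%N -> st l <= s -> s <= t -> t <= st l.+1 ->
  H s - H t = c l *: (csPhi q t - csPhi q s).
Proof.
move=> lm ls st_ tl.
have /andP[l0 lN] := st_range (leq_trans (ltnW lm) mk).
have /andP[l0' lN'] := st_range (leq_trans lm mk).
have s0 : 0 <= s by exact: le_trans ls.
have tN : t <= N by exact: le_trans lN'.
rewrite /H (@mxint_split _ _ _ q n0 y s t N)//; last exact: bmeas_sub (step_bmeas i).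
rewrite addrK; apply: mxint_cst => //; first exact: bmeas_sub (step_bmeas i).
move=> x /andP[sx xt]; apply: (y_layer lm); first exact: le_lt_trans sx.
exact: lt_le_trans tl.
Qed.

Let H_layer_mx l : (l <= m)%N -> H (st l) = layer_mx m P c l.
Proof.
move=> lm; have := subnK lm; set d := (m - l)%N; move: d => d.
elim: d l lm => [|d IH] l lm dl.
  have -> : l = m by rewrite -dl.
  have /andP[m0 mN] := st_range mk.
  rewrite /layer_mx big_geq// addr0 /H.
  exact: (@mxint_tail1 _ _ _ q n0 y (step_bmeas i) (st m) (st m)).
have ltm : (l < m)%N by rewrite -dl addSn ltnS leq_addl.
rewrite layer_mxS// -IH//; last by rewrite -dl addnS addSn.
rewrite PB -(H_layer ltm)//; first by rewrite addrC subrK.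
by apply: step_time_homo => //; exact: leq_trans mk.
Qed.

Let H_pd t : 0 <= t <= st m -> pdmx (H t).
Proof.
have /andP[m0 mN] := st_range mk.
move=> tI; apply: (@mxint_tail_pd _ _ _ q n0 y (step_bmeas i) (@step_ge0 i) t (st m)) => //.
exact: P_pd.
Qed.

(** The two bounds on [m + i] allow [m = k - i] and [m = k - i - 1], so consecutive raises have a
    cut in common. Before such a cut the levels [(l + i.+1) / k] are at most 1 without truncation,
    and each layer contributes a slope by [bint_inv_lndet]. *)
Lemma step_entropy :
  cs_entropy q y (st m) = lndet (P m) + layer_sum m P c m.
Proof.
rewrite /cs_entropy; congr (_ + _).
have /andP[m0 mN] := st_range mk.
have bH a b : 0 <= a -> b <= st m ->
    bmeas a b (fun t => mx_inner (invmx (H t)) (cs_density q t)).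
  move=> a0 bm; apply: bmeas_inner => //; first exact: le_trans mN.
  move=> u v; exact: (@mxint_tail_inv_bmeas _ _ _ q n0 y (step_bmeas i) (@step_ge0 i)
    (st m) u v a b m0 mN y1 (P_pd mk) a0 bm).
have : forall l, (l <= m)%N ->
    \int[mu]_(t in `[0, st l]) mx_inner (invmx (H t)) (cs_density q t) = layer_sum m P c l.
  elim=> [|l IH] lm.
    by rewrite /st step_time0// bint_set1 /layer_sum big_geq.
  have /andP[l0 lN] := st_range (leq_trans (ltnW lm) mk).
  have /andP[l0' lN'] := st_range (leq_trans lm mk).
  have ll : st l <= st l.+1 by apply: step_time_homo => //; exact: leq_trans mk.
  have lm' : st l.+1 <= st m by exact: step_time_homo.
  rewrite (@bint_split _ 0 (st l) (st l.+1))//; last exact: bH.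
  rewrite IH ?(ltnW lm)// /layer_sum big_nat_recr//=; congr (_ + _).
  rewrite (@bint_inv_lndet _ _ _ q n0 H (c l) (st l) (st l.+1))//.
  - by rewrite (H_layer_mx (ltnW lm)) (H_layer_mx lm) [layer_mx m P c l]layer_mxS.
  - by rewrite divr_gt0// ltr0n addnS.
  - by move=> t /andP[lt tl]; apply: H_pd; rewrite (le_trans l0)// (le_trans tl).
  - by move=> s t; exact: H_layer.
by apply.
Qed.

Let p := step_pair n0 q i k0.

Let tx_le : cs_tx p <= st m.
Proof.
have /andP[m0 mN] := st_range mk.
(* The step function is known to be 1 strictly after the cut, so a point between the cut and [t_x]
   is tested. *)
rewrite leNgt; apply/negP => mt; pose t := (st m + cs_tx p) / 2.
have tN : t <= N by have := cs_level_leN p n0 (lexx 1); rewrite -/(cs_tx p) /t /N; lra.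
have : cs_tx p <= t.
  apply: cs_level_le; first by apply/andP; split=> //; rewrite /t; lra.
  have mt' : st m < t by rewrite /t; lra.
  by have := y1 mt' tN; rewrite -[y t]/(csx p t) => ->.
by rewrite /t; lra.
Qed.

Lemma step_gap_psdB : psdmx (cs_gap p - P m).
Proof.
have /andP[m0 mN] := st_range mk.
have -> : cs_gap p - P m = csPhi q (st m) - csPhi q (cs_tx p).
  by apply/matrixP => a b; rewrite !mxE /=; ring.
by apply: csPhi_monotone => //; exact: (cs_level_ge0 p n0 (lexx 1)).
Qed.

Lemma step_CS : CS p = 2^-1 * (cs_energy h beta q y + cs_entropy q y (st m)).
Proof.
have /andP[m0 mN] := st_range mk.
apply: (CrisantiSommersE h n0 hsum Q1 (p := p) (w := st m)) => //; last exact: P_pd.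
rewrite /cs_dom/=; apply: pdmx_det_gt0.
rewrite -[cs_gap p](subrK (P m)) addrC; apply: pdmxDr; first exact: P_pd.
exact: step_gap_psdB.
Qed.

End entropy.

Let E := cs_exponent h beta Q.
Let stp i := step_pair n0 q i k0.

(* The cut point for level [i] is also a cut point for level [i + 1]; raising
   the levels by [1/k] lowers the entropy by at least
   [(lndet Q - lndet (P m) - n) / k] and costs at most [<K, Q> / k]. *)
Lemma step_CS_le i m : (0 < m)%N -> (m + i.+1)%N = k -> lndet (P m) <= - E ->
  CS (stp i.+1) <= CS (stp i).
Proof.
move=> m0 mik lm; have mk : (m <= k)%N by rewrite -mik leq_addr.
have h1 : (m + i <= k)%N by rewrite -mik addnS leqnSn.
have h2 : (k <= m + i.+1)%N by rewrite mik leqnn.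
have h3 : (m + i.+1 <= k)%N by rewrite mik leqnn.
have h4 : (k <= m + i.+2)%N by rewrite -mik [X in (_ <= X)%N]addnS leqnSn.
rewrite [leRHS](step_CS mk h2) [leLHS](step_CS mk h4).
apply: ler_wpM2l; first by rewrite invr_ge0.
rewrite [in leRHS](step_entropy mk h1 h2) [in leLHS](step_entropy mk h3 h4).
pose c l : R := (l + i.+1)%:R / k%:R; pose d : R := k%:R^-1.
have d0 : 0 <= d by rewrite invr_ge0 ler0n.
have cd l : (l + i.+2)%:R / k%:R = c l + d.
  by rewrite /c /d addnS -natr1 mulrDl mul1r.
have -> : layer_sum m P (fun l => (l + i.+2)%:R / k%:R) m = layer_sum m P (fun l => c l + d) m.
  by congr (layer_sum m P _ m); apply/funext => l.
have PB_psd' l : (l < m)%N -> psdmx (P l - P l.+1).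
  by move=> lm'; apply: PB_psd; exact: leq_trans mk.
have c0 l : (l < m)%N -> 0 < c l by move=> _; rewrite divr_gt0// ltr0n addnS.
have cS l : (l.+1 < m)%N -> c l <= c l.+1.
  by move=> _; rewrite ler_wpM2r ?invr_ge0 ?ler0n// ler_nat leq_add2r.
(* Here equality holds: after the raise, the last layer before this cut has level 1. *)
have cd1 : c m.-1 + d <= 1.
  rewrite -cd ler_pdivrMr// mul1r ler_nat -mik.
  by rewrite addnS -addSn prednK.
have lo := layer_sum_lower (P_pd mk) PB_psd' c0 cS d0 m0 cd1.
have en : cs_energy h beta q (step_x q k i.+1) - cs_energy h beta q (step_x q k i) <=
    d * mx_inner (cs_drift h beta Q) Q.
  apply: cs_energyB_le => // t tI.
  rewrite /step_x; case: ifP => _; first by rewrite subrr.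
  rewrite -mulrBl ler_piMl// lerBlDr -(natrD _ 1) ler_nat.
  by set u := Num.truncn _; lia.
have P0 : lndet (P 0%N) = lndet Q by rewrite /P /st step_time0// csPhi0 subr0.
rewrite P0 in lo.
(* The energy cost minus the entropy gain is at most [(E + lndet (P m)) / k], whose sign is the
   stopping criterion. *)
have : d * (E + lndet (P m)) <= 0 by apply: mulr_ge0_le0 => //; lra.
rewrite /E cs_exponentE.
have -> : layer_sum m P (fun l => (l + i.+1)%:R / k%:R) m = layer_sum m P c m by [].
move: lo en; set a1 := layer_sum _ _ _ _; set a2 := layer_sum _ _ _ _.
set K := mx_inner _ _; set b1 := cs_energy _ _ _ _; set b2 := cs_energy _ _ _ _.
by rewrite !mulrDr !mulrN => *; lra.
Qed.

(** The determinant of [P m] is at least [e^-E >= 1/L], and the gap at the actual [t_x], not later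
    than the cut, dominates [P m]. *)
Lemma step_gap_bound i m : (m + i.+1)%N = k -> - E <= lndet (P m) ->
  gap_bound L (cs_gap (stp i)).
Proof.
move=> mik Em; have mk : (m <= k)%N by rewrite -mik leq_addr.
apply: (@gap_bound_mono _ _ _ (P m)); last first.
  by apply: step_gap_psdB => //; rewrite -mik ?addnS.
have L1 := cs_L_gt1 h n0 hsum Q1 pQ; have LE := exp_le_cs_L h beta Q n0.
have L0 : 0 < L by rewrite (lt_trans ltr01).
apply: gap_bound_det => //; first exact: P_pd.
  move=> j; rewrite !mxE Q1 gerBl.
  by apply: psdmx_diag_ge0; apply: csPhi_psd; exact: st_range.
have dP := pdmx_det_gt0 (P_pd mk).
rewrite -[X in _ <= X]lnK ?posrE//.
apply: (@le_trans _ _ (expR (- E))); last by rewrite ler_expR.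
by rewrite expRN lef_pV2 ?posrE ?expR_gt0.
Qed.

Lemma step_descend i : (i < k)%N ->
  exists p : cs_pair Q, gap_bound L (cs_gap p) /\ CS p <= CS (stp i).
Proof.
have [d] := ubnP (k - i)%N; elim: d i => // d IH i ki ik.
pose m := (k - i.+1)%N.
have mik : (m + i.+1)%N = k by rewrite subnK.
have [Em|Em] := leP (- E) (lndet (P m)).
  by exists (stp i); split; [exact: step_gap_bound mik Em|exact: lexx].
have m0 : (0 < m)%N.
  rewrite lt0n; apply: contraTneq Em => ->; rewrite -leNgt.
  have -> : P 0%N = Q by rewrite /P /st step_time0// csPhi0 subr0.
  rewrite /E cs_exponentE; have := cs_drift_inner_ge0 h hsum Q1 pQ.
  by have : (0 : R) <= n%:R by [exact: ler0n]; lra.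
have [||p [gp Cp]] := IH i.+1; first by rewrite subnS; move: ki ik; lia.
  by move: m0 mik; clearbody m; lia.
exists p; split; first exact: gp.
apply: le_trans Cp _; apply: (step_CS_le m0 mik); exact: ltW.
Qed.

(** Rounding up raises [x] by at most [1/k], which bounds the energy cost. It enlarges [hatPhi],
    hence lowers the entropy integral, and the cut [t_x] still serves, so the determinant is
    unchanged. *)
Lemma step_start : CS (stp 0) <= CS q + (2 * k%:R)^-1 * mx_inner (cs_drift h beta Q) Q.
Proof.
have h1 : (k + 0 <= k)%N by rewrite addn0.
have h2 : (k <= k + 1)%N by rewrite leq_addr.
have pg := cs_dom_pd n0 dq.
rewrite (step_CS (leqnn k) h2).
have txN := cs_level_leN q n0 (lexx 1); have tx0 := cs_level_ge0 q n0 (lexx 1).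
rewrite (CrisantiSommersE h n0 hsum Q1 (p := q) (w := cs_tx q))//.
have -> : st k = cs_tx q by rewrite /st step_timek.
have yx t : 0 <= t <= N -> csx q t <= step_x q k 0 t <= csx q t + k%:R^-1.
  move=> tI; have /andP[t0 tN] := tI.
  rewrite /step_x; case: ifPn => [tn|].
    have -> : t = 0 by apply/eqP; rewrite eq_le tn t0.
    by rewrite csx0 lexx add0r invr_ge0 ler0n.
  move=> _; have x0 := csx_ge0 q tI; have x1 := csx_le1 q tI.
  have kx0 : 0 <= k%:R * csx q t by rewrite mulr_ge0.
  set m := Num.truncn _.
  have : m%:R <= k%:R * csx q t < m.+1%:R by rewrite -truncn_eq.
  move=> /andP[m1 m2]; apply/andP; split.
    rewrite ler_pdivlMr// mulrC; apply: le_trans (_ : Num.min (m.+1%:R) k%:R <= _).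
      by rewrite le_min (ltW m2) ler_piMr.
    by rewrite addn1 /minn; case: ltnP => _; rewrite ?ge_min ?lexx ?orbT.
  rewrite ler_pdivrMr// mulrDl mulVf ?gt_eqF// mulrC.
  apply: (@le_trans _ _ (m.+1%:R)); first by rewrite ler_nat addn1 geq_minl.
  by rewrite -natr1 lerD2r.
have en : cs_energy h beta q (step_x q k 0) - cs_energy h beta q (csx q) <=
    k%:R^-1 * mx_inner (cs_drift h beta Q) Q.
  apply: cs_energyB_le => //; first exact: csx_bmeas.
  by move=> t /yx /andP[_]; rewrite lerBlDl.
have xb := csx_bmeas q (lexx 0) (lexx N).
have x0 t : 0 <= t <= N -> 0 <= csx q t by exact: csx_ge0.
have x1 t : cs_tx q < t -> t <= N -> csx q t = 1 by exact: csx_after_tx.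
have y1 t : cs_tx q < t -> t <= N -> step_x q k 0 t = 1.
  move=> ut tN; have tI : 0 <= t <= N by rewrite tN (le_trans tx0)// ltW.
  apply/eqP; rewrite eq_le; have /andP[_ ->] := step_x_range q 0 k0 tI.
  by have /andP[+ _] := yx t tI; rewrite x1.
have ent : cs_entropy q (step_x q k 0) (cs_tx q) <= cs_entropy q (csx q) (cs_tx q).
  rewrite /cs_entropy lerD2l; apply: bint_le.
  - apply: bmeas_inner => // i j.
    exact: (@mxint_tail_inv_bmeas _ _ _ q n0 _ (step_bmeas 0) (@step_ge0 0) (cs_tx q)
      i j 0 (cs_tx q) tx0 txN y1 pg (lexx 0) (lexx _)).
  - apply: bmeas_inner => // i j.
    exact: (@mxint_tail_inv_bmeas _ _ _ q n0 _ xb x0 (cs_tx q)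
      i j 0 (cs_tx q) tx0 txN x1 pg (lexx 0) (lexx _)).
  move=> t /andP[t0 tu]; have tN : t <= N by exact: le_trans txN.
  have tI : 0 <= t <= N by rewrite t0.
  apply: mx_inner_le; last exact: density_psd.
  apply: psdmx_invB.
  - by apply: (@mxint_tail_pd _ _ _ q n0 _ xb x0 t (cs_tx q)) => //; rewrite t0.
  - by apply: (@mxint_tail_pd _ _ _ q n0 _ (step_bmeas 0) (@step_ge0 0) t (cs_tx q)) => //; rewrite t0.
  have bs z : bmeas 0 N z -> bmeas t N z by exact: bmeas_sub.
  rewrite mxintB//; [|exact: bs..].
  apply: mxint_psd => //; first by apply: bs; exact: bmeasB.
  move=> s /andP[ts sN]; rewrite subr_ge0.
  by have /andP[] : csx q s <= step_x q k 0 s <= csx q s + k%:R^-1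
    by apply: yx; rewrite sN (le_trans t0).
rewrite lerBlDl addrC in en; rewrite invfM -mulrA -mulrDr.
have i2 : (0 : R) <= 2^-1 by rewrite invr_ge0 ler0n.
apply: (ler_wpM2l i2); apply: le_trans (lerD en ent) _.
by rewrite -addrA [X in _ <= X]addrC lexx.
Qed.

End Reduction.

Section Reduction2.
Context {R : realType} {n : nat}.
Variables (h : 'cV[R]_n) (beta : nat -> 'cV[R]_n) (Q : 'M[R]_n).
Hypothesis n0 : (0 < n)%N.
Hypothesis hsum : forall j : 'I_n,
  (\sum_(2 <= p <oo) (2 ^+ p * beta p j 0 ^+ 2)%:E < +oo)%E.
Hypothesis Q1 : forall j, Q j j = 1.
Hypothesis pQ : pdmx Q.

Lemma cs_reduction (q : cs_pair Q) (e : R) : cs_dom q -> 0 < e ->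
  exists p : cs_pair Q, gap_bound (cs_L h beta Q) (cs_gap p) /\
    CrisantiSommers h beta p <= CrisantiSommers h beta q + e.
Proof.
move=> dq e0; pose K := mx_inner (cs_drift h beta Q) Q.
have K0 : 0 <= K by exact: cs_drift_inner_ge0.
(* [K + 1] avoids a division by zero. *)
have [k kK] := @natSinv_lt R (e / (K + 1)) (divr_gt0 e0 (ltr_wpDl K0 ltr01)).
have k0 : (0 < k.+1)%N by [].
have [p [gp Cp]] := step_descend h n0 hsum Q1 pQ dq k0 k0.
exists p; split => //; apply: le_trans Cp _.
apply: le_trans (step_start h n0 hsum Q1 dq k0) _.
rewrite lerD2l invfM -/K.
have Kp : 0 < K + 1 by lra.
have : k.+1%:R^-1 * (K + 1) <= e by rewrite -ler_pdivlMr// ltW.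
have : 0 <= (k.+1%:R : R)^-1 by rewrite invr_ge0 ler0n.
set r := k.+1%:R^-1 => r0 rK.
have rK0 : 0 <= r * K by exact: mulr_ge0.
by rewrite -mulrA; lra.
Qed.

End Reduction2.

(** * Continuity on csA *)

Section EntryBounds.
Context {R : realType} {n : nat}.
Implicit Types A B G : 'M[R]_n.

Lemma mx_inner_norm A B (a b : R) : (forall i j, `|A i j| <= a) ->
  (forall i j, `|B i j| <= b) -> `|mx_inner A B| <= n%:R * n%:R * (a * b).
Proof.
move=> Aa Bb; rewrite mx_innerE; apply: le_trans (ler_norm_sum _ _ _) _.
apply: (@le_trans _ _ (\sum_(i < n) \sum_(j < n) (a * b))).
  apply: ler_sum => i _; apply: le_trans (ler_norm_sum _ _ _) _.
  by apply: ler_sum => j _; rewrite normrM ler_pM.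
by rewrite !sumr_const !card_ord -mulrA !mulr_natl.
Qed.

Lemma mulmx_norm A B (a b : R) : (forall i j, `|A i j| <= a) ->
  (forall i j, `|B i j| <= b) -> forall i j, `|(A *m B) i j| <= n%:R * (a * b).
Proof.
move=> Aa Bb i j; rewrite mxE; apply: le_trans (ler_norm_sum _ _ _) _.
apply: (@le_trans _ _ (\sum_(k < n) (a * b))).
  by apply: ler_sum => k _; rewrite normrM ler_pM.
by rewrite sumr_const card_ord mulr_natl.
Qed.

Lemma gap_bound_inv_norm L G i j : 0 <= L -> gap_bound L G -> `|invmx G i j| <= L.
Proof.
move=> L0 hG; have psG : psdmx G by case: hG.
have [_ iG] := (gap_bound_norm L0 psG).1 hG.
exact: (mx_norm_leP (invmx G) L0).1 iG i j.
Qed.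

Lemma invmxB_norm L A B (e : R) : 0 <= L -> gap_bound L A -> gap_bound L B ->
  (forall i j, `|(B - A) i j| <= e) ->
  forall i j, `|(invmx A - invmx B) i j| <= n%:R * (n%:R * (L * e) * L).
Proof.
move=> L0 gA gB BA i j.
have pA := gap_bound_pd L0 gA; have pB := gap_bound_pd L0 gB.
have -> : invmx A - invmx B = invmx A *m (B - A) *m invmx B.
  rewrite mulmxBr mulmxBl mulmxK ?pdmx_unit//.
  by rewrite mulVmx ?pdmx_unit// mul1mx.
apply: mulmx_norm => [k l|k l]; last exact: gap_bound_inv_norm.
by apply: mulmx_norm => // ? ?; exact: gap_bound_inv_norm.
Qed.

Lemma lndetB_norm L A B (e : R) : 0 <= L -> gap_bound L A -> gap_bound L B ->
  (forall i j, `|(A - B) i j| <= e) ->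
  `|lndet A - lndet B| <= n%:R * n%:R * (L * e).
Proof.
move=> L0 gA gB AB.
have pA := gap_bound_pd L0 gA; have pB := gap_bound_pd L0 gB.
have BA i j : `|(B - A) i j| <= e by rewrite -opprB mxE normrN.
have h1 := pdmx_lndetB pA pB; have h2 := pdmx_lndetB pB pA.
have k1 := mx_inner_norm (fun i j => gap_bound_inv_norm i j L0 gB) AB.
have k2 := mx_inner_norm (fun i j => gap_bound_inv_norm i j L0 gA) BA.
have := ler_norm (mx_inner (invmx B) (A - B)).
have := ler_norm (mx_inner (invmx A) (B - A)).
by rewrite ler_norml /lndet => *; apply/andP; split; lra.
Qed.

(** Summing [gap_bound_sqr] over the coordinates gives [|w|^2 <= n L qform G w]. The perturbation
    changes the form by at most [n e |w|^2], which is at most half of [qform G w]; hence the factor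
    2. *)
Lemma gap_bound_perturb L G G' (e : R) : (0 < n)%N -> 0 < L -> gap_bound L G -> psdmx G' ->
  (forall i j, `|(G' - G) i j| <= e) -> 2 * (n%:R * n%:R * L) * e <= 1 ->
  gap_bound (2 * (n%:R * L)) G'.
Proof.
move=> n0 L0 gG pG' GG' eL; split => // w j.
have np : (0 : R) < n%:R by rewrite ltr0n.
pose s := \sum_i w i 0 ^+ 2.
have s_ge : w j 0 ^+ 2 <= s by rewrite /s (bigD1 j)//= lerDl sumr_ge0// => i _; exact: sqr_ge0.
have qG : s <= n%:R * L * qform G w.
  have -> : n%:R * L * qform G w = \sum_(i < n) L * qform G w.
    by rewrite sumr_const card_ord -mulrA mulr_natl.
  by apply: ler_sum => i _; apply: gap_bound_sqr gG; exact: ltW.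
have qD : - (e * (n%:R * s)) <= qform (G' - G) w.
  have eE : e * (n%:R * s) =
      \sum_(i < n) \sum_(k < n) e * ((w i 0 ^+ 2 + w k 0 ^+ 2) / 2).
    under eq_bigr => i _ do rewrite -mulr_sumr -mulr_suml big_split/= sumr_const card_ord -/s.
    rewrite -mulr_sumr -mulr_suml big_split/= sumr_const card_ord sumrMnl -/s -[s *+ n]mulr_natl.
    by field.
  rewrite eE qformE -sumrN; apply: ler_sum => i _; rewrite -sumrN; apply: ler_sum => k _.
  have e0 : 0 <= e by apply: le_trans (GG' i k).
  have /ler_normlP[] : `|w i 0 * (G' - G) i k * w k 0| <= e * ((w i 0 ^+ 2 + w k 0 ^+ 2) / 2).
    rewrite mulrAC normrM mulrC ler_pM//.
    rewrite ler_norml; apply/andP; split.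
      by have := sqr_ge0 (w i 0 + w k 0); rewrite sqrrD; lra.
    by have := sqr_ge0 (w i 0 - w k 0); rewrite sqrrB; lra.
  by move=> ? _; lra.
have s0 : 0 <= s by apply: le_trans s_ge; exact: sqr_ge0.
set L' := 2 * (n%:R * L); have L'0 : 0 < L' by rewrite !mulr_gt0.
have q' : w j 0 ^+ 2 <= L' * qform G' w.
  have qB : qform (G' - G) w = qform G' w - qform G w by rewrite qformB.
  have h1 : L' * - (e * (n%:R * s)) <= L' * (qform G' w - qform G w).
    by rewrite ler_wpM2l -?qB// ltW.
  have h2 : 2 * (n%:R * n%:R * L) * e * s <= 1 * s by rewrite ler_wpM2r.
  by move: h1 h2; rewrite /L'; move: qG s_ge; lra.
(* Back from the quadratic to the linear form of the bound, by [0 <= (L' - w_j)^2]. *)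
rewrite -(ler_pM2l L'0); have := sqr_ge0 (L' - w j 0); rewrite sqrrB; lra.
Qed.

End EntryBounds.

Section Continuity.
Context {R : realType} {n : nat} {Q : 'M[R]_n}.
Local Notation mu := (@lebesgue_measure R).
Hypothesis n0 : (0 < n)%N.
Hypothesis Q1 : forall j, Q j j = 1.
Let N : R := n%:R.
Let N0 : 0 < N. Proof. by rewrite ltr0n. Qed.
Implicit Types p q : cs_pair Q.

Lemma cs_dist_ge_x p q :
  \int[mu]_(t in `[0, N]) `|csx p t - csx q t| <= cs_dist p q.
Proof. by rewrite /cs_dist lerDl /csPhi_dist; exact: bigmax_ge_id. Qed.

Lemma cs_dist_ge_Phi p q t i j : 0 <= t <= N ->
  `|csPhi p t i j - csPhi q t i j| <= cs_dist p q.
Proof.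
move=> tN; pose S k l : R :=
  sup [set `|csPhi p u k l - csPhi q u k l| | u in `[0, n%:R]].
apply: (@le_trans _ _ (csPhi_dist p q)); last first.
  by rewrite /cs_dist lerDr; apply: bint_ge0 => u _; exact: normr_ge0.
apply: (@le_trans _ _ (S i j)).
  apply: ub_le_sup; last by exists t => //=; rewrite in_itv.
  exists (1 + 1) => y [u /=]; rewrite in_itv/= => uN <-.
  apply: le_trans (ler_normB _ _) _.
  by rewrite lerD//; exact: (csPhi_entry_le1 Q1).
apply: (@le_trans _ _ (\big[Num.max/0]_(l < n) S i l)).
  exact: (le_bigmax _ (S i)).
exact: (le_bigmax _ (fun k => \big[Num.max/0]_(l < n) S k l)).
Qed.

Section compare.
Variables (p q : cs_pair Q) (d : R).
Hypothesis d0 : 0 <= d.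
Hypothesis dPhi : forall t i j, 0 <= t <= N -> `|csPhi p t i j - csPhi q t i j| <= d.
Hypothesis dx : \int[mu]_(t in `[0, N]) `|csx p t - csx q t| <= d.

Lemma density_norm (r : cs_pair Q) t i j : 0 <= t <= N -> `|cs_density r t i j| <= 1.
Proof. by case: (cs_densityP r n0) => _ _ h _; exact: h. Qed.

Lemma path_diff_bound (u V : R -> R) (M a b : R) i j : 0 <= a -> a <= b -> b <= N ->
  varbound a b u V -> (forall t, a <= t <= b -> `|u t| <= M) ->
  `|\int[mu]_(t in `[a, b]) (u t * (cs_density p t i j - cs_density q t i j))| <=
    d * (V b - V a + 2 * M).
Proof.
move=> a0 ab bN uV uM.
apply: (@bint_by_parts_bound _ a b u V (fun t => csPhi p t i j - csPhi q t i j)) => //.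
- by apply: bmeasB; exact: density_bmeas.
- move=> t /andP[at_ tb]; apply: le_trans (ler_normB _ _) _.
  have tN : 0 <= t <= N by rewrite (le_trans a0 at_) (le_trans tb bN).
  by have := density_norm p i j tN; have := density_norm q i j tN; lra.
- move=> s t as_ st tb; have s0 := le_trans a0 as_; have tN := le_trans tb bN.
  rewrite bintB; [|exact: density_bmeas|exact: density_bmeas].
  by rewrite !density_int//; lra.
by move=> t /andP[at_ tb]; apply: dPhi; rewrite (le_trans a0 at_) (le_trans tb bN).
Qed.

Lemma path_diff_inner_bound (u : R -> 'M[R]_n) (V : R -> R) (M a b : R) :
  0 <= a -> a <= b -> b <= N ->
  (forall i j, varbound a b (fun t => u t i j) V) ->
  (forall t i j, a <= t <= b -> `|u t i j| <= M) ->
  `|\int[mu]_(t in `[a, b]) mx_inner (u t) (cs_density p t) -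
    \int[mu]_(t in `[a, b]) mx_inner (u t) (cs_density q t)| <=
    n%:R * (n%:R * (d * (V b - V a + 2 * M))).
Proof.
move=> a0 ab bN uV uM.
have um i j : bmeas a b (fun t => u t i j) by exact: varbound_bmeas (uV i j).
have fm i j : bmeas a b (fun t => u t i j * (cs_density p t j i - cs_density q t j i)).
  by apply: bmeasM; [exact: um|apply: bmeasB; exact: density_bmeas].
rewrite -bintB; [|exact: bmeas_inner|exact: bmeas_inner].
rewrite (@bint_eq _ _ _ _ (fun t => \sum_i \sum_j
  (u t i j * (cs_density p t j i - cs_density q t j i)))); last first.
  move=> t _; rewrite -mx_innerBr mx_innerE; apply: eq_bigr => i _.
  by apply: eq_bigr => j _; rewrite [(_ - _ : 'M[R]_n) j i]mxE [(- _ : 'M[R]_n) j i]mxE.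
rewrite bint_sum; last by move=> i; apply: bmeas_sum => j; exact: fm.
apply: le_trans (ler_norm_sum _ _ _) _.
apply: (@le_trans _ _ (\sum_(i < n) (n%:R * (d * (V b - V a + 2 * M))))); last first.
  by rewrite sumr_const card_ord [leRHS]mulr_natl.
apply: ler_sum => i _; rewrite bint_sum; last by move=> j; exact: fm.
apply: le_trans (ler_norm_sum _ _ _) _.
apply: (@le_trans _ _ (\sum_(j < n) (d * (V b - V a + 2 * M)))); last first.
  by rewrite sumr_const card_ord [leRHS]mulr_natl.
apply: ler_sum => j _.
apply: (@path_diff_bound (fun t => u t i j) V M a b j i) => //.
by move=> t; exact: uM.
Qed.

Lemma csx_diff_int_le a b : 0 <= a -> a <= b -> b <= N ->
  \int[mu]_(t in `[a, b]) `|csx p t - csx q t| <= d.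
Proof.
move=> a0 ab bN; apply: le_trans dx.
have bm s t : 0 <= s -> t <= N -> bmeas s t (fun x => `|csx p x - csx q x|).
  by move=> s0 tN; apply: bmeas_norm; apply: bmeasB; exact: csx_bmeas.
have ge s t : 0 <= \int[mu]_(x in `[s, t]) `|csx p x - csx q x|.
  by apply: bint_ge0 => x _; exact: normr_ge0.
rewrite (@bint_split _ 0 a N)//; [|exact: le_trans bN|exact: bm].
rewrite (@bint_split _ a b N)//; last exact: bm.
by have := ge 0 a; have := ge b N; lra.
Qed.

(** The term [(x_p - x_q) phi_p] costs the L1 distance; the term [x_q (phi_p - phi_q)] is integrated
    by parts and costs at most [3 d], for the variation of [x_q] and twice its bound. *)
Lemma mxint_tail_diff t i j : 0 <= t <= N ->
  `|(mxint p (csx p) t N - mxint q (csx q) t N) i j| <= 4 * d.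
Proof.
move=> /andP[t0 tN].
have b1 : bmeas t N (fun x => (csx p x - csx q x) * cs_density p x i j).
  by apply: bmeasM; [apply: bmeasB; exact: csx_bmeas|exact: density_bmeas].
have b2 : bmeas t N (fun x => csx q x * (cs_density p x i j - cs_density q x i j)).
  by apply: bmeasM; [exact: csx_bmeas|apply: bmeasB; exact: density_bmeas].
have b3 (r : cs_pair Q) : bmeas t N (fun x => csx r x * cs_density r x i j).
  by apply: bmeasM; [exact: csx_bmeas|exact: density_bmeas].
rewrite !mxE -bintB//.
rewrite (@bint_eq _ _ _ _ (fun x => (csx p x - csx q x) * cs_density p x i j +
  csx q x * (cs_density p x i j - cs_density q x i j))); last by move=> x _; ring.
rewrite bintD//.
have xI x : t <= x <= N -> 0 <= x <= N by move=> /andP[tx ->]; rewrite (le_trans t0 tx).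
have h1 : `|\int[mu]_(x in `[t, N]) ((csx p x - csx q x) * cs_density p x i j)| <= d.
  apply: le_trans (csx_diff_int_le t0 tN (lexx N)).
  apply: le_trans (le_normr_Rintegral _ (bmeas_integrable b1)) _.
    exact: measurable_itv.
  apply: bint_le; [exact: bmeas_norm|apply: bmeas_norm; apply: bmeasB; exact: csx_bmeas|].
  by move=> x /xI xN; rewrite normrM ler_piMr//; exact: density_norm.
have h2 : `|\int[mu]_(x in `[t, N]) (csx q x * (cs_density p x i j - cs_density q x i j))| <=
    d * (csx q N - csx q t + 2 * 1).
  apply: (@path_diff_bound (csx q) (csx q)) => //.
    move=> s s' ts ss' s'N; rewrite ger0_norm// subr_ge0.
    by apply: csx_nondecreasing => //; exact: le_trans ts.
  by move=> x /xI xN; rewrite ger0_norm ?(csx_ge0 q xN)// (csx_le1 q xN).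
have h3 : d * (csx q N - csx q t + 2 * 1) <= d * 3.
  have tI : 0 <= t <= N by rewrite t0 tN.
  apply: ler_wpM2l => //; have := csx_ge0 q tI; have : csx q N = 1 by exact: csxn.
  by move=> ->; lra.
apply: le_trans (ler_normD _ _) _; apply: le_trans (lerD h1 (le_trans h2 h3)) _.
by rewrite {h1 h2 h3 b1 b2 b3}; lra.
Qed.

End compare.

End Continuity.

Section ContinuityFunctional.
Context {R : realType} {n : nat} {Q : 'M[R]_n}.
Local Notation mu := (@lebesgue_measure R).
Variables (h : 'cV[R]_n) (beta : nat -> 'cV[R]_n).
Hypothesis n0 : (0 < n)%N.
Hypothesis hsum : forall j : 'I_n,
  (\sum_(2 <= p <oo) (2 ^+ p * beta p j 0 ^+ 2)%:E < +oo)%E.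
Hypothesis Q1 : forall j, Q j j = 1.
Let N : R := n%:R.
Let N0 : 0 < N. Proof. by rewrite ltr0n. Qed.
Let N00 : 0 <= N. Proof. exact: ltW N0. Qed.
Implicit Types p q : cs_pair Q.

(** Log-determinant, density and inverse are changed one at a time; for the density, the trace of
    the inverse bounds the variation. The three terms of the constant belong to the determinant, the
    inverse and the density, in this order. *)
Lemma cs_entropy_diff p q (d K w : R) : 0 <= d -> 0 < K ->
  (forall t i j, 0 <= t <= N -> `|csPhi p t i j - csPhi q t i j| <= d) ->
  \int[mu]_(t in `[0, N]) `|csx p t - csx q t| <= d ->
  cs_tx p <= w -> cs_tx q <= w -> 0 <= w <= N ->
  gap_bound K (Q - csPhi p w) -> gap_bound K (Q - csPhi q w) ->
  `|cs_entropy p (csx p) w - cs_entropy q (csx q) w| <=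
    (N * N * K + N * N * (N * (N * (K * 4) * K)) * N + N * (N * (N * K + 2 * K))) * d.
Proof.
move=> d0 K0 dPhi dx tpw tqw /andP[w0 wN] gp gq; have K00 := ltW K0.
have after (r : cs_pair Q) : cs_tx r <= w -> forall s, w < s -> s <= N -> csx r s = 1.
  by move=> tr s ws sN; apply: (csx_after_tx n0) => //; exact: le_lt_trans ws.
have xb (r : cs_pair Q) : bmeas 0 N (csx r) by exact: csx_bmeas.
have x0 (r : cs_pair Q) t : 0 <= t <= N -> 0 <= csx r t by exact: csx_ge0.
pose H (r : cs_pair Q) t := mxint r (csx r) t N.
have Hgap (r : cs_pair Q) : cs_tx r <= w -> gap_bound K (Q - csPhi r w) ->
    forall t, 0 <= t <= w -> gap_bound K (H r t).
  move=> tr gr t /andP[t0 tw]; apply: gap_bound_mono gr _.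
  rewrite /H -(mxint_tail1 r n0 (xb r) w0 (after r tr) (lexx w) wN).
  exact: (mxint_tail_psdB r n0 (xb r) (x0 r) t0 tw wN).
have Hbm (r : cs_pair Q) i j : cs_tx r <= w -> gap_bound K (Q - csPhi r w) ->
    bmeas 0 w (fun t => invmx (H r t) i j).
  move=> tr gr; apply: (mxint_tail_inv_bmeas n0 (xb r) (x0 r) i j w0 wN (after r tr)) => //.
  exact: (gap_bound_pd K00 gr).
have part1 : `|lndet (Q - csPhi p w) - lndet (Q - csPhi q w)| <= N * N * (K * d).
  apply: lndetB_norm K00 gp gq _ => i j.
  have -> : ((Q - csPhi p w) - (Q - csPhi q w)) i j = csPhi q w i j - csPhi p w i j.
    by rewrite !mxE; ring.
  by rewrite distrC; apply: dPhi; rewrite w0 wN.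
have bI (r s : cs_pair Q) : cs_tx r <= w -> gap_bound K (Q - csPhi r w) ->
    bmeas 0 w (fun t => mx_inner (invmx (H r t)) (cs_density s t)).
  by move=> tr gr; apply: bmeas_inner => // i j; exact: Hbm.
have part2 : `|\int[mu]_(t in `[0, w]) mx_inner (invmx (H p t)) (cs_density q t) -
    \int[mu]_(t in `[0, w]) mx_inner (invmx (H q t)) (cs_density q t)| <=
    N * N * (N * (N * (K * (4 * d)) * K) * 1) * w.
  rewrite -bintB; [|exact: bI|exact: bI].
  rewrite -[X in _ * X]subr0.
  apply: bint_norm => //; first by apply: bmeasB; exact: bI.
  move=> t tw; have tN : 0 <= t <= N by case/andP: tw => -> /le_trans->.
  rewrite -mx_innerBl; apply: mx_inner_norm => i j; last exact: density_norm.
  apply: (invmxB_norm K00); [exact: Hgap|exact: Hgap|].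
  move=> k l; rewrite -opprB [(- _ : 'M[R]_n) k l]mxE normrN.
  exact: mxint_tail_diff.
have part3 : `|\int[mu]_(t in `[0, w]) mx_inner (invmx (H p t)) (cs_density p t) -
    \int[mu]_(t in `[0, w]) mx_inner (invmx (H p t)) (cs_density q t)| <=
    N * (N * (d * (\tr (invmx (H p w)) - \tr (invmx (H p 0)) + 2 * K))).
  apply: (path_diff_inner_bound n0 dPhi (u := fun t => invmx (H p t))
    (V := fun t => \tr (invmx (H p t)))) => //.
    move=> i j; apply: invmx_antitone_varbound.
      by move=> t tw; apply: gap_bound_pd K00 _; exact: Hgap.
    move=> s t s0 st tw.
    exact: (mxint_tail_psdB p n0 (xb p) (x0 p) s0 st (le_trans tw wN)).
  by move=> t i j tw; apply: gap_bound_inv_norm K00 _; exact: Hgap.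
have trw : \tr (invmx (H p w)) <= N * K.
  rewrite /mxtrace; apply: (@le_trans _ _ (\sum_(i < n) K)); last first.
    by rewrite sumr_const card_ord [leRHS]mulr_natl.
  apply: ler_sum => i _; apply: le_trans (ler_norm _) _.
  apply: gap_bound_inv_norm K00 _; apply: Hgap => //; by rewrite w0 lexx.
have tr0 : 0 <= \tr (invmx (H p 0)).
  rewrite /mxtrace; apply: sumr_ge0 => i _; apply: psdmx_diag_ge0.
  apply/pdmx_psd/pdmx_inv/(gap_bound_pd K00); apply: Hgap => //; by rewrite w0 lexx.
have part3' : N * (N * (d * (\tr (invmx (H p w)) - \tr (invmx (H p 0)) + 2 * K))) <=
    N * (N * (d * (N * K + 2 * K))).
  apply: (ler_wpM2l N00); apply: (ler_wpM2l N00); apply: (ler_wpM2l d0).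
  apply: (lerD _ (lexx (2 * K))); rewrite lerBlDr; apply: (le_trans trw).
  by rewrite -[X in X <= _]addr0; apply: (lerD (lexx (N * K)) tr0).
have part2' : N * N * (N * (N * (K * (4 * d)) * K) * 1) * w <=
    N * N * (N * (N * (K * (4 * d)) * K) * 1) * N.
  by apply: ler_wpM2l; rewrite // !mulr_ge0.
have tri (a b c a' b' e1 e2 e3 : R) : `|a - a'| <= e1 -> `|b - c| <= e2 -> `|c - b'| <= e3 ->
    `|(a + b) - (a' + b')| <= e1 + e2 + e3.
  move=> h1 h2 h3; have -> : a + b - (a' + b') = (a - a') + (b - c) + (c - b') by ring.
  apply: le_trans (ler_normD _ _) _; rewrite lerD//.
  by apply: le_trans (ler_normD _ _) _; rewrite lerD.
rewrite /cs_entropy; apply: le_trans (tri _ _ _ _ _ _ _ _ part1 part3 part2) _.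
apply: le_trans (lerD (lerD (lexx _) part3') part2') _.
by rewrite le_eqVlt; apply/orP; left; apply/eqP; ring.
Qed.

Local Notation drift := (cs_drift h beta).

Lemma cs_drift_path_norm p t i j : 0 <= t <= N -> `|drift (csPhi p t) i j| <= \tr (drift Q).
Proof.
move=> tN; have [pd pdB] := cs_drift_path_psd h n0 hsum Q1 p tN.
apply: le_trans (psdmx_entry_le_tr i j pd) _.
rewrite -subr_ge0 -raddfB /mxtrace; apply: sumr_ge0 => k _; exact: psdmx_diag_ge0.
Qed.

(** [x], drift and density are changed one at a time: by the L1 distance, by the Lipschitz bound on
    the drift, and by parts against [x] times the drift, whose variation is bounded by that of
    [B * csx q t + S * t]. *)
Lemma cs_energy_diff : exists M : R, forall p q (d : R), 0 <= d ->
  (forall t i j, 0 <= t <= N -> `|csPhi p t i j - csPhi q t i j| <= d) ->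
  \int[mu]_(t in `[0, N]) `|csx p t - csx q t| <= d ->
  `|cs_energy h beta p (csx p) - cs_energy h beta q (csx q)| <= M * d.
Proof.
have [S [S0 hS]] := cs_drift_lipschitz h hsum.
set B := \tr (drift Q).
exists (N * N * B + N * N * S * N + N * (N * (B + S * N + 2 * B))) => p q d d0 dPhi dx.
have N0N : 0 <= N <= N by rewrite N00 lexx.
have B0 : 0 <= B.
  exact: le_trans (normr_ge0 _) (cs_drift_path_norm p (Ordinal n0) (Ordinal n0) N0N).
have Kb (r : cs_pair Q) i j : bmeas 0 N (fun t => drift (csPhi r t) i j).
  exact: (cs_drift_bmeas h hsum Q1).
have xb (r : cs_pair Q) : bmeas 0 N (csx r) by exact: csx_bmeas.
have I (r s : cs_pair Q) : bmeas 0 N (fun t => mx_inner (drift (csPhi r t)) (cs_density s t)).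
  by apply: bmeas_inner => // i j; exact: Kb.
have part1 : `|\int[mu]_(t in `[0, N])
    ((csx p t - csx q t) * mx_inner (drift (csPhi p t)) (cs_density p t))| <= N * N * B * d.
  have b1 : bmeas 0 N (fun t => (csx p t - csx q t) *
      mx_inner (drift (csPhi p t)) (cs_density p t)).
    by apply: bmeasM; [apply: bmeasB; exact: xb|exact: I].
  have b2 : bmeas 0 N (fun t => `|csx p t - csx q t|).
    by apply: bmeas_norm; apply: bmeasB; exact: xb.
  apply: le_trans (le_normr_Rintegral _ (bmeas_integrable b1)) _.
    exact: measurable_itv.
  apply: (@le_trans _ _ (\int[mu]_(t in `[0, N]) (N * N * B * `|csx p t - csx q t|))).
    apply: bint_le; [exact: bmeas_norm|by apply: bmeasM; [exact: bmeas_cst|]|].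
    move=> t tN; rewrite normrM mulrC ler_wpM2r//.
    apply: le_trans (mx_inner_norm (a := B) (b := 1) _ _) _; last by rewrite mulr1.
      by move=> i j; exact: cs_drift_path_norm.
    by move=> i j; exact: density_norm.
  rewrite bintZ//; apply: ler_wpM2l dx; by rewrite !mulr_ge0.
have part2 : `|\int[mu]_(t in `[0, N])
    (csx q t * mx_inner (drift (csPhi p t) - drift (csPhi q t)) (cs_density p t))| <=
    N * N * (S * d * 1) * (N - 0).
  apply: bint_norm => //.
    apply: bmeasM; first exact: xb.
    apply: bmeas_inner => // i j.
    apply: (@bmeas_eq _ _ _ (fun t => drift (csPhi p t) i j - drift (csPhi q t) i j)).
      by move=> t _; rewrite [RHS]mxE [(- _ : 'M[R]_n) i j]mxE.
    by apply: bmeasB; exact: Kb.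
  move=> t tN; rewrite normrM ger0_norm ?(csx_ge0 q tN)//.
  apply: le_trans (ler_piMl (normr_ge0 _) (csx_le1 q tN)) _.
  apply: mx_inner_norm => i j; last exact: density_norm.
  rewrite [(_ - _ : 'M[R]_n) i j]mxE [(- _ : 'M[R]_n) i j]mxE.
  apply: le_trans (hS _ _ i j (csPhi_entry_le1 Q1 p i j tN) (csPhi_entry_le1 Q1 q i j tN)) _.
  by apply: ler_wpM2l => //; exact: dPhi.
pose u t : 'M[R]_n := csx q t *: drift (csPhi q t).
have uE t i j : u t i j = csx q t * drift (csPhi q t) i j by rewrite mxE.
have part3 : `|\int[mu]_(t in `[0, N]) mx_inner (u t) (cs_density p t) -
    \int[mu]_(t in `[0, N]) mx_inner (u t) (cs_density q t)| <=
    N * (N * (d * ((B * csx q N + S * N) - (B * csx q 0 + S * 0) + 2 * B))).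
  apply: (path_diff_inner_bound n0 dPhi (u := u) (V := fun t => B * csx q t + S * t)) => //.
    move=> i j s t s0 st tN; rewrite !uE.
    have sI : 0 <= s <= N by rewrite s0 (le_trans st).
    have tI : 0 <= t <= N by rewrite (le_trans s0 st) tN.
    set Ks := drift (csPhi q s) i j; set Kt := drift (csPhi q t) i j.
    have -> : csx q t * Kt - csx q s * Ks = (csx q t - csx q s) * Kt + csx q s * (Kt - Ks) by ring.
    apply: le_trans (ler_normD _ _) _; rewrite !normrM.
    have xst : csx q s <= csx q t by exact: csx_nondecreasing.
    rewrite [`|csx q t - csx q s|]ger0_norm ?subr_ge0// [`|csx q s|]ger0_norm ?(csx_ge0 q sI)//.
    have -> : B * csx q t + S * t - (B * csx q s + S * s) =
      (csx q t - csx q s) * B + 1 * (S * (t - s)) by ring.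
    apply: lerD; first by rewrite ler_wpM2l ?subr_ge0//; exact: cs_drift_path_norm.
    apply: ler_pM; rewrite ?(csx_ge0 q sI) ?(csx_le1 q sI)//.
    apply: le_trans (hS _ _ i j (csPhi_entry_le1 Q1 q i j tI) (csPhi_entry_le1 Q1 q i j sI)) _.
    rewrite ler_wpM2l//.
    by apply: le_trans (csPhi_lipschitz q i j sI tI) _; rewrite ger0_norm ?subr_ge0.
  move=> t i j tN; rewrite uE normrM ger0_norm ?(csx_ge0 q tN)//.
  apply: le_trans (ler_piMl (normr_ge0 _) (csx_le1 q tN)) _.
  exact: cs_drift_path_norm.
have c1 : bmeas 0 N (fun t => (csx p t - csx q t) * mx_inner (drift (csPhi p t)) (cs_density p t)).
  by apply: bmeasM; [apply: bmeasB; exact: xb|exact: I].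
have c2 : bmeas 0 N (fun t => csx q t * mx_inner (drift (csPhi p t) - drift (csPhi q t)) (cs_density p t)).
  apply: (@bmeas_eq _ _ _ (fun t => csx q t * (mx_inner (drift (csPhi p t)) (cs_density p t) -
    mx_inner (drift (csPhi q t)) (cs_density p t)))).
    by move=> t _; rewrite mx_innerBl.
  by apply: bmeasM; [exact: xb|apply: bmeasB; exact: I].
have c3 (r : cs_pair Q) : bmeas 0 N (fun t => mx_inner (u t) (cs_density r t)).
  apply: (@bmeas_eq _ _ _ (fun t => csx q t * mx_inner (drift (csPhi q t)) (cs_density r t))).
    by move=> t _; rewrite mx_innerZl.
  by apply: bmeasM; [exact: xb|exact: I].
have -> : cs_energy h beta p (csx p) = \int[mu]_(t in `[0, N])
     ((csx p t - csx q t) * mx_inner (drift (csPhi p t)) (cs_density p t)) +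
   \int[mu]_(t in `[0, N])
     (csx q t * mx_inner (drift (csPhi p t) - drift (csPhi q t)) (cs_density p t)) +
   \int[mu]_(t in `[0, N]) mx_inner (u t) (cs_density p t).
  rewrite -bintD// -bintD//; last exact: bmeasD.
  by apply: bint_eq => t _; rewrite mx_innerBl mx_innerZl; ring.
have -> : cs_energy h beta q (csx q) = \int[mu]_(t in `[0, N]) mx_inner (u t) (cs_density q t).
  by apply: bint_eq => t _; rewrite mx_innerZl.
have part3' : N * (N * (d * ((B * csx q N + S * N) - (B * csx q 0 + S * 0) + 2 * B))) =
   N * (N * (d * (B + S * N + 2 * B))).
  by rewrite csx0 csxn; ring.
rewrite part3' in part3.
rewrite -addrA; apply: le_trans (ler_normD _ _) _; apply: le_trans (lerD (ler_normD _ _) part3) _.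
apply: le_trans (lerD (lerD part1 part2) (lexx _)) _.
by rewrite le_eqVlt; apply/orP; left; apply/eqP; ring.
Qed.

Lemma gap_bound_weaken (L L' : R) (G : 'M[R]_n) : L <= L' -> gap_bound L G -> gap_bound L' G.
Proof. by move=> LL [pG hG]; split=> // w j; exact: le_trans (hG w j) LL. Qed.

(** The cut [w] is [t_x] for one of the pairs. For the other one, the gap at [w] differs from that
    matrix by at most the distance in each entry, so [gap_bound_perturb] applies. *)
Lemma gap_bound_later L p q (w : R) : 0 < L -> cs_tx p <= w -> cs_tx q <= w -> w <= N ->
  cs_tx p = w \/ cs_tx q = w ->
  gap_bound L (cs_gap p) -> gap_bound L (cs_gap q) ->
  2 * (N * N * L) * cs_dist p q <= 1 -> gap_bound (2 * (N * L)) (Q - csPhi p w).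
Proof.
move=> L0 tp tq wN pqw gp gq dL.
have tx0 (r : cs_pair Q) : 0 <= cs_tx r by rewrite cs_txE; exact: (cs_level_ge0 r n0 (lexx 1)).
have wI : 0 <= w <= N by rewrite (le_trans (tx0 p) tp) wN.
have LL : L <= 2 * (N * L).
  have N1 : 1 <= N by rewrite /N ler1n.
  by rewrite mulrA ler_peMl ?(ltW L0)//; lra.
case: pqw => [tpw|tqw].
  by apply: gap_bound_weaken LL _; rewrite -tpw.
apply: (@gap_bound_perturb _ _ L (Q - csPhi q w) _ (cs_dist p q)) => //.
- by rewrite -tqw.
- exact: csPhi_gap_psd.
move=> i j.
have -> : ((Q - csPhi p w) - (Q - csPhi q w)) i j = csPhi q w i j - csPhi p w i j.
  by rewrite !mxE; ring.
by rewrite distrC; exact: (cs_dist_ge_Phi Q1).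
Qed.

(* Both entropies are computed from the common cut point [max (cs_tx p) (cs_tx q)];
   the terms with [cs_density p - cs_density q] are integrated by parts. *)
Lemma CrisantiSommers_lipschitz L : 0 < L -> exists2 M : R, 0 < M & forall p q,
  gap_bound L (cs_gap p) -> gap_bound L (cs_gap q) -> M * cs_dist p q <= 1 ->
  `|CrisantiSommers h beta p - CrisantiSommers h beta q| <= M * cs_dist p q.
Proof.
move=> L0; have [ME hE] := cs_energy_diff.
set K := 2 * (N * L); have K0 : 0 < K by rewrite !mulr_gt0.
set MS := N * N * K + N * N * (N * (N * (K * 4) * K)) * N + N * (N * (N * K + 2 * K)).
have MS0 : 0 <= MS.
  have K00 := ltW K0.
  by rewrite /MS; repeat first [exact: N00 | exact: K00 | exact: ler0n | apply: addr_ge0 | apply: mulr_ge0].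
set M1 := 2 * (N * N * L); have M10 : 0 < M1 by rewrite !mulr_gt0.
(* The summand [M1] makes [M * cs_dist p q <= 1] imply the smallness that [gap_bound_later] asks
   for; the others are for energy and entropy. *)
exists (M1 + (`|ME| + MS)); first by rewrite ltr_wpDr// addr_ge0.
move=> p q gp gq; set d := cs_dist p q => dM.
have d0 : 0 <= d by rewrite addr_ge0//; [apply: bint_ge0 => u _|exact: bigmax_ge_id].
have d1 : M1 * d <= 1.
  by apply: le_trans dM; rewrite ler_wpM2r// lerDl addr_ge0.
have tx (r : cs_pair Q) : 0 <= cs_tx r <= N.
  by rewrite cs_txE (cs_level_ge0 r n0 (lexx 1)) (cs_level_leN r n0 (lexx 1)).
set w := Num.max (cs_tx p) (cs_tx q).
have tp : cs_tx p <= w by rewrite le_max lexx.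
have tq : cs_tx q <= w by rewrite le_max lexx orbT.
have wN : w <= N by rewrite ge_max; case/andP: (tx p) => _ ->; case/andP: (tx q) => _ ->.
have w0 : 0 <= w by case/andP: (tx p) => t0 _; exact: le_trans t0 tp.
have pqw : cs_tx p = w \/ cs_tx q = w.
  by rewrite /w; case: leP => _; [right|left].
have gpw : gap_bound K (Q - csPhi p w) by exact: (@gap_bound_later L p q w).
have gqw : gap_bound K (Q - csPhi q w).
  apply: (@gap_bound_later L q p w) => //; first by case: pqw; [right|left].
  by rewrite cs_dist_sym.
have dom (r : cs_pair Q) : gap_bound L (cs_gap r) -> cs_dom r.
  by move=> gr; apply: pdmx_det_gt0; exact: gap_bound_pd (ltW L0) gr.
rewrite (CrisantiSommersE h n0 hsum Q1 (dom p gp) tp wN (gap_bound_pd (ltW K0) gpw)).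
rewrite (CrisantiSommersE h n0 hsum Q1 (dom q gq) tq wN (gap_bound_pd (ltW K0) gqw)).
have dPhi t i j : 0 <= t <= N -> `|csPhi p t i j - csPhi q t i j| <= d.
  exact: (cs_dist_ge_Phi Q1).
have dx := cs_dist_ge_x p q.
have wI : 0 <= w <= N by rewrite w0 wN.
have h1 := hE p q d d0 dPhi dx.
have h2 := cs_entropy_diff d0 K0 dPhi dx tp tq wI gpw gqw.
rewrite -/MS in h2.
have h3 : ME * d <= `|ME| * d by rewrite ler_wpM2r// ler_norm.
rewrite -mulrBr normrM ger0_norm ?invr_ge0//.
rewrite opprD addrACA.
have h4 := le_trans (ler_normD _ _) (lerD (le_trans h1 h3) h2).
have h5 : 2^-1 * `|cs_energy h beta p (csx p) - cs_energy h beta q (csx q) +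
    (cs_entropy p (csx p) w - cs_entropy q (csx q) w)| <= 2^-1 * (`|ME| * d + MS * d).
  by apply: ler_wpM2l h4; rewrite invr_ge0.
apply: le_trans h5 _.
have e1 : 0 <= `|ME| * d by rewrite mulr_ge0.
have e2 : 0 <= MS * d by rewrite mulr_ge0.
have e3 : 0 <= M1 * d by rewrite mulr_ge0 ?(ltW M10).
rewrite (mulrDl M1) (mulrDl `|ME|); move: e1 e2 e3.
move: (`|ME| * d) (MS * d) (M1 * d) => a b c e1 e2 e3.
lra.
Qed.

End ContinuityFunctional.

(** * Compactness of csA *)

(** The image of the ultrafilter clusters in a segment, and for an ultrafilter a cluster point is a
    limit. Used at every time separately, this replaces the diagonal extraction of Helly's
    theorem. *)
Lemma ultra_bounded_cvg (R : realType) (T : Type) (F : set_system T) (FU : UltraFilter F)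
    (f : T -> R) (B : R) :
  (forall p, `|f p| <= B) -> exists l : R, f p @[p --> F] --> l.
Proof.
move=> fB.
have FB : (fmap f F) `[- B, B]%classic.
  by apply: nearW => p /=; rewrite in_itv/= -ler_norml.
have [l [_ lc]] : (`[- B, B]%classic `&` cluster (fmap f F)) !=set0.
  exact: (@segment_compact R (- B) B (fmap f F)).
exists l; apply/cvgrPdist_le => e e0.
have [//|Fn] := in_ultra_setVsetC [set p | `|l - f p| <= e] FU.
have fFn : (fmap f F) [set y | ~ (`|l - y| <= e)] by exact: Fn.
have [y [/= nle lt]] := lc _ _ fFn (nbhs_ball_norm l (PosNum e0)).
by case: nle; exact: ltW.
Qed.

Lemma cvg_eq_cst (R : realType) (T : Type) (F : set_system T) (FP : ProperFilter F)
    (f : T -> R) (l c : R) :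
  f p @[p --> F] --> l -> (forall p, f p = c) -> l = c.
Proof.
move=> fl fc; apply/eqP; rewrite eq_le; apply/andP; split.
  by apply: (cvgr_to_le fl); apply: nearW => p; rewrite fc.
by apply: (cvgr_to_ge fl); apply: nearW => p; rewrite fc.
Qed.

Section LimitPair.
Context {R : realType} {n : nat} {Q : 'M[R]_n}.
Local Notation mu := (@lebesgue_measure R).
Hypothesis n0 : (0 < n)%N.
Let N : R := n%:R.
Let N0 : 0 < N. Proof. by rewrite ltr0n. Qed.
Let N00 : 0 <= N. Proof. exact: ltW N0. Qed.
Let I0N : 0 <= (0 : R) <= N. Proof. by rewrite lexx N00. Qed.
Let INN : 0 <= N <= N. Proof. by rewrite lexx N00. Qed.
Implicit Types p q : cs_pair Q.
Variable F : set_system (cs_pair Q).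
Hypothesis FP : ProperFilter F.
Variables (y : R -> R) (Psi : R -> 'M[R]_n).
Hypothesis hy : forall t, 0 <= t <= N -> csx p t @[p --> F] --> y t.
Hypothesis hPsi : forall t i j, 0 <= t <= N -> csPhi p t i j @[p --> F] --> Psi t i j.

Lemma limx_range t : 0 <= t <= N -> 0 <= y t <= 1.
Proof.
move=> tN; apply/andP; split.
  by apply: (cvgr_to_ge (hy tN)); apply: nearW => p; exact: csx_ge0.
by apply: (cvgr_to_le (hy tN)); apply: nearW => p; exact: csx_le1.
Qed.

Lemma limx_nondecreasing s t : 0 <= s -> s <= t -> t <= N -> y s <= y t.
Proof.
move=> s0 st tN; have sI : 0 <= s <= N by rewrite s0 (le_trans st).
have tI : 0 <= t <= N by rewrite (le_trans s0 st).
rewrite -subr_ge0; apply: (cvgr_to_ge (cvgB (hy tI) (hy sI))).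
by apply: nearW => p; rewrite /= subr_ge0; exact: csx_nondecreasing.
Qed.

Lemma limx0 : y 0 = 0.
Proof.
by apply: (cvg_eq_cst FP (hy I0N)) => p; exact: csx0.
Qed.

Lemma limxn : y N = 1.
Proof.
by apply: (cvg_eq_cst FP (hy INN)) => p; exact: csxn.
Qed.

Lemma limPhi_psd t : 0 <= t <= N -> psdmx (Psi t).
Proof.
move=> tN; apply: (@psdmx_limit _ _ _ F _ (fun p => csPhi p t)).
  by move=> i j; exact: hPsi.
by apply: nearW => p; exact: csPhi_psd.
Qed.

Lemma limPhi_monotone s t : 0 <= s -> s <= t -> t <= N -> psdmx (Psi t - Psi s).
Proof.
move=> s0 st tN; have sI : 0 <= s <= N by rewrite s0 (le_trans st).
have tI : 0 <= t <= N by rewrite (le_trans s0 st).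
apply: (@psdmx_limit _ _ _ F _ (fun p => csPhi p t - csPhi p s)).
  have mxBE (A B : 'M[R]_n) i j : (A - B) i j = A i j - B i j by rewrite !mxE.
  move=> i j; rewrite mxBE.
  apply: cvg_trans (cvgB (@hPsi _ i j tI) (@hPsi _ i j sI)).
  by apply: near_eq_cvg; apply: nearW => p; rewrite mxBE.
by apply: nearW => p; exact: csPhi_monotone.
Qed.

Lemma limPhi_lipschitz s t i j : 0 <= s <= N -> 0 <= t <= N ->
  `|Psi t i j - Psi s i j| <= `|t - s|.
Proof.
move=> sI tI.
apply: (cvgr_to_le (cvg_norm (cvgB (@hPsi _ i j tI) (@hPsi _ i j sI)))).
by apply: nearW => p; exact: csPhi_lipschitz.
Qed.

Lemma limPhi_trace t : 0 <= t <= N -> \tr (Psi t) = t.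
Proof.
move=> tN; have tc : (\sum_i csPhi p t i i) @[p --> F] --> \sum_i Psi t i i.
  by apply: cvg_bigsum => i; exact: hPsi.
by apply: (cvg_eq_cst FP tc) => p; exact: (csPhi_trace p tN).
Qed.

Lemma limPhi0 : Psi 0 = 0.
Proof.
by apply/matrixP => i j; apply: (cvg_eq_cst FP (@hPsi _ i j I0N)) => p; rewrite csPhi0.
Qed.

Lemma limPhin : Psi N = Q.
Proof.
by apply/matrixP => i j; apply: (cvg_eq_cst FP (@hPsi _ i j INN)) => p; rewrite csPhin.
Qed.

(* The right limit of [y], which need not be right-continuous itself; it
   satisfies [y s <= limx s <= y t] for [s < t]. *)
Definition limx (t : R) : R :=
  if t <= 0 then 0 else if N <= t then 1 else inf [set y s | s in [set s | t < s <= N]].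

Let has_inf_limx t : 0 <= t < N -> has_inf [set y s | s in [set s | t < s <= N]].
Proof.
move=> /andP[t0 tN]; split; first by exists (y N), N => //=; rewrite tN lexx.
exists 0 => z [s /= /andP[ts sN] <-].
have sI : 0 <= s <= N by rewrite sN (le_trans t0 (ltW ts)).
by case/andP: (limx_range sI).
Qed.

Lemma limx_le s t : 0 <= s -> s < t -> t <= N -> limx s <= y t.
Proof.
move=> s0 st tN; rewrite /limx; case: ifPn => _.
  have tI : 0 <= t <= N by rewrite tN (le_trans s0 (ltW st)).
  by case/andP: (limx_range tI).
rewrite [N <= s]leNgt (lt_le_trans st tN)/=; apply: ge_inf; last by exists t => //=; rewrite st.
by case: (@has_inf_limx s); rewrite ?s0 ?(lt_le_trans st tN).
Qed.

Lemma le_limx s t : 0 <= s -> s <= t -> t <= N -> y s <= limx t.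
Proof.
move=> s0 st tN; have sI : 0 <= s <= N by rewrite s0 (le_trans st).
rewrite /limx; case: (leP t 0) => [t0|t0].
  have -> : s = 0 by apply/eqP; rewrite eq_le s0 (le_trans st t0).
  by rewrite limx0.
case: (leP N t) => [_|tltN]; first by case/andP: (limx_range sI).
have [ne _] : has_inf [set y s | s in [set s | t < s <= N]].
  by apply: has_inf_limx; rewrite (ltW t0).
apply: lb_le_inf ne _ => z [u /= /andP[tu uN] <-].
by apply: limx_nondecreasing => //; exact: le_trans st (ltW tu).
Qed.

Lemma limx_range' t : 0 <= t <= N -> 0 <= limx t <= 1.
Proof.
move=> /andP[t0 tN]; apply/andP; split.
  by apply: le_trans (le_limx (lexx 0) t0 tN); rewrite limx0.
have [ltN|] := ltP t N; first by rewrite -limxn; exact: limx_le.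
by rewrite /limx => ->; case: ifP.
Qed.

Lemma limx_homo s t : 0 <= s -> s <= t -> t <= N -> limx s <= limx t.
Proof.
move=> s0; rewrite le_eqVlt => /orP[/eqP->//|st] tN.
have [ltN|Nt] := ltP t N; last first.
  have -> : limx t = 1.
    by rewrite /limx Nt leNgt (le_lt_trans s0 st).
  have sI : 0 <= s <= N by rewrite s0 (le_trans (ltW st)).
  by case/andP: (limx_range' sI).
by apply: le_trans (limx_le s0 st tN) _; exact: le_limx (le_trans s0 (ltW st)) (lexx t) tN.
Qed.

Lemma limx_right_continuous t : 0 < t < N -> limx s @[s --> t^'+] --> limx t.
Proof.
move=> /andP[t0 tN]; apply/cvgrPdist_le => e e0.
have hi : has_inf [set y s | s in [set s | t < s <= N]].
  by apply: has_inf_limx; rewrite (ltW t0).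
have [z [s /= /andP[ts sN] <-] ys] := inf_adherent e0 hi.
have limtE : limx t = inf [set y s | s in [set s | t < s <= N]].
  by rewrite /limx !leNgt t0 tN.
rewrite -limtE in ys.
near=> u.
have tu : t < u by near: u; exact: nbhs_right_gt.
have us : u < s by near: u; exact: nbhs_right_lt.
have h1 : limx t <= limx u.
  by apply: limx_homo; [exact: ltW|exact: ltW|exact: le_trans (ltW us) sN].
have h2 : limx u <= y s by apply: limx_le => //; exact: ltW (lt_trans t0 tu).
by rewrite distrC ger0_norm ?subr_ge0//; lra.
Unshelve. all: by end_near. Qed.

Lemma limx_at0 : limx 0 = 0. Proof. by rewrite /limx lexx. Qed.

Lemma limx_atn : limx N = 1. Proof. by rewrite /limx lexx leNgt N0. Qed.

Definition lim_pair : cs_pair Q := @CSPair R n Q limx Psi limx_range' limx_homo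
  limx_right_continuous limx_at0 limx_atn limPhi_psd limPhi_lipschitz limPhi_monotone
  limPhi_trace limPhi0 limPhin.

End LimitPair.

Section LimitPairCvg.
Context {R : realType} {n : nat} {Q : 'M[R]_n}.
Local Notation mu := (@lebesgue_measure R).
Hypothesis n0 : (0 < n)%N.
Let N : R := n%:R.
Let N0 : 0 < N. Proof. by rewrite ltr0n. Qed.
Let N00 : 0 <= N. Proof. exact: ltW N0. Qed.
Implicit Types p q : cs_pair Q.
Variable F : set_system (cs_pair Q).
Hypothesis FP : ProperFilter F.
Variables (y : R -> R) (Psi : R -> 'M[R]_n).
Hypothesis hy : forall t, 0 <= t <= N -> csx p t @[p --> F] --> y t.
Hypothesis hPsi : forall t i j, 0 <= t <= N -> csPhi p t i j @[p --> F] --> Psi t i j.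
Let r := lim_pair n0 FP hy hPsi.

Let rle s t : 0 <= s -> s < t -> t <= N -> csx r s <= y t.
Proof. exact: (limx_le FP hy). Qed.

Let ler_ s t : 0 <= s -> s <= t -> t <= N -> y s <= csx r t.
Proof. exact: (le_limx n0 FP hy). Qed.

Let ynd s t : 0 <= s -> s <= t -> t <= N -> y s <= y t.
Proof. exact: (limx_nondecreasing FP hy). Qed.

(** By monotonicity both functions stay between [y s] and [y t] on the cell, up to [e]. *)
Lemma limx_cell p (s t e : R) : 0 <= s -> s <= t -> t <= N -> 0 <= e ->
  `|csx p s - y s| <= e -> `|csx p t - y t| <= e ->
  \int[mu]_(u in `[s, t]) `|csx r u - csx p u| <= (y t - y s + e) * (t - s).
Proof.
move=> s0 st tN e0 ps pt.
have uI u : s <= u <= t -> 0 <= u <= N by move=> /andP[/(le_trans s0)-> /le_trans->].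
pose g u := Num.min (csx r u) (y t).
have bp : bmeas s t (csx p) by exact: csx_bmeas.
have br : bmeas s t (csx r) by exact: csx_bmeas.
(* [g] is [csx r] except possibly at [t], where [csx r] may exceed [y t]. *)
have bg : bmeas s t g.
  apply: bmeas_nondecreasing => u v su uv vt; rewrite /g.
  have h := @csx_nondecreasing _ _ _ r u v (le_trans s0 su) uv (le_trans vt tN).
  by rewrite le_min !ge_min h lexx /= orbT.
have -> : \int[mu]_(u in `[s, t]) `|csx r u - csx p u| = \int[mu]_(u in `[s, t]) `|g u - csx p u|.
  apply: bint_eq_oo => //; [by apply: bmeas_norm; exact: bmeasB|by apply: bmeas_norm; exact: bmeasB|].
  move=> u /andP[su ut]; rewrite /g min_l//.
  by apply: rle => //; exact: le_trans (ltW su).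
have b : bmeas s t (fun u => `|g u - csx p u|) by apply: bmeas_norm; exact: bmeasB.
rewrite -(bint_cst (y t - y s + e) st); apply: bint_le => //; first exact: bmeas_cst.
move=> u su.
have /andP[su1 ut] := su; have uN := uI u su.
have h1 : csx p s <= csx p u by exact: csx_nondecreasing (le_trans ut tN).
have h2 : csx p u <= csx p t by apply: csx_nondecreasing => //; case/andP: uN.
have h3 : y s <= g u.
  by rewrite /g le_min ynd// andbT; apply: ler_ => //; exact: le_trans tN.
have h4 : g u <= y t by rewrite /g ge_min lexx orbT.
move: ps pt; rewrite !ler_norml => /andP[a1 a2] /andP[a3 a4].
by apply/andP; split; lra.
Qed.

Section grid.
Variables (M : nat) (p : cs_pair Q).
Hypothesis M0 : (0 < M)%N.
Let d : R := N / M%:R.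
Hypothesis px : forall i : 'I_M.+1, `|csx p (i%:R * d) - y (i%:R * d)| <= d.
Hypothesis pPhi : forall (i : 'I_M.+1) k l,
  `|csPhi p (i%:R * d) k l - Psi (i%:R * d) k l| <= d.

Let Mp : (0 : R) < M%:R. Proof. by rewrite ltr0n. Qed.
Let d0 : 0 < d. Proof. by rewrite divr_gt0. Qed.
Let Md : M%:R * d = N. Proof. by rewrite /d mulrC divfK// gt_eqF. Qed.
Let gridI i : (i <= M)%N -> 0 <= i%:R * d <= N.
Proof.
by move=> iM; rewrite mulr_ge0 ?ler0n ?(ltW d0)//= -Md ler_wpM2r ?(ltW d0)// ler_nat.
Qed.

(** The oscillations of [y] over the cells telescope: for monotone functions, closeness at the grid
    points gives L1 closeness. *)
Lemma limx_grid k : (k <= M)%N ->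
  \int[mu]_(u in `[0, k%:R * d]) `|csx r u - csx p u| <=
  (y (k%:R * d) - y 0 + k%:R * d) * d.
Proof.
elim: k => [_|k IH kM]; first by rewrite !mul0r bint_set1 subrr add0r mul0r.
have /andP[a0 aN] := gridI (ltnW kM); have /andP[b0 bN] := gridI kM.
have dE : k.+1%:R * d - k%:R * d = d by rewrite -mulrBl -natrB// subSnn mul1r.
have ab : k%:R * d <= k.+1%:R * d by rewrite -subr_ge0 dE ltW.
rewrite (@bint_split _ 0 (k%:R * d))//; last first.
  by apply: bmeas_norm; apply: bmeasB; exact: csx_bmeas.
have h1 := IH (ltnW kM).
have k1 : (k < M.+1)%N by exact: ltnW.
have h2 := limx_cell a0 ab bN (ltW d0) (px (Ordinal k1)) (px (Ordinal (kM : (k.+1 < M.+1)%N))).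
rewrite dE in h2; apply: le_trans (lerD h1 h2) _.
rewrite -mulrDl le_eqVlt; apply/orP; left; apply/eqP; congr (_ * _).
by rewrite -[k.+1%:R * d](subrK (k%:R * d)) dE; ring.
Qed.

Lemma limPhi_grid t k l : 0 <= t <= N -> `|csPhi r t k l - csPhi p t k l| <= 3 * d.
Proof.
move=> tN; have /andP[t0 tn] := tN.
pose i := Num.truncn (t / d).
have td0 : 0 <= t / d by rewrite divr_ge0// ltW.
have /andP[i1 i2] : (i%:R <= t / d < i.+1%:R) by rewrite -truncn_eq.
have iM : (i <= M)%N.
  rewrite -(ler_nat R); apply: le_trans i1 _.
  by rewrite ler_pdivrMr// Md.
have h1 : i%:R * d <= t by rewrite -ler_pdivlMr.
have h2 : t < (i%:R + 1) * d by rewrite -ltr_pdivrMr// natr1.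
have gI := gridI iM.
have iM' : (i < M.+1)%N by [].
have p1 := pPhi (Ordinal iM') k l; rewrite /= in p1.
have dt : `|t - i%:R * d| <= d by rewrite ger0_norm ?subr_ge0//; lra.
have q1 := le_trans (csPhi_lipschitz r k l gI tN) dt.
have q2 := le_trans (csPhi_lipschitz p k l gI tN) dt.
have -> : csPhi r t k l - csPhi p t k l = (csPhi r t k l - csPhi r (i%:R * d) k l) -
  (csPhi p (i%:R * d) k l - Psi (i%:R * d) k l) - (csPhi p t k l - csPhi p (i%:R * d) k l).
  by rewrite /=; ring.
apply: le_trans (ler_normB _ _) _; apply: le_trans (lerD (ler_normB _ _) (lexx _)) _.
apply: le_trans (lerD (lerD q1 p1) q2) _; lra.
Qed.

Lemma cs_dist_grid : cs_dist r p <= (4 + N) * d.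
Proof.
have h1 : csx_dist r p <= (1 + N) * d.
  rewrite /csx_dist -/N -Md; apply: le_trans (limx_grid (leqnn M)) _.
  rewrite ler_wpM2r ?(ltW d0)// lerD2r Md (limxn n0 FP hy) (limx0 n0 FP hy) subr0.
  exact: lexx.
have h2 : csPhi_dist r p <= 3 * d.
  have d3 : 0 <= 3 * d by rewrite mulr_ge0// ltW.
  apply/bigmax_leP; split=> [//|i _]; apply/bigmax_leP; split=> [//|j _].
  apply: ge_sup.
    by exists `|csPhi r 0 i j - csPhi p 0 i j|, 0 => //=; rewrite in_itv/= lexx N00.
  by move=> z [t /=]; rewrite in_itv/= => tN <-; exact: limPhi_grid.
by rewrite /cs_dist; apply: le_trans (lerD h1 h2) _; lra.
Qed.

End grid.

(** The mesh depends on [e] only, so finitely many pointwise limits are used at once, as a filter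
    permits. *)
Lemma lim_pair_dist (e : R) : 0 < e -> \forall p \near F, cs_dist r p < e.
Proof.
move=> e0; pose M := (Num.truncn ((4 + N) * N / e)).+1.
have Mp : (0 : R) < M%:R by rewrite ltr0n.
have Me : (4 + N) * (N / M%:R) < e.
  rewrite mulrA ltr_pdivrMr// (mulrC e) -ltr_pdivrMr//; exact: truncnS_gt.
have d0 : 0 < N / M%:R by rewrite divr_gt0.
have gI (i : 'I_M.+1) : 0 <= i%:R * (N / M%:R) <= N.
  rewrite mulr_ge0 ?ler0n ?(ltW d0)//= mulrC mulrAC ler_pdivrMr// ler_wpM2l// ler_nat.
  exact: leq_ord i.
have near1 : \forall p \near F, forall i : 'I_M.+1,
    `|csx p (i%:R * (N / M%:R)) - y (i%:R * (N / M%:R))| <= N / M%:R.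
  apply: filter_forall => i; have /cvgrPdist_le/(_ _ d0) := hy (gI i).
  by apply: filterS => p; rewrite distrC.
have near2 : \forall p \near F, forall (i : 'I_M.+1) (k l : 'I_n),
    `|csPhi p (i%:R * (N / M%:R)) k l - Psi (i%:R * (N / M%:R)) k l| <= N / M%:R.
  apply: filter_forall => i; apply: filter_forall => k; apply: filter_forall => l.
  have /cvgrPdist_le/(_ _ d0) := @hPsi _ k l (gI i).
  by apply: filterS => p; rewrite distrC.
apply: filterS2 near1 near2 => p p1 p2.
exact: le_lt_trans (cs_dist_grid (ltn0Sn _) p1 p2) Me.
Qed.

(** The limit pair may reach 1 before [tau], so only [t_x <= tau] holds. The bound passes to the gap
    at [tau], being made of closed inequalities, and then to the larger gap at [t_x]. *)
Lemma lim_pair_gap_bound (L tau : R) : 0 <= tau <= N ->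
  cs_tx p @[p --> F] --> tau ->
  (\forall p \near F, gap_bound L (cs_gap p)) -> gap_bound L (cs_gap r).
Proof.
move=> /andP[tau0 tauN] ctau gF.
have tauI : 0 <= tau <= N by rewrite tau0.
have tx (p : cs_pair Q) : 0 <= cs_tx p <= N.
  by rewrite cs_txE (cs_level_ge0 p n0 (lexx 1)) (cs_level_leN p n0 (lexx 1)).
have after t : tau < t -> t <= N -> csx r t = 1.
  move=> taut tN; pose s := (tau + t) / 2.
  have [taus st] : tau < s /\ s < t by split; rewrite /s; lra.
  have sI : 0 <= s <= N by rewrite (le_trans tau0 (ltW taus)) (le_trans (ltW st) tN).
  have ys : 1 <= y s.
    apply: (cvgr_to_ge (hy sI)).
    have near1 : \forall p \near F, cs_tx p < s by exact: (cvgr_lt tau ctau).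
    apply: filterS near1 => p ps; rewrite (csx_after_tx n0 ps)//.
    by case/andP: sI.
  apply/eqP; rewrite eq_le csx_le1 ?tN ?(le_trans tau0 (ltW taut))//=.
  by apply: le_trans ys _; apply: ler_ => //; [case/andP: sI|exact: ltW].
have txr : cs_tx r <= tau.
  rewrite leNgt; apply/negP => h; pose s := (tau + cs_tx r) / 2.
  have [taus st] : tau < s /\ s < cs_tx r by split; rewrite /s; lra.
  have sN : s <= N by apply: le_trans (ltW st) _; case/andP: (tx r).
  have s0 : 0 <= s by exact: le_trans tau0 (ltW taus).
  have := csx_before_level n0 (lexx 1) s0 (_ : s < cs_level r 1).
  by rewrite -cs_txE (after s taus sN) ltxx => /(_ st).
have cPhi i j : csPhi p (cs_tx p) i j @[p --> F] --> Psi tau i j.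
  apply/cvgrPdist_le => e e0; have e2 : 0 < e / 2 by rewrite divr_gt0.
  have /cvgrPdist_le/(_ _ e2) n1 := ctau.
  have /cvgrPdist_le/(_ _ e2) n2 := @hPsi _ i j tauI.
  apply: filterS2 n1 n2 => p p1 p2.
  have p3 := le_trans (csPhi_lipschitz p i j (tx p) tauI) p1.
  have -> : Psi tau i j - csPhi p (cs_tx p) i j = (Psi tau i j - csPhi p tau i j) +
    (csPhi p tau i j - csPhi p (cs_tx p) i j) by ring.
  by apply: le_trans (ler_normD _ _) _; lra.
have cgap i j : cs_gap p i j @[p --> F] --> (Q - Psi tau) i j.
  have mxBE (A B : 'M[R]_n) : (A - B) i j = A i j - B i j by rewrite !mxE.
  rewrite mxBE; apply: cvg_trans (cvgB (cvg_cst (Q i j)) (cPhi i j)).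
  by apply: near_eq_cvg; apply: nearW => p; rewrite mxBE.
have gtau : gap_bound L (Q - Psi tau).
  split; first exact: (csPhi_gap_psd r tauI).
  move=> w j.
  have qc : qform (cs_gap p) w @[p --> F] --> qform (Q - Psi tau) w by exact: qform_limit.
  apply: (cvgr_to_le (cvgB (cvg_cst (2 * w j 0)) qc)).
  by apply: filterS gF => p [_]; exact.
apply: gap_bound_mono gtau _.
have -> : cs_gap r - (Q - Psi tau) = Psi tau - csPhi r (cs_tx r).
  by rewrite /cs_gap opprB addrC addrA subrK.
by apply: (csPhi_monotone r) => //; case/andP: (tx r).
Qed.

End LimitPairCvg.

(** * The minimum *)

Lemma step_right_continuous (R : realType) (x := fun t : R => if t <= 0 then 0 else 1 : R)
    (t : R) : 0 < t -> x s @[s --> t^'+] --> x t.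
Proof.
move=> t0; have c : (fun=> x t) s @[s --> t^'+] --> x t by exact: cvg_cst.
apply: cvg_trans c; apply: near_eq_cvg.
near=> s; have ts : t < s by near: s; exact: nbhs_right_gt.
by rewrite /x !leNgt t0 (lt_trans t0 ts).
Unshelve. all: by end_near. Qed.

Section Minimum.
Context {R : realType} {n : nat} {Q : 'M[R]_n}.
Local Notation mu := (@lebesgue_measure R).
Variables (h : 'cV[R]_n) (beta : nat -> 'cV[R]_n).
Hypothesis n0 : (0 < n)%N.
Hypothesis hsum : forall j : 'I_n,
  (\sum_(2 <= p <oo) (2 ^+ p * beta p j 0 ^+ 2)%:E < +oo)%E.
Hypothesis Q1 : forall j, Q j j = 1.
Hypothesis pQ : pdmx Q.
Let N : R := n%:R.
Let N0 : 0 < N. Proof. by rewrite ltr0n. Qed.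
Implicit Types p q : cs_pair Q.
Let L := cs_L h beta Q.
Let A := csA Q (cs_T h beta Q) L.
Let L0 : 0 < L.
Proof. exact: lt_trans ltr01 (cs_L_gt1 h n0 hsum Q1 pQ). Qed.

(** Along an ultrafilter [x], the entries of [Phi] and [t_x] converge pointwise, and [lim_pair]
    assembles the limits. *)
Lemma csA_compact : compact A.
Proof.
rewrite compact_ultra => F FU FA.
have FP : ProperFilter F by exact: ultra_proper.
have [y hy] : exists y : R -> R, forall t, 0 <= t <= N -> csx p t @[p --> F] --> y t.
  suff /choice[f hf] : forall t, exists l : R, 0 <= t <= N -> csx p t @[p --> F] --> l.
    by exists f => t; exact: hf.
  move=> t; have [tN|tN] := boolP (0 <= t <= N); last by exists 0.
  have [p|l hl] := @ultra_bounded_cvg R _ F FU (fun p => csx p t) 1; last by exists l.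
  by rewrite ger0_norm ?csx_le1 ?csx_ge0.
have [Psi hPsi] : exists Psi : R -> 'M[R]_n, forall t i j, 0 <= t <= N ->
    csPhi p t i j @[p --> F] --> Psi t i j.
  suff /choice[f hf] : forall u : R * ('I_n * 'I_n), exists l : R, 0 <= u.1 <= N ->
      csPhi p u.1 u.2.1 u.2.2 @[p --> F] --> l.
    exists (fun t => \matrix_(i, j) f (t, (i, j))) => t i j tN.
    by rewrite mxE; exact: (hf (t, (i, j))).
  move=> [t [i j]] /=; have [tN|tN] := boolP (0 <= t <= N); last by exists 0.
  have [p|l hl] := @ultra_bounded_cvg R _ F FU (fun p => csPhi p t i j) 1; last by exists l.
  exact: csPhi_entry_le1.
have tx p : 0 <= cs_tx p <= N.
  by rewrite cs_txE (cs_level_ge0 p n0 (lexx 1)) (cs_level_leN p n0 (lexx 1)).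
have [tau ctau] : exists tau : R, cs_tx p @[p --> F] --> tau.
  apply: (@ultra_bounded_cvg R _ F FU _ N) => p.
  by case/andP: (tx p) => t0 tN; rewrite ger0_norm.
have tau0 : 0 <= tau by apply: (cvgr_to_ge ctau); apply: nearW => p; case/andP: (tx p).
have tauN : tau <= N by apply: (cvgr_to_le ctau); apply: nearW => p; case/andP: (tx p).
exists (lim_pair n0 FP hy hPsi); split.
  apply/(csAP h n0 hsum Q1 pQ); apply: (lim_pair_gap_bound n0 FP hy hPsi _ ctau).
    by rewrite tau0.
  by apply: filterS FA => p /(csAP h n0 hsum Q1 pQ).
move=> B /nbhs_ballP[e /= e0 eB]; apply: (filterS eB).
exact: (lim_pair_dist n0 FP hy hPsi e0).
Qed.

(** The straight path to [Q] with [x = 1] on []0, n]]. The reduction applied to it shows that [csA]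
    is nonempty. *)
Lemma cs_pair_linear : exists p : cs_pair Q, cs_dom p.
Proof.
have N1 : 1 <= N by rewrite /N ler1n.
pose x (t : R) : R := if t <= 0 then 0 else 1.
pose Phi (t : R) := (t / N) *: Q.
have x_range t : 0 <= t <= N -> 0 <= x t <= 1.
  by rewrite /x; case: ifP => _ _; rewrite ?lexx ?ler01.
have x_nd s t : 0 <= s -> s <= t -> t <= N -> x s <= x t.
  move=> _ st _; rewrite /x; case: (leP s 0) => s0; case: (leP t 0) => t0 //.
  by have := lt_le_trans s0 (le_trans st t0); rewrite ltxx.
have x_rc t : 0 < t < N -> x s @[s --> t^'+] --> x t.
  by move=> /andP[t0 _]; exact: step_right_continuous.
have x0 : x 0 = 0 by rewrite /x lexx.
have xN : x N = 1 by rewrite /x leNgt N0.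
have psQ := pdmx_psd pQ.
have P_psd t : 0 <= t <= N -> psdmx (Phi t).
  by move=> /andP[t0 _]; apply: psdmxZ => //; rewrite divr_ge0.
have P_lip s t i j : 0 <= s <= N -> 0 <= t <= N -> `|Phi t i j - Phi s i j| <= `|t - s|.
  move=> _ _; have -> : Phi t i j - Phi s i j = (t - s) * (N^-1 * Q i j).
    by rewrite /Phi !mxE; ring.
  rewrite normrM ler_piMr// normrM ger0_norm ?invr_ge0//.
  apply: mulr_ile1; rewrite ?invr_ge0 ?invf_le1//.
  by apply: psdmx_entry_le1 => // k; rewrite Q1.
have P_mon s t : 0 <= s -> s <= t -> t <= N -> psdmx (Phi t - Phi s).
  move=> _ st _; rewrite /Phi -scalerBl -mulrBl; apply: psdmxZ => //.
  by rewrite divr_ge0 ?subr_ge0.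
have P_tr t : 0 <= t <= N -> \tr (Phi t) = t.
  move=> _; rewrite /Phi mxtraceZ /mxtrace (eq_bigr (fun=> 1)) => [|i _]; last exact: Q1.
  by rewrite sumr_const card_ord -/N divfK// gt_eqF.
have P0 : Phi 0 = 0 by rewrite /Phi mul0r scale0r.
have PN : Phi N = Q by rewrite /Phi divff ?scale1r// gt_eqF.
pose p : cs_pair Q := @CSPair R n Q x Phi x_range x_nd x_rc x0 xN P_psd P_lip P_mon P_tr P0 PN.
exists p.
have N2 : 0 < N / 2 by rewrite divr_gt0.
(* Any bound below [N] makes the gap a positive multiple of [Q]. *)
have txN : cs_tx p <= N / 2.
  rewrite cs_txE; apply: cs_level_le; first by rewrite (ltW N2); lra.
  by rewrite /= /x [N / 2 <= 0]leNgt N2.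
have c0 : 0 < 1 - cs_tx p / N by rewrite subr_gt0 ltr_pdivrMr// mul1r; lra.
have gapE : cs_gap p = (1 - cs_tx p / N) *: Q by rewrite scalerBl scale1r.
by rewrite /cs_dom /= gapE detZ mulr_gt0 ?exprn_gt0// pdmx_det_gt0.
Qed.

(** The direct method with filters: sublevel sets within [csA] generate a proper filter, and at its
    cluster point the local Lipschitz bound gives a value at most that of any [q]. *)
Lemma csA_min : exists2 p, A p & forall q, A q ->
  CrisantiSommers h beta p <= CrisantiSommers h beta q.
Proof.
pose C := CrisantiSommers (Q := Q) h beta.
pose S (p : cs_pair Q) : set (cs_pair Q) := [set q | A q /\ C q <= C p].
have [p0 Ap0] : exists p, A p.
  have [q dq] := cs_pair_linear.
  have [p [gp _]] := cs_reduction h n0 hsum Q1 pQ dq ltr01.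
  by exists p; apply/(csAP h n0 hsum Q1 pQ).
have FF : Filter (filter_from A S).
  apply: filter_from_filter; first by exists p0.
  move=> p q Ap Aq; have [pq|qp] := leP (C p) (C q).
    exists p; [exact: Ap|move=> s [As sp]].
    by split; split; [exact: As|exact: sp|exact: As|exact: le_trans sp pq].
  exists q; [exact: Aq|move=> s [As sq]].
  by split; split; [exact: As|exact: le_trans sq (ltW qp)|exact: As|exact: sq].
have FP : ProperFilter (filter_from A S).
  apply: filter_from_proper => p Ap.
  by exists p; split; [exact: Ap|exact: lexx].
have FA : filter_from A S A by exists p0; [exact: Ap0|move=> s []].
have [r [Ar cr]] := csA_compact FP FA.
exists r; [exact: Ar|move=> q Aq; rewrite -/(C r) -/(C q); apply/ler_addgt0Pr => e e0].
have [M M0 hM] := CrisantiSommers_lipschitz h n0 hsum Q1 L0.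
(* The 1 puts nearby pairs in the range of the Lipschitz bound, and [e] is the tolerance. *)
pose d := Num.min 1 e / M; have d0 : 0 < d by rewrite divr_gt0// lt_min ltr01.
have nr : nbhs r (ball r d) by exact: nbhsx_ballx.
have Sq : filter_from A S (S q) by exists q; [exact: Aq|exact: subset_refl].
have [s [[As sq] rs]] := cr _ _ Sq nr.
have rs' : cs_dist r s < d by exact: rs.
have Mrs : M * cs_dist r s <= Num.min 1 e.
  by rewrite mulrC -ler_pdivlMr// ltW.
have Mrs1 : M * cs_dist r s <= 1 by apply: le_trans Mrs _; rewrite ge_min lexx.
have Mrse : M * cs_dist r s <= e by apply: le_trans Mrs _; rewrite ge_min lexx orbT.
have gr := (csAP h n0 hsum Q1 pQ r).1 Ar.
have gs := (csAP h n0 hsum Q1 pQ s).1 As.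
have := le_trans (hM r s gr gs Mrs1) Mrse.
rewrite ler_distlC => /andP[h1 _]; rewrite lerBlDr in h1.
exact: le_trans h1 (lerD sq (lexx e)).
Qed.

End Minimum.

Theorem proposition1 (R : realType) (n : nat)
    (h : 'cV[R]_n) (beta : nat -> 'cV[R]_n) (Q : 'M[R]_n) :
  (1 <= n)%N ->
  (forall p : nat, (2 <= p)%N -> odd p -> beta p = 0) ->
  (forall j : 'I_n,
    (\sum_(2 <= p <oo) (2 ^+ p * beta p j 0 ^+ 2)%:E < +oo)%E) ->
  pdmx Q ->
  (forall j : 'I_n, Q j j = 1) ->
  (forall j j' : 'I_n, -1 <= Q j j' <= 1) ->
  compact (csA Q (cs_T h beta Q) (cs_L h beta Q)) /\
  exists2 p : cs_pair Q, csA Q (cs_T h beta Q) (cs_L h beta Q) p &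
    forall q : cs_pair Q, cs_dom q ->
      CrisantiSommers h beta p <= CrisantiSommers h beta q.
Proof.
move=> n0 _ hsum pQ Q1 _; split; first exact: csA_compact.
have [p Ap minp] := csA_min h n0 hsum Q1 pQ.
(* As [q] may lie outside [csA], the minimum is compared with a point of [csA] whose value exceeds
   that of [q] by at most [e]. *)
exists p; [exact: Ap|move=> q dq; apply/ler_addgt0Pr => e e0].
have [p' [gp' p'q]] := cs_reduction h n0 hsum Q1 pQ dq e0.
apply: le_trans p'q; apply: minp; exact: (csAP h n0 hsum Q1 pQ p').2 gp'.
Qed.
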